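(* Consider the closed-loop linear delay system with gain $K$, the supply rate function $\mathsf s$, and the decomposition data ($\boldsymbol f_i,\boldsymbol\varphi_i,\boldsymbol\phi_i,M_i,\widehat A_i,\widehat B_i,\widehat C_i,\widehat{\mathfrak B}_i$, $i\in\mathbb{N}_\nu$) described in the context, and assume the decomposition data are given. Let $d=\sum_{i=1}^\nu d_i$, $\varrho=dn$. Suppose there exist $K\in\mathbb{R}^{p\times n}$, $P_1\in\mathbb{S}^n$, $P_2\in\mathbb{R}^{n\times\varrho}$, $P_3\in\mathbb{S}^{\varrho}$ and $Q_i,R_i\in\mathbb{S}^n$, $i\in\mathbb{N}_\nu$, such that $$\begin{bmatrix}P_1&P_2\\ P_2^\top&P_3\end{bmatrix}+\Big[\mathsf O_n\oplus\Big(\operatorname{diag}_{i=1}^{\nu}(I_{d_i}\otimes Q_i)\Big)\Big]\succ0,$$ $$\mathbf Q=\operatorname{diag}_{i=1}^\nu Q_i\succ0,\qquad \mathbf R=\operatorname{diag}_{i=1}^\nu R_i\succ0,$$ $$\begin{bmatrix}\boldsymbol\Psi&\boldsymbol\Sigma^\top\widetilde J^\top\\ \widetilde J\boldsymbol\Sigma&J_1\end{bmatrix}=\mathsf{Sy}\big[\mathbf P^\top\boldsymbol\Pi\big]+\boldsymbol\Phi\prec0,$$ where, with the matrices $\mathbf A,\mathbf B_1,\mathbf C,\mathbf B_2,\widehat I,\mathbf M$ and dimensions $\beta,\varkappa,\mu,\kappa$ of the context, $$\boldsymbol\Omega=\mathbf A+\mathbf B_1[(I_\beta\otimes K)\oplus\mathsf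 O_q],\qquad \boldsymbol\Sigma=\mathbf C+\mathbf B_2[(I_\beta\otimes K)\oplus\mathsf O_q],$$ $$\boldsymbol\Psi=\mathsf{Sy}\left(S^\top\begin{bmatrix}P_1&P_2\\ P_2^\top&P_3\end{bmatrix}\begin{bmatrix}\boldsymbol\Omega\\ \begin{bmatrix}\mathbf M\otimes I_n&\mathsf O_{dn,(\mu n+q)}\end{bmatrix}\end{bmatrix}-\begin{bmatrix}\mathsf O_{(\beta n),m}\\ J_2^\top\end{bmatrix}\boldsymbol\Sigma\right)+\Xi,$$ $$S=\begin{bmatrix}I_n&\mathsf O_{n,\nu n}&\mathsf O_{n,\varkappa n}&\mathsf O_{n,\mu n}&\mathsf O_{n,q}\\ \mathsf O_{dn,n}&\mathsf O_{dn,\nu n}&\widehat I&\mathsf O_{dn,\mu n}&\mathsf O_{dn,q}\end{bmatrix},$$ $$\Xi=\big[(\mathbf Q+\mathbf R\Lambda)\oplus\mathsf O_n\oplus\mathsf O_{\kappa n}\oplus\mathsf O_q\big]-\Big[\mathsf O_n\oplus\mathbf Q\oplus\big[\operatorname{diag}_{i=1}^\nu (I_{\varkappa_i}\otimes R_i)\big]\oplus\big[\operatorname{diag}_{i=1}^\nu (I_{\mu_i}\otimes R_i)\big]\oplus J_3\Big],$$ $$\Lambda=\operatorname{diag}_{i=1}^\nu (r_i-r_{i-1})I_n,$$ $$\mathbf P=\begin{bmatrix}P_1&\mathsf O_{n,\nu n}&P_2\widehat I&\mathsf O_{n,(\mu n+q+m)}\end{bmatrix},\qquad \boldsymbol\Pi=\begin{bmatrix}\boldsymbol\Omega&\mathsf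 O_{n,m}\end{bmatrix},$$ $$\boldsymbol\Phi=\mathsf{Sy}\left(\begin{bmatrix}P_2\\ \mathsf O_{\nu n,dn}\\ \widehat I^\top P_3\\ \mathsf O_{(\mu n+q+m),dn}\end{bmatrix}\begin{bmatrix}\mathbf M\otimes I_n&\mathsf O_{dn,(\mu n+q+m)}\end{bmatrix}+\begin{bmatrix}\mathsf O_{(\beta n),m}\\ -J_2^\top\\ \widetilde J\end{bmatrix}\begin{bmatrix}\boldsymbol\Sigma&\mathsf O_m\end{bmatrix}\right)+(\Xi\oplus J_1).$$ Then the closed-loop system with this $K$ is dissipative with respect to $\mathsf s$, and the origin of the closed-loop system with $\boldsymbol w(t)\equiv\mathbf 0_q$ is globally exponentially stable.
   Context: Notation. $\mathbb{S}^k$ is the set of real symmetric $k\times k$ matrices; $\succ0,\prec0,\preceq0$ denote positive definite, negative definite, negative semidefinite; $\mathsf{Sy}(X)=X+X^\top$; $\otimes$ is the Kronecker product; $X\oplus Y$ is the block-diagonal matrix with blocks $X,Y$ and $\operatorname{diag}_{i=1}^\nu X_i=X_1\oplus\cdots\oplus X_\nu$ (also for non-square blocks, including column vectors); $[\![X_i]\!]_{i=1}^{\nu}=[X_1\ \cdots\ X_\nu]$ and $[X_i]_{i=1}^\nu$ denote row-wise and column-wise concatenation; $\mathsf O_{a,b}$ is the $a\times b$ zero matrix, $\mathsf O_a=\mathsf O_{a,a}$, $\mathbf 0_a=\mathsf O_{a,1}$. Matrices with a zero dimension are empty and are omitted. $\mathbb{N}_\nu=\{1,\dots,\nu\}$.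 $\mathscr{L}^2$ denotes square-integrable measurable functions and $\mathscr{W}^{1,2}$ the $\mathscr{L}^2$ functions with weak derivative in $\mathscr{L}^2$ (the continuous representative is used for point values). System. Let $n,m,p,q,\nu\in\mathbb{N}$, $0=r_0<r_1<\cdots<r_\nu=r$, $\mathcal{J}=[-r,0]$, $\mathcal{I}_i=[-r_i,-r_{i-1}]$, $t_0\in\mathbb{R}$. Given are constant matrices $A_i\in\mathbb{R}^{n\times n}$, $B_i\in\mathbb{R}^{n\times p}$, $C_i\in\mathbb{R}^{m\times n}$, $\mathfrak B_i\in\mathbb{R}^{m\times p}$ ($i=0,\dots,\nu$), $D_1\in\mathbb{R}^{n\times q}$, $D_2\in\mathbb{R}^{m\times q}$ and functions $\widetilde A_i\in\mathscr{L}^2(\mathcal{I}_i;\mathbb{R}^{n\times n})$, $\widetilde B_i\in\mathscr{L}^2(\mathcal{I}_i;\mathbb{R}^{n\times p})$, $\widetilde C_i\in\mathscr{L}^2(\mathcal{I}_i;\mathbb{R}^{m\times n})$, $\widetilde{\mathfrak B}_i\in\mathscr{L}^2(\mathcal{I}_i;\mathbb{R}^{m\times p})$ ($i\in\mathbb{N}_\nu$). For $K\in\mathbb{R}^{p\times n}$ the closed-loop system (obtained from the open-loop delay system with state feedback $\boldsymbol u(t)=K\boldsymbol x(t)$) is $$\dot{\boldsymbol x}(t)=\sum_{i=0}^\nu(A_i+B_iK)\boldsymbol x(t-r_i)+\sum_{i=1}^\nu\int_{\mathcal{I}_i}(\widetilde A_i(\tau)+\widetilde B_i(\tau)K)\boldsymbol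 x(t+\tau)\,\mathrm d\tau+D_1\boldsymbol w(t),$$ $$\boldsymbol z(t)=\sum_{i=0}^\nu(C_i+\mathfrak B_iK)\boldsymbol x(t-r_i)+\sum_{i=1}^\nu\int_{\mathcal{I}_i}(\widetilde C_i(\tau)+\widetilde{\mathfrak B}_i(\tau)K)\boldsymbol x(t+\tau)\,\mathrm d\tau+D_2\boldsymbol w(t),$$ for almost all $t\ge t_0$, with $\boldsymbol x(t_0+\theta)=\boldsymbol\psi(\theta)$, $\theta\in\mathcal{J}$, $\boldsymbol\psi\in\mathcal{C}(\mathcal{J};\mathbb{R}^n)$ (continuous functions with the sup norm $\|\cdot\|_\infty$), disturbance $\boldsymbol w\in\mathscr{L}^2([t_0,\infty);\mathbb{R}^q)$, and solutions in the sense of Carathéodory. Write $\mathbf x_t(\theta)=\boldsymbol x(t+\theta)$, $\theta\in\mathcal{J}$. Supply rate function. $$\mathsf s(\boldsymbol z,\boldsymbol w)=\begin{bmatrix}\boldsymbol z\\ \boldsymbol w\end{bmatrix}^\top\begin{bmatrix}\widetilde J^\top J_1^{-1}\widetilde J&J_2\\ J_2^\top&J_3\end{bmatrix}\begin{bmatrix}\boldsymbol z\\ \boldsymbol w\end{bmatrix}$$ with given $J_1\in\mathbb{S}^m$, $J_1^{-1}\prec0$, $\widetilde J\in\mathbb{R}^{m\times m}$, $\widetilde J^\top J_1^{-1}\widetilde J\preceq0$, $J_2\in\mathbb{R}^{m\times q}$, $J_3\in\mathbb{S}^q$. Dissipativity and stability. The closed-loop system is dissipative with respect to $\mathsf s$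 if there is a continuous storage functional $\mathsf v:\mathcal{C}(\mathcal{J};\mathbb{R}^n)\to[0,\infty)$ with $\mathsf v(0)=0$ such that along all solutions (all $\boldsymbol\psi$, all $\boldsymbol w\in\mathscr{L}^2$) $\mathsf v(\mathbf x_{t_2})-\mathsf v(\mathbf x_{t_1})\le\int_{t_1}^{t_2}\mathsf s(\boldsymbol z(t),\boldsymbol w(t))\,\mathrm dt$ for all $t_2\ge t_1\ge t_0$. The origin is globally exponentially stable if there are $c,\lambda>0$ with $\|\boldsymbol x(t)\|_2\le c\,e^{-\lambda(t-t_0)}\|\boldsymbol\psi\|_\infty$ for all $t\ge t_0$ and all $\boldsymbol\psi$. Decomposition data. For each $i\in\mathbb{N}_\nu$: $d_i\in\mathbb{N}$, $\delta_i,\mu_i\in\mathbb{N}\cup\{0\}$, $\varkappa_i=d_i+\delta_i$, $\kappa_i=d_i+\delta_i+\mu_i$; $\boldsymbol f_i\in\mathscr{W}^{1,2}(\mathcal{I}_i;\mathbb{R}^{d_i})$, $\boldsymbol\varphi_i\in\mathscr{L}^2(\mathcal{I}_i;\mathbb{R}^{\delta_i})$, $\boldsymbol\phi_i\in\mathscr{L}^2(\mathcal{I}_i;\mathbb{R}^{\mu_i})$; $\boldsymbol h_i=\begin{bmatrix}\boldsymbol\varphi_i\\ \boldsymbol f_i\end{bmatrix}$, $\boldsymbol g_i=\begin{bmatrix}\boldsymbol\phi_i\\ \boldsymbol h_i\end{bmatrix}$; constant matrices $M_i\in\mathbb{R}^{d_i\times\varkappa_i}$, $\widehat A_i\in\mathbb{R}^{n\times\kappa_in}$,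 $\widehat B_i\in\mathbb{R}^{n\times\kappa_ip}$, $\widehat C_i\in\mathbb{R}^{m\times\kappa_in}$, $\widehat{\mathfrak B}_i\in\mathbb{R}^{m\times\kappa_ip}$, such that (almost everywhere on $\mathcal{I}_i$) $\widetilde A_i=\widehat A_i(\boldsymbol g_i\otimes I_n)$, $\widetilde B_i=\widehat B_i(\boldsymbol g_i\otimes I_p)$, $\widetilde C_i=\widehat C_i(\boldsymbol g_i\otimes I_n)$, $\widetilde{\mathfrak B}_i=\widehat{\mathfrak B}_i(\boldsymbol g_i\otimes I_p)$, $\boldsymbol f_i'=M_i\boldsymbol h_i$ (weak derivative), and $\int_{\mathcal{I}_i}\boldsymbol g_i\boldsymbol g_i^\top\mathrm d\tau\succ0$. Derived matrices. $\mathfrak F_i=\int_{\mathcal{I}_i}\boldsymbol f_i\boldsymbol f_i^\top\mathrm d\tau$, $\mathfrak H_i=\int_{\mathcal{I}_i}\boldsymbol h_i\boldsymbol h_i^\top\mathrm d\tau$, $\Gamma_i=\int_{\mathcal{I}_i}\boldsymbol\phi_i\boldsymbol h_i^\top\mathrm d\tau$, $\boldsymbol\varepsilon_i=\boldsymbol\phi_i-\Gamma_i\mathfrak H_i^{-1}\boldsymbol h_i$, $\mathfrak E_i=\int_{\mathcal{I}_i}\boldsymbol\varepsilon_i\boldsymbol\varepsilon_i^\top\mathrm d\tau$; these Gram matrices $\mathfrak F_i,\mathfrak H_i,\mathfrak E_i$ are positive definite, with Cholesky factors (lower triangular) $\mathfrak F_i=\mathfrak L_{\boldsymbol f_i}\mathfrak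 L_{\boldsymbol f_i}^\top$, $\mathfrak H_i=\mathfrak L_{\boldsymbol h_i}\mathfrak L_{\boldsymbol h_i}^\top$, $\mathfrak E_i=\mathfrak L_{\boldsymbol\varepsilon_i}\mathfrak L_{\boldsymbol\varepsilon_i}^\top$. Put $$T_i=\begin{bmatrix}\Gamma_i\mathfrak L_{\boldsymbol h_i}^{-\top}\\ \mathfrak L_{\boldsymbol h_i}\end{bmatrix}\in\mathbb{R}^{\kappa_i\times\varkappa_i},\qquad \widetilde T_i=\begin{bmatrix}I_{\mu_i}\\ \mathsf O_{\varkappa_i,\mu_i}\end{bmatrix}\mathfrak L_{\boldsymbol\varepsilon_i}\in\mathbb{R}^{\kappa_i\times\mu_i},$$ $\varkappa=\sum_i\varkappa_i$, $\mu=\sum_i\mu_i$, $\kappa=\sum_i\kappa_i$, $d=\sum_id_i$ (sums over $i\in\mathbb{N}_\nu$), $\beta=1+\nu+\kappa$, and $$\mathbf A=\begin{bmatrix}[\![A_i]\!]_{i=0}^\nu&[\![\widehat A_i(T_i\otimes I_n)]\!]_{i=1}^\nu&[\![\widehat A_i(\widetilde T_i\otimes I_n)]\!]_{i=1}^\nu&D_1\end{bmatrix},$$ $$\mathbf B_1=\begin{bmatrix}[\![B_i]\!]_{i=0}^\nu&[\![\widehat B_i(T_i\otimes I_p)]\!]_{i=1}^\nu&[\![\widehat B_i(\widetilde T_i\otimes I_p)]\!]_{i=1}^\nu&\mathsf O_{n,q}\end{bmatrix},$$ $$\mathbf C=\begin{bmatrix}[\![C_i]\!]_{i=0}^\nu&[\![\widehat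 C_i(T_i\otimes I_n)]\!]_{i=1}^\nu&[\![\widehat C_i(\widetilde T_i\otimes I_n)]\!]_{i=1}^\nu&D_2\end{bmatrix},$$ $$\mathbf B_2=\begin{bmatrix}[\![\mathfrak B_i]\!]_{i=0}^\nu&[\![\widehat{\mathfrak B}_i(T_i\otimes I_p)]\!]_{i=1}^\nu&[\![\widehat{\mathfrak B}_i(\widetilde T_i\otimes I_p)]\!]_{i=1}^\nu&\mathsf O_{m,q}\end{bmatrix},$$ $$\widehat I=\Big(\operatorname{diag}_{i=1}^\nu\mathfrak L_{\boldsymbol f_i}^{-1}\begin{bmatrix}\mathsf O_{d_i,\delta_i}&I_{d_i}\end{bmatrix}\mathfrak L_{\boldsymbol h_i}\Big)\otimes I_n,$$ $$\mathbf M=\begin{bmatrix}\operatorname{diag}_{i=1}^\nu\mathfrak L_{\boldsymbol f_i}^{-1}\boldsymbol f_i(-r_{i-1})&\mathbf 0_d&\mathsf O_{d,\varkappa}\end{bmatrix}-\begin{bmatrix}\mathbf 0_d&\operatorname{diag}_{i=1}^\nu\mathfrak L_{\boldsymbol f_i}^{-1}\boldsymbol f_i(-r_i)&\operatorname{diag}_{i=1}^\nu\mathfrak L_{\boldsymbol f_i}^{-1}M_i\mathfrak L_{\boldsymbol h_i}\end{bmatrix}.$$ With these, the closed-loop system reads $\dot{\boldsymbol x}(t)=(\mathbf A+\mathbf B_1[(I_\beta\otimes K)\oplus\mathsf O_q])\boldsymbol\vartheta(t)$, $\boldsymbol z(t)=(\mathbf C+\mathbf B_2[(I_\beta\otimes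 K)\oplus\mathsf O_q])\boldsymbol\vartheta(t)$, where $\boldsymbol\vartheta(t)$ is the column stacking of $\boldsymbol x(t)$, $[\boldsymbol x(t-r_i)]_{i=1}^\nu$, $\big[\int_{\mathcal{I}_i}(\mathfrak L_{\boldsymbol h_i}^{-1}\boldsymbol h_i(\tau)\otimes I_n)\boldsymbol x(t+\tau)\mathrm d\tau\big]_{i=1}^\nu$, $\big[\int_{\mathcal{I}_i}(\mathfrak L_{\boldsymbol\varepsilon_i}^{-1}\boldsymbol\varepsilon_i(\tau)\otimes I_n)\boldsymbol x(t+\tau)\mathrm d\tau\big]_{i=1}^\nu$ and $\boldsymbol w(t)$. *)

(* Defs.v *)
From HB Require Import structures.
From mathcomp Require Import all_boot all_order all_algebra.
From mathcomp Require Import mxtens.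
From mathcomp Require Import all_classical all_reals all_analysis.

Set Implicit Arguments.
Unset Strict Implicit.
Unset Printing Implicit Defensive.

Import Order.TTheory GRing.Theory Num.Theory.
Import numFieldNormedType.Exports.

Local Open Scope classical_set_scope.
Local Open Scope ring_scope.

Definition posdefmx (R : realType) (k : nat) (A : 'M[R]_k) : Prop :=
  A^T = A /\ forall x : 'cV[R]_k, x != 0 -> 0 < (x^T *m A *m x) 0 0.

Definition negdefmx (R : realType) (k : nat) (A : 'M[R]_k) : Prop :=
  A^T = A /\ forall x : 'cV[R]_k, x != 0 -> (x^T *m A *m x) 0 0 < 0.

Definition negsemidefmx (R : realType) (k : nat) (A : 'M[R]_k) : Prop :=
  A^T = A /\ forall x : 'cV[R]_k, (x^T *m A *m x) 0 0 <= 0.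

Definition Sy (R : realType) (k : nat) (X : 'M[R]_k) : 'M[R]_k := X + X^T.

Definition oplus (R : realType) (a b c e : nat)
    (X : 'M[R]_(a, b)) (Y : 'M[R]_(c, e)) : 'M[R]_(a + c, b + e) :=
  block_mx X 0 0 Y.

(* [\mxdiag] only accepts square blocks; this is its definition for rectangular
   ones.  On the diagonal the two block formats agree, so that [conform_mx]
   always returns [B i]. *)
Definition rdiag (R : realType) (nu : nat) (a b : 'I_nu -> nat)
    (B : forall i, 'M[R]_(a i, b i)) : 'M[R]_(\sum_i a i, \sum_i b i) :=
  \mxblock_(i, j) if i == j then conform_mx 0 (B i) else 0.

(* g (x) I_a for a column g. *)
Definition kronI (R : realType) (k a : nat) (g : 'cV[R]_k) : 'M[R]_(k * a, a) :=
  castmx (erefl _, mul1n a) (g *t (1%:M : 'M[R]_a)).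

(* Any lower triangular L with L L^T = X is allowed, whatever the signs of its
   diagonal; this includes the usual choice of a positive diagonal. *)
Definition cholesky (R : realType) (k : nat) (X L : 'M[R]_k) : Prop :=
  is_trig_mx L /\ L *m L^T = X.

Definition norm2 (R : realType) (k : nat) (x : 'cV[R]_k) : R :=
  Num.sqrt (\sum_(j < k) x j 0 ^+ 2).

Definition mxint (R : realType) (a b : nat) (D : set R) (F : R -> 'M[R]_(a, b)) :
    'M[R]_(a, b) :=
  \matrix_(i, j) \int[@lebesgue_measure R]_(x in D) F x i j.

Definition L2 (R : realType) (a b : nat) (D : set R) (F : R -> 'M[R]_(a, b)) :
    Prop :=
  forall i j, measurable_fun D (fun x => F x i j) /\
    (@lebesgue_measure R).-integrable D (fun x => (F x i j ^+ 2)%:E).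

(* C^1 functions with compact support in ]a, b[. *)
Definition test_function (R : realType) (a b : R) (phi : R -> R) : Prop :=
  [/\ forall x, derivable phi x 1,
      continuous (derive1 phi) &
      exists c d : R, [/\ a < c, d < b &
        forall x, ~ (c <= x <= d) -> phi x = 0]].

Definition weak_derivative (R : realType) (k : nat) (a b : R)
    (f g : R -> 'cV[R]_k) : Prop :=
  forall phi : R -> R, test_function a b phi ->
    mxint `[a, b] (fun x => derive1 phi x *: f x) =
    - mxint `[a, b] (fun x => phi x *: g x).

(* Elements of W^{1,2}([a, b]) are given by their continuous representative,
   so that point values are meaningful. *)
Definition W12 (R : realType) (k : nat) (a b : R) (f : R -> 'cV[R]_k) : Prop :=
  [/\ L2 `[a, b] f, {within `[a, b], continuous f} &
      exists2 g, L2 `[a, b] g & weak_derivative a b f g].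

Definition abs_continuous (R : realType) (a b : R) (f : R -> R) : Prop :=
  forall e : R, 0 < e -> exists2 d : R, 0 < d &
    forall (N : nat) (u v : nat -> R),
      (forall k, (k < N)%N -> [/\ a <= u k, u k <= v k & v k <= b]) ->
      (forall j k, (j < k < N)%N -> v j <= u k) ->
      \sum_(k < N) (v k - u k) < d ->
      \sum_(k < N) `|f (v k) - f (u k)| < e.

(* [delay k] stands for r_k and is meaningful for k <= nu; the families over
   0..nu are indexed by 'I_nu.+1, and those over 1..nu by 'I_nu, the element
   i : 'I_nu being the index i + 1. *)
Record delay_system (R : realType) (n m p q nu : nat) := DelaySystem {
  delay : nat -> R;
  A0 : 'I_nu.+1 -> 'M[R]_n;
  B0 : 'I_nu.+1 -> 'M[R]_(n, p);
  C0 : 'I_nu.+1 -> 'M[R]_(m, n);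
  F0 : 'I_nu.+1 -> 'M[R]_(m, p);
  At : 'I_nu -> R -> 'M[R]_n;
  Bt : 'I_nu -> R -> 'M[R]_(n, p);
  Ct : 'I_nu -> R -> 'M[R]_(m, n);
  Ft : 'I_nu -> R -> 'M[R]_(m, p);
  D1 : 'M[R]_(n, q);
  D2 : 'M[R]_(m, q)
}.

Definition itv_delay (R : realType) (n m p q nu : nat)
    (s : delay_system R n m p q nu) (i : 'I_nu) : set R :=
  `[- delay s i.+1, - delay s i].

Definition itv_hist (R : realType) (n m p q nu : nat)
    (s : delay_system R n m p q nu) : set R := `[- delay s nu, 0].

Definition delay_system_wf (R : realType) (n m p q nu : nat)
    (s : delay_system R n m p q nu) : Prop :=
  [/\ delay s 0 = 0,
      forall i, (i < nu)%N -> delay s i < delay s i.+1 &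
      forall i, [/\ L2 (itv_delay s i) (At s i), L2 (itv_delay s i) (Bt s i),
                    L2 (itv_delay s i) (Ct s i) & L2 (itv_delay s i) (Ft s i)]].

Definition state_rhs (R : realType) (n m p q nu : nat)
    (s : delay_system R n m p q nu) (K : 'M[R]_(p, n))
    (w : R -> 'cV[R]_q) (x : R -> 'cV[R]_n) (t : R) : 'cV[R]_n :=
  \sum_(i < nu.+1) (A0 s i + B0 s i *m K) *m x (t - delay s i)
  + \sum_(i < nu) mxint (itv_delay s i)
      (fun tau => (At s i tau + Bt s i tau *m K) *m x (t + tau))
  + D1 s *m w t.

Definition output_rhs (R : realType) (n m p q nu : nat)
    (s : delay_system R n m p q nu) (K : 'M[R]_(p, n))
    (w : R -> 'cV[R]_q) (x : R -> 'cV[R]_n) (t : R) : 'cV[R]_m :=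
  \sum_(i < nu.+1) (C0 s i + F0 s i *m K) *m x (t - delay s i)
  + \sum_(i < nu) mxint (itv_delay s i)
      (fun tau => (Ct s i tau + Ft s i tau *m K) *m x (t + tau))
  + D2 s *m w t.

(* C(J; R^n) is encoded by the functions on R that are continuous on J; their
   values outside J are irrelevant. *)
Definition hist_fun (R : realType) (n m p q nu : nat)
    (s : delay_system R n m p q nu) (psi : R -> 'cV[R]_n) : Prop :=
  {within itv_hist s, continuous psi}.

Definition sup_norm (R : realType) (n m p q nu : nat)
    (s : delay_system R n m p q nu) (psi : R -> 'cV[R]_n) : R :=
  sup [set norm2 (psi theta) | theta in itv_hist s].

Definition segment (R : realType) (n : nat) (x : R -> 'cV[R]_n) (t : R) :
    R -> 'cV[R]_n := fun theta => x (t + theta).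

(* Caratheodory solutions on [t0 - r, +oo[ with initial function psi. *)
Definition is_solution (R : realType) (n m p q nu : nat)
    (s : delay_system R n m p q nu) (K : 'M[R]_(p, n)) (t0 : R)
    (psi : R -> 'cV[R]_n) (w : R -> 'cV[R]_q) (x : R -> 'cV[R]_n) : Prop :=
  [/\ forall theta, theta \in itv_hist s -> x (t0 + theta) = psi theta,
      forall (T : R) (j : 'I_n), abs_continuous t0 T (fun t => x t j 0) &
      {ae @lebesgue_measure R, forall t, t0 <= t ->
        is_derive t (1 : R) x (state_rhs s K w x t)}].

Definition is_output (R : realType) (n m p q nu : nat)
    (s : delay_system R n m p q nu) (K : 'M[R]_(p, n)) (t0 : R)
    (w : R -> 'cV[R]_q) (x : R -> 'cV[R]_n) (z : R -> 'cV[R]_m) : Prop :=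
  (forall j, measurable_fun `[t0, +oo[ (fun t => z t j 0)) /\
  {ae @lebesgue_measure R, forall t, t0 <= t -> z t = output_rhs s K w x t}.

Definition supply (R : realType) (m q : nat) (J1 Jt : 'M[R]_m)
    (J2 : 'M[R]_(m, q)) (J3 : 'M[R]_q) (z : 'cV[R]_m) (w : 'cV[R]_q) : R :=
  ((col_mx z w)^T
   *m block_mx (Jt^T *m invmx J1 *m Jt) J2 J2^T J3
   *m col_mx z w) 0 0.

(* Continuity forces v to depend on the restriction to J only, hence v is
   indeed a functional on C(J; R^n). *)
Definition storage_functional (R : realType) (n m p q nu : nat)
    (s : delay_system R n m p q nu) (v : (R -> 'cV[R]_n) -> R) : Prop :=
  [/\ forall psi, hist_fun s psi -> 0 <= v psi,
      v (fun=> 0) = 0 &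
      forall psi, hist_fun s psi -> forall e : R, 0 < e ->
        exists2 d : R, 0 < d &
          forall chi, hist_fun s chi ->
            sup_norm s (fun theta => chi theta - psi theta) < d ->
            `|v chi - v psi| < e].

Definition dissipative (R : realType) (n m p q nu : nat)
    (s : delay_system R n m p q nu) (K : 'M[R]_(p, n)) (t0 : R)
    (rate : 'cV[R]_m -> 'cV[R]_q -> R) : Prop :=
  exists2 v : (R -> 'cV[R]_n) -> R, storage_functional s v &
    forall (psi : R -> 'cV[R]_n) (w : R -> 'cV[R]_q)
           (x : R -> 'cV[R]_n) (z : R -> 'cV[R]_m),
      hist_fun s psi -> L2 `[t0, +oo[ w ->
      is_solution s K t0 psi w x -> is_output s K t0 w x z ->
      forall t1 t2 : R, t0 <= t1 -> t1 <= t2 ->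
        v (segment x t2) - v (segment x t1) <=
        \int[@lebesgue_measure R]_(t in `[t1, t2]) rate (z t) (w t).

Definition globally_exp_stable (R : realType) (n m p q nu : nat)
    (s : delay_system R n m p q nu) (K : 'M[R]_(p, n)) (t0 : R) : Prop :=
  exists c lambda : R, [/\ 0 < c, 0 < lambda &
    forall psi x : R -> 'cV[R]_n,
      hist_fun s psi -> is_solution s K t0 psi (fun=> 0) x ->
      forall t : R, t0 <= t ->
        norm2 (x t) <= c * expR (- lambda * (t - t0)) * sup_norm s psi].

(* [ff], [fvphi] and [fphi] are f_i, \varphi_i and \phi_i, respectively. Sums
   of dimensions follow the stacking order of h_i and g_i. *)
Record decomposition (R : realType) (n m p nu : nat) := Decomposition {
  dimf : 'I_nu -> nat;
  dimvphi : 'I_nu -> nat;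
  dimphi : 'I_nu -> nat;
  ff : forall i, R -> 'cV[R]_(dimf i);
  fvphi : forall i, R -> 'cV[R]_(dimvphi i);
  fphi : forall i, R -> 'cV[R]_(dimphi i);
  Mf : forall i, 'M[R]_(dimf i, dimvphi i + dimf i);
  Ah : forall i, 'M[R]_(n, (dimphi i + (dimvphi i + dimf i)) * n);
  Bh : forall i, 'M[R]_(n, (dimphi i + (dimvphi i + dimf i)) * p);
  Ch : forall i, 'M[R]_(m, (dimphi i + (dimvphi i + dimf i)) * n);
  Fh : forall i, 'M[R]_(m, (dimphi i + (dimvphi i + dimf i)) * p)
}.

Section DimensionsAndFunctions.
Context (R : realType) (n m p nu : nat) (D : decomposition R n m p nu).

Definition dimh (i : 'I_nu) : nat := (dimvphi D i + dimf D i)%N.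
Definition dimg (i : 'I_nu) : nat := (dimphi D i + dimh i)%N.
Definition dimF : nat := \sum_i dimf D i.
Definition beta : nat := (1 + nu + \sum_i dimg i)%N.

Definition fh (i : 'I_nu) (tau : R) : 'cV[R]_(dimh i) :=
  col_mx (fvphi D i tau) (ff D i tau).
Definition fg (i : 'I_nu) (tau : R) : 'cV[R]_(dimg i) :=
  col_mx (fphi D i tau) (fh i tau).

(* The column format a, nu a, \varkappa a, mu a of the vectors of size
   beta a. *)
Definition bdim (a : nat) : nat :=
  (a + \sum_(i < nu) a + \sum_(i < nu) (dimh i * a)
     + \sum_(i < nu) (dimphi D i * a))%N.

Lemma bdimE (a : nat) : (beta * a)%N = bdim a.
Proof.
rewrite /beta /bdim /dimg big_split /= !mulnDl mul1n !big_distrl /=.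
rewrite sum_nat_const card_ord -!addnA; congr (_ + (_ + _))%N.
exact: addnC.
Qed.

Lemma bdimM (a : nat) :
  ((1 + \sum_(i < nu) 1 + \sum_(i < nu) dimh i) * a)%N =
  (a + \sum_(i < nu) a + \sum_(i < nu) (dimh i * a))%N.
Proof.
rewrite !mulnDl mul1n !big_distrl /=; congr (_ + _ + _)%N.
by apply: eq_bigr => i _; rewrite mul1n.
Qed.

Lemma sum_mull (k : 'I_nu -> nat) (a : nat) :
  (\sum_i (k i * a) = (\sum_i k i) * a)%N.
Proof. by rewrite big_distrl. Qed.

Lemma addn_shift (a b c : nat) : (a + b + c = b + a + c)%N.
Proof. by rewrite (addnC a). Qed.

End DimensionsAndFunctions.

Definition gram (R : realType) (a b : nat) (I : set R) (u : R -> 'cV[R]_a)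
    (v : R -> 'cV[R]_b) : 'M[R]_(a, b) :=
  mxint I (fun tau => u tau *m (v tau)^T).

Definition decomposes (R : realType) (n m p q nu : nat)
    (s : delay_system R n m p q nu) (D : decomposition R n m p nu) : Prop :=
  forall i : 'I_nu, let I := itv_delay s i in
  [/\ (0 < dimf D i)%N,
      [/\ W12 (- delay s i.+1) (- delay s i) (ff D i), L2 I (fvphi D i) &
          L2 I (fphi D i)],
      {ae @lebesgue_measure R, forall tau, I tau ->
        [/\ At s i tau = Ah D i *m kronI n (fg D i tau),
            Bt s i tau = Bh D i *m kronI p (fg D i tau),
            Ct s i tau = Ch D i *m kronI n (fg D i tau) &
            Ft s i tau = Fh D i *m kronI p (fg D i tau)]},
      weak_derivative (- delay s i.+1) (- delay s i) (ff D i)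
        (fun tau => Mf D i *m fh D i tau) &
      posdefmx (gram I (fg D i) (fg D i))].

(* The factors L_{f_i}, L_{h_i} and L_{\varepsilon_i}. *)
Record factors (R : realType) (n m p nu : nat) (D : decomposition R n m p nu) :=
  Factors {
  Lf : forall i, 'M[R]_(dimf D i);
  Lh : forall i, 'M[R]_(dimh D i);
  Le : forall i, 'M[R]_(dimphi D i)
}.

Section DerivedMatrices.
Context (R : realType) (n m p q nu : nat) (s : delay_system R n m p q nu)
        (D : decomposition R n m p nu).

Definition gramH (i : 'I_nu) : 'M[R]_(dimh D i) :=
  gram (itv_delay s i) (fh D i) (fh D i).

Definition Gam (i : 'I_nu) : 'M[R]_(dimphi D i, dimh D i) :=
  gram (itv_delay s i) (fphi D i) (fh D i).

Definition feps (i : 'I_nu) (tau : R) : 'cV[R]_(dimphi D i) :=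
  fphi D i tau - Gam i *m invmx (gramH i) *m fh D i tau.

Definition factors_wf (L : factors D) : Prop :=
  forall i : 'I_nu,
  [/\ cholesky (gram (itv_delay s i) (ff D i) (ff D i)) (Lf L i),
      cholesky (gramH i) (Lh L i) &
      cholesky (gram (itv_delay s i) (feps i) (feps i)) (Le L i)].

Variable L : factors D.

Definition T1 (i : 'I_nu) : 'M[R]_(dimg D i, dimh D i) :=
  col_mx (Gam i *m (invmx (Lh L i))^T) (Lh L i).

Definition T2 (i : 'I_nu) : 'M[R]_(dimg D i, dimphi D i) :=
  col_mx 1%:M 0 *m Le L i.

Definition hatblocks (k a c : nat) (X0 : 'I_nu.+1 -> 'M[R]_(k, a))
    (X : forall i, 'M[R]_(k, dimg D i * a)) (E : 'M[R]_(k, c)) :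
    'M[R]_(k, bdim D a + c) :=
  row_mx (row_mx (row_mx (row_mx
    (X0 ord0)
    (\mxrow_(i < nu) X0 (lift ord0 i)))
    (\mxrow_(i < nu) (X i *m (T1 i *t (1%:M : 'M[R]_a)))))
    (\mxrow_(i < nu) (X i *m (T2 i *t (1%:M : 'M[R]_a)))))
    E.

Definition bA := hatblocks (A0 s) (Ah D) (D1 s).
Definition bB1 := hatblocks (B0 s) (Bh D) (0 : 'M[R]_(n, q)).
Definition bC := hatblocks (C0 s) (Ch D) (D2 s).
Definition bB2 := hatblocks (F0 s) (Fh D) (0 : 'M[R]_(m, q)).

Definition Ihat : 'M[R]_(dimF D * n, \sum_(i < nu) (dimh D i * n)) :=
  castmx (erefl _, esym (sum_mull (dimh D) n))
    (rdiag (fun i => invmx (Lf L i) *m row_mx 0 1%:M *m Lh L i)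
     *t (1%:M : 'M[R]_n)).

(* f_i(- r_{i-1}) and f_i(- r_i) are the values at the right, resp. left, end
   of the i-th interval. *)
Definition bM : 'M[R]_(dimF D, 1 + \sum_(i < nu) 1 + \sum_(i < nu) dimh D i) :=
  castmx (erefl _, addn_shift _ _ _)
    (row_mx (row_mx
      (rdiag (fun i => invmx (Lf L i) *m ff D i (- delay s i)))
      (0 : 'cV[R]_(dimF D)))
      (0 : 'M[R]_(dimF D, \sum_(i < nu) dimh D i)))
  - row_mx (row_mx
      (0 : 'cV[R]_(dimF D))
      (rdiag (fun i => invmx (Lf L i) *m ff D i (- delay s i.+1))))
      (rdiag (fun i => invmx (Lf L i) *m Mf D i *m Lh L i)).

Definition bMI :
    'M[R]_(dimF D * n, n + \sum_(i < nu) n + \sum_(i < nu) (dimh D i * n)) :=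
  castmx (erefl _, bdimM D n) (bM *t (1%:M : 'M[R]_n)).

Definition Kblock (K : 'M[R]_(p, n)) : 'M[R]_(bdim D p + q, bdim D n + q) :=
  oplus (castmx (bdimE D p, bdimE D n) ((1%:M : 'M[R]_(beta D)) *t K))
        (0 : 'M[R]_q).

Definition bOmega (K : 'M[R]_(p, n)) : 'M[R]_(n, bdim D n + q) :=
  bA + bB1 *m Kblock K.

Definition bSigma (K : 'M[R]_(p, n)) : 'M[R]_(m, bdim D n + q) :=
  bC + bB2 *m Kblock K.

Definition bS : 'M[R]_(n + dimF D * n, bdim D n + q) :=
  col_mx (row_mx (row_mx (row_mx (row_mx 1%:M 0) 0) 0) 0)
         (row_mx (row_mx (row_mx (row_mx 0 0) Ihat) 0) 0).

Definition Pblock (P1 : 'M[R]_n) (P2 : 'M[R]_(n, dimF D * n))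
    (P3 : 'M[R]_(dimF D * n)) : 'M[R]_(n + dimF D * n) :=
  block_mx P1 P2 P2^T P3.

Definition diagIQ (Q : 'I_nu -> 'M[R]_n) : 'M[R]_(dimF D * n) :=
  castmx (sum_mull (dimf D) n, sum_mull (dimf D) n)
    (\mxdiag_(i < nu) ((1%:M : 'M[R]_(dimf D i)) *t Q i)).

Definition bLambda : 'M[R]_(\sum_(i < nu) n) :=
  \mxdiag_(i < nu) ((delay s i.+1 - delay s i)%:M : 'M[R]_n).

(* The first zero block has size n, so that the first summand acts on x(t), ...,
   x(t - r_{nu - 1}) and the second one on x(t - r_1), ..., x(t - r_nu); the
   zero block of size kappa n is split as \varkappa n + mu n. *)
Definition bXi (Q Rm : 'I_nu -> 'M[R]_n) (J3 : 'M[R]_q) :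
    'M[R]_(bdim D n + q) :=
  oplus (oplus (oplus
    (castmx (addnC _ _, addnC _ _)
      (oplus (\mxdiag_(i < nu) Q i + (\mxdiag_(i < nu) Rm i) *m bLambda)
             (0 : 'M[R]_n)))
    (0 : 'M[R]_(\sum_(i < nu) (dimh D i * n))))
    (0 : 'M[R]_(\sum_(i < nu) (dimphi D i * n))))
    (0 : 'M[R]_q)
  - oplus (oplus (oplus (oplus
    (0 : 'M[R]_n)
    (\mxdiag_(i < nu) Q i))
    (\mxdiag_(i < nu) ((1%:M : 'M[R]_(dimh D i)) *t Rm i)))
    (\mxdiag_(i < nu) ((1%:M : 'M[R]_(dimphi D i)) *t Rm i)))
    J3.

Definition bPsi (K : 'M[R]_(p, n)) (P1 : 'M[R]_n) (P2 : 'M[R]_(n, dimF D * n))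
    (P3 : 'M[R]_(dimF D * n)) (Q Rm : 'I_nu -> 'M[R]_n)
    (J2 : 'M[R]_(m, q)) (J3 : 'M[R]_q) : 'M[R]_(bdim D n + q) :=
  Sy (bS^T *m Pblock P1 P2 P3
        *m col_mx (bOmega K) (row_mx (row_mx bMI 0) (0 : 'M[R]_(_, q)))
      - col_mx (0 : 'M[R]_(bdim D n, m)) J2^T *m bSigma K)
  + bXi Q Rm J3.

Definition lmi_block (K : 'M[R]_(p, n)) (P1 : 'M[R]_n)
    (P2 : 'M[R]_(n, dimF D * n)) (P3 : 'M[R]_(dimF D * n))
    (Q Rm : 'I_nu -> 'M[R]_n) (J1 Jt : 'M[R]_m)
    (J2 : 'M[R]_(m, q)) (J3 : 'M[R]_q) : 'M[R]_(bdim D n + q + m) :=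
  block_mx (bPsi K P1 P2 P3 Q Rm J2 J3) ((bSigma K)^T *m Jt^T)
           (Jt *m bSigma K) J1.

Definition bP (P1 : 'M[R]_n) (P2 : 'M[R]_(n, dimF D * n)) :
    'M[R]_(n, bdim D n + q + m) :=
  row_mx (row_mx (row_mx (row_mx (row_mx
    P1 0) (P2 *m Ihat)) 0) (0 : 'M[R]_(n, q))) (0 : 'M[R]_(n, m)).

Definition bPi (K : 'M[R]_(p, n)) : 'M[R]_(n, bdim D n + q + m) :=
  row_mx (bOmega K) (0 : 'M[R]_(n, m)).

Definition bPhi (K : 'M[R]_(p, n)) (P2 : 'M[R]_(n, dimF D * n))
    (P3 : 'M[R]_(dimF D * n)) (Q Rm : 'I_nu -> 'M[R]_n) (J1 Jt : 'M[R]_m)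
    (J2 : 'M[R]_(m, q)) (J3 : 'M[R]_q) : 'M[R]_(bdim D n + q + m) :=
  Sy ((col_mx (col_mx (col_mx (col_mx (col_mx
         P2 0) (Ihat^T *m P3)) 0) (0 : 'M[R]_(q, _))) (0 : 'M[R]_(m, _)))
      *m row_mx (row_mx (row_mx bMI 0) (0 : 'M[R]_(_, q))) (0 : 'M[R]_(_, m))
      + col_mx (col_mx (0 : 'M[R]_(bdim D n, m)) (- J2^T)) Jt
        *m row_mx (bSigma K) (0 : 'M[R]_m))
  + oplus (bXi Q Rm J3) J1.

End DerivedMatrices.

(* Main.v *)
Require Import Defs.
From HB Require Import structures.
From mathcomp Require Import all_boot all_order all_algebra.
From mathcomp Require Import ring lra.
From mathcomp Require Import mxtens.
From mathcomp Require Import all_classical all_reals all_analysis.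
From mathcomp Require Import measurable_realfun.

Set Implicit Arguments.
Unset Strict Implicit.
Unset Printing Implicit Defensive.

Import Order.TTheory GRing.Theory Num.Theory.
Import numFieldNormedType.Exports.

Local Open Scope classical_set_scope.
Local Open Scope ring_scope.

(** The proof is a Lyapunov-Krasovskii argument. For a history y put
    eta(y) = (y(0), [int L_f^-1 f_i(tau) (x) y(tau)]) and
      V(y) = eta^T [P1 P2; P2^T P3] eta
             + sum_i int_{I_i} y(tau)^T (Q_i + (tau + r_i) R_i) y(tau) dtau,
    which is [lyap]. It serves both as storage functional and as Lyapunov
    functional.

    The tool on the side of the matrices is Bessel's inequality
    ([bessel_inequality]). The functions L_f^-1 f_i are orthonormal in L^2, hence
    the integrals with Q_i dominate the form of diag (I (x) Q_i) in eta, and V is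
    bounded below by a multiple of |y(0)|^2 ([lyap_lower_bound]). The functions
    L_h^-1 h_i and L_eps^-1 eps_i together are orthonormal too, and they span the
    components of g_i. So the distributed delays are linear in the vector theta
    built from the projections on them ([hatblocks_delay_state]), and the integrals
    with R_i dominate the terms with R_i in Xi ([projR_le]). After elimination of
    J1 by a Schur complement, the matrix inequality states that
    V' <= supply rate - e |theta|^2 ([lyap_deriv_le]); integration gives
    dissipativity. For w = 0 the supply rate is nonpositive. The integrals of
    |x|^2 in V, which theta does not control, are controlled by what Bessel's
    inequality gives away, and V' <= - l V follows ([lyap_decay]).

    The tool on the side of analysis is the derivative of a moving integral
    int_I f(tau) u(t + tau) dtau, where f has a weak derivative and u is merely
    continuous ([delay_integral_is_derive]). It rests on integration by parts
    against C^1 functions without boundary condition ([weak_ibp]). Hence V is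
    absolutely continuous along a solution, with the expected derivative almost
    everywhere ([lyap_ac], [lyap_is_derive]). The passage from the differential
    inequality to its integrated form is the theorem that an absolutely continuous
    function with an almost everywhere nonpositive derivative is nonincreasing
    ([ac_ae_derive_le0_nonincr], [ac_increment_le]).

    Matrices of integrals such as int f_i y^T are kept as matrices as long as
    possible; [vecm] stacks their rows, which turns the Kronecker products of the
    statement into products of matrices. *)

(** * Monotonicity of absolutely continuous functions *)

Section AbsoluteContinuity.
Context {R : realType}.
Notation mu := (@lebesgue_measure R).
Implicit Types (a b c t : R) (f g y : R -> R).

(** Intervals around c are needed, not only those with endpoint c: the sweep in
    [ac_ae_derive_le0_nonincr] jumps over c. *)
Lemma derive_le0_increment y c (d e : R) :
  is_derive c (1 : R) y d -> d <= 0 -> 0 < e ->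
  exists2 r : R, 0 < r & forall s s' : R, s <= c -> c <= s' ->
    c - s < r -> s' - c < r -> y s' - y s <= e * (s' - s).
Proof.
move=> [yd yE] + e0.
have : h^-1 *: ((y \o shift c) (h *: (1:R)) - y c) @[h --> 0^'] --> d.
  by rewrite -yE; exact: yd.
move=> /cvgrPdist_le /(_ _ e0) [r /= r0 H] d0.
exists r => // s s' sc cs' csr s'cr.
have inc h : h != 0 -> `|h| < r -> (y (h + c) - y c) / h <= e.
  move=> h0 hr; have := H h; rewrite /ball_/= sub0r normrN => /(_ hr h0).
  rewrite /GRing.scale/= mulr1 => /ler_normlP[+ _].
  rewrite mulrC opprB => hh; lra.
have up : y s' - y c <= e * (s' - c).
  have [->|ne] := eqVneq s' c; first by rewrite !subrr mulr0.
  have pos : 0 < s' - c by rewrite subr_gt0 lt_neqAle eq_sym ne.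
  have := inc (s' - c); rewrite gt_eqF// gtr0_norm// subrK => /(_ isT s'cr).
  by rewrite ler_pdivrMr.
have lo : y c - y s <= e * (c - s).
  have [->|ne] := eqVneq s c; first by rewrite !subrr mulr0.
  have pos : 0 < c - s by rewrite subr_gt0 lt_neqAle ne.
  have neg : s - c < 0 by rewrite subr_lt0 lt_neqAle ne.
  have := inc (s - c); rewrite lt_eqF// ltr0_norm// opprB subrK => /(_ isT csr).
  by rewrite ler_ndivrMr// => ?; lra.
lra.
Qed.

(** The exceptional null set lies in an open set U of small measure. Sweep from
    a to b: a point outside the null set is passed at the cost of a small slope,
    and a point of the null set is passed within an interval contained in U, whose
    increment is only recorded. The recorded intervals are disjoint with total
    length at most mu U, so that absolute continuity makes the sum of their
    increments small. *)
Lemma ac_ae_derive_le0_nonincr a b y : a <= b -> abs_continuous a b y ->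
  {ae mu, forall t, a <= t <= b -> exists2 d, is_derive t (1 : R) y d & d <= 0} ->
  y b <= y a.
Proof.
move=> ab acy [N [mN N0 /subsetCPl goodN]].
rewrite -subr_le0; apply/ler_addgt0Pr => e e0; rewrite add0r.
pose e1 := e / (1 + (b - a)).
have ba : 0 < 1 + (b - a) by lra.
have e10 : 0 < e1 by rewrite divr_gt0.
have [d d0 acd] := acy _ e10.
have [U [oU NU muUN]] : exists U : set R,
    [/\ open U, N `<=` U & (mu (U `\` N) < d%:E)%E].
  by apply: lebesgue_regularity_outer => //; rewrite [ltLHS]N0.
have mU : measurable U by exact: open_measurable.
have muU : (mu U < d%:E)%E.
  have -> : U = N `|` (U `\` N) by rewrite setDUK.
  apply: le_lt_trans muUN; rewrite (le_trans (measureU2 _ _ _))//.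
    exact: measurableD.
  by rewrite [X in (X + _)%E](N0 : mu N = 0%E) add0e.
(* Invariant of the induction on t: up to e1 * (t - a), the increment of y over
   [a, t] is that over finitely many successive intervals contained in U. *)
pose covered t := exists (k : nat) (u v : nat -> R),
  [/\ forall i, (i < k)%N -> [/\ a <= u i, u i <= v i & v i <= t],
      forall j i, (j < i < k)%N -> v j <= u i,
      ((\sum_(i < k) (v i - u i))%:E <= mu (U `&` `]a, t]))%E &
      y t - y a <= e1 * (t - a) + \sum_(i < k) `|y (v i) - y (u i)|].
have covered_a : covered a.
  exists 0%N, (fun=> a), (fun=> a); split => //.
    by rewrite big_ord0 measure_ge0.
  by rewrite big_ord0 !subrr mulr0 addr0.
have step c : a <= c <= b -> exists2 r : R, 0 < r &
    forall s s' : R, a <= s -> s <= c -> c <= s' -> c - s < r -> s' - c < r ->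
    covered s -> covered s'.
  move=> acb; have [Nc|Nc] := pselect (N c).
  - have /nbhs_ballP[r /= r0 rU] : nbhs c U by apply: oU; exact: NU.
    exists r => // s s' as_ sc cs' csr s'cr [k [u [v [uv vu kmu ky]]]].
    exists k.+1, (fun i => if (i < k)%N then u i else s),
           (fun i => if (i < k)%N then v i else s').
    have ss' : s <= s' by exact: le_trans cs'.
    split.
    + move=> i _; case: ifPn => ik; last by split.
      by have [? ? vs] := uv _ ik; split => //; exact: le_trans vs ss'.
    + move=> j i /andP[ji]; rewrite ltnS => ik.
      rewrite (leq_trans ji ik); case: ifPn => ik'; first by apply: vu; rewrite ji.
      by have [] := uv _ (leq_trans ji ik).
    + rewrite big_ord_recr/= ltnn.
      under eq_bigr do rewrite ltn_ord.
      have -> : U `&` `]a, s'] = (U `&` `]a, s]) `|` `]s, s'].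
        apply/seteqP; split => x /=; rewrite !in_itv/=.
          move=> [Ux /andP[ax xs']]; case: (leP x s) => xs; first by left; rewrite ax.
          by right; rewrite xs'.
        case=> [[Ux /andP[-> xs]]|/andP[sx xs']].
          by split => //; exact: le_trans ss'.
        split; last by rewrite xs' (le_lt_trans as_ sx).
        apply: rU; rewrite /ball/= distrC ltr_norml; apply/andP; split; lra.
      rewrite measureU//=; last 2 first.
        exact: measurableI.
        apply/seteqP; split => x //=; rewrite !in_itv/= => -[[_ /andP[_ xs]]].
        by rewrite ltNge xs.
      rewrite EFinD leeD//.
      rewrite lebesgue_measure_itv/= lte_fin; case: ltP => ss; first by rewrite EFinB.
      by rewrite lee_fin subr_le0.
    + rewrite big_ord_recr/= ltnn.
      under eq_bigr do rewrite ltn_ord.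
      have := ler_norm (y s' - y s).
      have : e1 * (s - a) <= e1 * (s' - a) by rewrite ler_pM2l// lerB.
      lra.
  - have /(_ c) := goodN; move=> /(_ Nc) /(_ acb)[dc ydc dc0].
    have [r r0 H] := derive_le0_increment ydc dc0 e10.
    exists r => // s s' as_ sc cs' csr s'cr [k [u [v [uv vu kmu ky]]]].
    have ss' : s <= s' by exact: le_trans cs'.
    exists k, u, v; split => //.
    + by move=> i /uv[? ? vs]; split => //; exact: le_trans vs ss'.
    + apply: le_trans kmu _; apply: le_measure; rewrite ?inE; try exact: measurableI.
      apply: setIS => x /=; rewrite !in_itv/= => /andP[->/=] xs; exact: le_trans xs ss'.
    + have := H _ _ sc cs' csr s'cr; rewrite !mulrBr; lra.
(* The step property excludes that the supremum of S is smaller than b. *)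
pose S := [set t | a <= t <= b /\ covered t].
have Sa : S a by split => //; rewrite lexx.
have supS : has_sup S.
  by split; [exists a|exists b => t [/andP[]]].
have aS : a <= sup S by apply: ub_le_sup => //; exact: supS.2.
have Sb : sup S <= b by apply: ge_sup => [|t [/andP[]]//]; exists a.
have [r r0 stepS] := step (sup S) ltac:(by rewrite aS Sb).
have [s Ss sr] := sup_adherent r0 supS.
have sS : s <= sup S by apply: ub_le_sup Ss; exact: supS.2.
have [/andP[as_ _] cs] := Ss.
pose s' := Num.min b (sup S + r / 2).
have Ss' : sup S <= s' by rewrite le_min Sb/= lerDl divr_ge0 ?ltW.
have cs' : covered s'.
  apply: (stepS s s') => //; first lra.
  have : s' <= sup S + r / 2 by rewrite ge_min lexx orbT.
  lra.
have : s' <= sup S.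
  apply: ub_le_sup; first exact: supS.2.
  by split => //; rewrite (le_trans aS Ss')/= ge_min lexx.
rewrite /s' ge_min => /orP[bS|]; last lra.
have {}cs' : covered b by rewrite -(_ : s' = b)// /s'; apply/min_idPl; lra.
have [k [u [v [uv vu kmu ky]]]] := cs'.
have : \sum_(i < k) `|y (v i) - y (u i)| < e1.
  apply: acd => //; rewrite -lte_fin; apply: le_lt_trans muU.
  apply: le_trans kmu _; apply: le_measure; rewrite ?inE//.
  exact: measurableI.
have : e1 * (1 + (b - a)) = e by rewrite /e1 divfK// gt_eqF.
lra.
Qed.

End AbsoluteContinuity.

(** * Operations on absolutely continuous functions and comparison *)

Section AbsoluteContinuityClosure.
Context {R : realType}.
Notation mu := (@lebesgue_measure R).
Implicit Types (a b c t : R) (f g y z : R -> R).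

Lemma lipschitz_ac a b C y :
  (forall s t, a <= s -> s <= t -> t <= b -> `|y t - y s| <= C * (t - s)) ->
  abs_continuous a b y.
Proof.
move=> yC e e0; exists (e / (`|C| + 1)) => [|N u v uv _ duv].
  by rewrite divr_gt0// ltr_wpDl.
rewrite ltr_pdivlMr ?ltr_wpDl// mulrDr mulr1 in duv.
apply: (@le_lt_trans _ _ (`|C| * \sum_(k < N) (v k - u k))).
  rewrite mulr_sumr; apply: ler_sum => k _.
  have [au uvk vb] := uv _ (ltn_ord k).
  apply: le_trans (yC _ _ au uvk vb) _.
  by rewrite ler_wpM2r ?subr_ge0// ler_norm.
apply: le_lt_trans duv; rewrite mulrC lerDl; apply: sumr_ge0 => k _.
by have [_ ? _] := uv _ (ltn_ord k); rewrite subr_ge0.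
Qed.

Lemma ac_cst a b c : abs_continuous a b (fun=> c).
Proof.
by apply: (@lipschitz_ac _ _ 0) => s t _ _ _; rewrite subrr normr0 mul0r.
Qed.

Lemma acD a b y z : abs_continuous a b y -> abs_continuous a b z ->
  abs_continuous a b (fun t => y t + z t).
Proof.
move=> acy acz e e0; have e2 : 0 < e / 2 by rewrite divr_gt0.
have [d1 d10 yd] := acy _ e2; have [d2 d20 zd] := acz _ e2.
exists (Num.min d1 d2) => [|N u v uv vu]; first by rewrite lt_min d10.
rewrite lt_min => /andP[du1 du2]; rewrite (splitr e).
apply: le_lt_trans (ltrD (yd _ _ _ uv vu du1) (zd _ _ _ uv vu du2)).
by rewrite -big_split/=; apply: ler_sum => k _; rewrite opprD addrACA ler_normD.
Qed.

Lemma ac_sum a b (I : finType) (P : pred I) (F : I -> R -> R) :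
  (forall i, abs_continuous a b (F i)) ->
  abs_continuous a b (fun t => \sum_(i | P i) F i t).
Proof.
move=> acF; rewrite -[X in abs_continuous _ _ X](_ : \sum_(i | P i) F i = _); last first.
  by apply/funext => t; rewrite fct_sumE.
by elim/big_ind : _ => //; [exact: ac_cst|move=> *; exact: acD].
Qed.

Lemma ac_sub a b c d y : a <= c -> d <= b ->
  abs_continuous a b y -> abs_continuous c d y.
Proof.
move=> ac db acy e e0; have [dl dl0 H] := acy e e0; exists dl => // N u v uv.
by apply: H => k kN; have [cu ? vd] := uv k kN; split;
  [exact: le_trans cu| |exact: le_trans vd db].
Qed.

Lemma ac_continuous a b y : a < b -> abs_continuous a b y ->
  {within `[a, b], continuous y}.
Proof.
move=> ab acy; apply/subspace_continuousP => t /=.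
rewrite in_itv/= => tab; apply/cvgrPdist_lt => e e0.
have [d d0 H] := acy _ e0.
rewrite near_withinE; near=> s => /=; rewrite in_itv/= => sab.
have std : `|t - s| < d by near: s; exact: (nbhsx_ballx t d d0).
pose u (k : nat) := Num.min s t; pose v (k : nat) := Num.max s t.
have := H 1%N u v; rewrite !big_ord1 /u /v.
have {tab} /andP[at_ tb] := tab; have {sab} /andP[as_ sb] := sab.
have hd : Num.max s t - Num.min s t = `|t - s|.
  by case: (leP s t) => st; [rewrite ger0_norm ?subr_ge0|rewrite distrC gtr0_norm ?subr_gt0].
have hy : `|y (Num.max s t) - y (Num.min s t)| = `|y t - y s|.
  by case: (leP s t) => st //; rewrite distrC.
rewrite hd hy; apply => //.
- move=> k _; split; first by rewrite le_min as_.
    by rewrite ge_min le_max lexx.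
  by rewrite ge_max sb.
- by move=> j k /andP[jk]; rewrite ltnS leqn0 => /eqP k0; rewrite k0 in jk.
Unshelve. all: by end_near. Qed.

Lemma continuous_itv_bounded a b y : {within `[a, b], continuous y} ->
  exists2 C : R, 0 < C & forall t, a <= t <= b -> `|y t| <= C.
Proof.
move=> cy; have : compact (y @` `[a, b]).
  by apply: continuous_compact => //; exact: segment_compact.
move=> /compact_bounded[M [_ HM]]; exists (`|M| + 1); first by rewrite ltr_wpDl.
by move=> t tab; apply: (HM (`|M| + 1)); [rewrite ltr_pwDr// ler_norm|exists t].
Qed.

Lemma acM a b y z : abs_continuous a b y -> abs_continuous a b z ->
  abs_continuous a b (fun t => y t * z t).
Proof.
move=> acy acz; have [ab|ba] := ltP a b; last first.
  apply: (@lipschitz_ac _ _ 0) => s t as_ st tb.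
  have -> : s = t by apply/le_anti; rewrite st (le_trans tb)// (le_trans ba).
  by rewrite !subrr normr0 mulr0.
have [B B0 yB] := continuous_itv_bounded (ac_continuous ab acy).
have [C C0 zC] := continuous_itv_bounded (ac_continuous ab acz).
move=> e e0.
have [d1 d10 yd] := acy (e / (2 * C)) ltac:(by rewrite divr_gt0// mulr_gt0).
have [d2 d20 zd] := acz (e / (2 * B)) ltac:(by rewrite divr_gt0// mulr_gt0).
exists (Num.min d1 d2) => [|N u v uv vu]; first by rewrite lt_min d10.
rewrite lt_min => /andP[du1 du2].
have hy : C * \sum_(k < N) `|y (v k) - y (u k)| < e / 2.
  have -> : e / 2 = C * (e / (2 * C)) by field; rewrite gt_eqF.
  by rewrite ltr_pM2l//; exact: yd.
have hz : B * \sum_(k < N) `|z (v k) - z (u k)| < e / 2.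
  have -> : e / 2 = B * (e / (2 * B)) by field; rewrite gt_eqF.
  by rewrite ltr_pM2l//; exact: zd.
rewrite (splitr e); apply: le_lt_trans (ltrD hy hz).
rewrite !mulr_sumr -big_split/=; apply: ler_sum => k _.
have [au uvk vb] := uv _ (ltn_ord k).
have -> : y (v k) * z (v k) - y (u k) * z (u k) =
  z (v k) * (y (v k) - y (u k)) + y (u k) * (z (v k) - z (u k)) by ring.
apply: le_trans (ler_normD _ _) _; rewrite !normrM lerD// ler_wpM2r//.
- by apply: zC; rewrite vb (le_trans au).
- by apply: yB; rewrite au (le_trans uvk).
Qed.

Lemma acN a b y : abs_continuous a b y -> abs_continuous a b (fun t => - y t).
Proof.
move=> acy; rewrite (_ : (fun _ => _) = fun t => -1 * y t).
  by apply: acM => //; exact: ac_cst.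
by apply/funext => t; rewrite mulN1r.
Qed.

Lemma expR_ac (l : R) a b : 0 <= l -> abs_continuous a b (fun t => expR (l * (t - a))).
Proof.
move=> l0; apply: (@lipschitz_ac _ _ (expR (l * (b - a)) * l)) => u v au uv vb.
have mono : expR (l * (u - a)) <= expR (l * (v - a)).
  by rewrite ler_expR ler_wpM2l// lerD2r.
rewrite ger0_norm ?subr_ge0//.
apply: (@le_trans _ _ (expR (l * (v - a)) * (l * (v - u)))).
  have -> : expR (l * (u - a)) = expR (l * (v - a)) * expR (- (l * (v - u))).
    by rewrite -expRD; congr expR; ring.
  rewrite -{1}[expR (l * (v - a))]mulr1 -mulrBr ler_wpM2l ?expR_ge0//.
  by have := expR_ge1Dx (- (l * (v - u))); lra.
rewrite -mulrA ler_wpM2r ?mulr_ge0// ?subr_ge0//.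
by rewrite ler_expR ler_wpM2l// lerD2r.
Qed.

(** The function exp (l (t - a)) y(t) has a nonpositive derivative. *)
Lemma ac_gronwall (l : R) a b y : 0 <= l -> a <= b -> abs_continuous a b y ->
  {ae mu, forall t, a <= t <= b -> exists2 d, is_derive t (1 : R) y d & d <= - l * y t} ->
  y b <= expR (- (l * (b - a))) * y a.
Proof.
move=> l0 ab acy dy.
have : expR (l * (b - a)) * y b <= expR (l * (a - a)) * y a.
  apply: (ac_ae_derive_le0_nonincr (y := fun t => expR (l * (t - a)) * y t) ab).
    by apply: acM => //; exact: expR_ac.
  have aeF := @ae_filter_ringOfSetsType _ _ _ mu.
  apply: (@filterS _ _ aeF _ _ _ dy) => t h /h[d dyt dle].
  have de : is_derive t (1 : R) (fun t => expR (l * (t - a))) (expR (l * (t - a)) * l).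
    have da : is_derive t (1 : R) (fun t => l * (t - a)) l.
      apply: is_derive_eq; rewrite subr0 /GRing.scale/=; ring.
    by apply: is_derive_eq.
  exists (expR (l * (t - a)) *: d + y t *: (expR (l * (t - a)) * l)).
    exact: is_deriveM.
  rewrite /GRing.scale/= [X in _ + X]mulrCA -mulrDr pmulr_rle0 ?expR_gt0//.
  by lra.
rewrite subrr mulr0 expR0 mul1r => h.
rewrite expRN -(ler_pM2l (expR_gt0 (l * (b - a)))) mulrA divff ?mul1r//.
by rewrite gt_eqF// expR_gt0.
Qed.

(** The sum of the increments is at most the integral of the absolute value of g
    over the union of the disjoint intervals, a set of small measure. *)
Lemma integral_ac a b g : mu.-integrable setT (EFin \o g) ->
  abs_continuous a b (fun t => \int[mu]_(x in `]-oo, t]) g x).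
Proof.
move=> ig e e0; have [d [d0 gd]] := integral_normr_continuous ig e0.
exists d => // N u v uv vu duv.
have ign : mu.-integrable setT (EFin \o (fun x => `|g x|)).
  by have := integrable_norm ig.
pose A n := \big[setU/set0]_(k < n) `]u k, v k]%classic.
have mA n : measurable (A n) by exact: bigsetU_measurable.
have muA n : (mu (A n) <= (\sum_(k < n) Num.max 0 (v k - u k))%:E)%E.
  elim: n => [|n IHn]; first by rewrite /A !big_ord0 measure0.
  rewrite /A !big_ord_recr/= EFinD.
  apply: (le_trans (measureU2 _ _ _)) => //; first exact: (mA n).
  apply: leeD => //.
  rewrite [leLHS](lebesgue_measure_itv `]u n, v n])/= lte_fin.
  by case: ifP => _; rewrite -?EFinB lee_fin le_max lexx ?orbT.
have intA n : (n <= N)%N -> \sum_(k < n) `|\int[mu]_(x in `]-oo, v k]) g x -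
    \int[mu]_(x in `]-oo, u k]) g x| <= \int[mu]_(x in A n) `|g x|.
  elim: n => [_|n IHn nN]; first by rewrite big_ord0 /A big_ord0 Rintegral_set0.
  rewrite /A !big_ord_recr/= Rintegral_setU//; last 3 first.
  - exact: (mA n).
  - apply: (integrableS measurableT) => //; apply: measurableU => //.
    exact: (mA n).
  - apply/disj_setPS => x []; rewrite -(bigcup_mkord n (fun k => `]u k, v k]%classic)) => -[j /= jn].
    rewrite !in_itv/= => /andP[_ xv] /andP[ux _].
    have := vu j n; rewrite jn nN => /(_ isT) vun.
    by have := le_lt_trans (le_trans xv vun) ux; rewrite ltxx.
  apply: lerD; first by apply: IHn; exact: ltnW.
  have [au uvn vb] := uv _ nN.
  rewrite Rintegral_itvB ?bnd_simp//; last exact: (integrableS measurableT).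
  by apply: le_normr_Rintegral => //; exact: (integrableS measurableT).
apply: le_lt_trans (intA N (leqnn _)) _; apply: gd; first exact: (mA N).
apply: le_lt_trans (muA N) _; rewrite lte_fin.
rewrite (eq_bigr (fun k : 'I_N => v k - u k))// => k _.
by apply/max_idPr; have [_ ? _] := uv _ (ltn_ord k); rewrite subr_ge0.
Qed.

(** Subtracting from y the indefinite integral of g, whose derivative is g almost
    everywhere, reduces the claim to [ac_ae_derive_le0_nonincr]. *)
Lemma ac_increment_le a b y g : a <= b -> abs_continuous a b y ->
  mu.-integrable `[a, b] (EFin \o g) ->
  {ae mu, forall t, a <= t <= b ->
    exists2 dy, is_derive t (1 : R) y dy & dy <= g t} ->
  y b - y a <= \int[mu]_(t in `[a, b]) g t.
Proof.
move=> ab acy ig yg.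
pose h := g \_ `[a, b].
have ih : mu.-integrable setT (EFin \o h).
  by rewrite -restrict_EFin; apply/integrable_restrict => //=; rewrite setIidr.
pose G x := \int[mu]_(t in `]-oo, x]) h t.
have aeG : {ae mu, forall x, derivable G x 1 /\ (derive1 G) x = h x}.
  apply: FTC1Ny => [x|]; first exact: (integrableS measurableT).
  split => //; first by case/integrableP : ih => /measurable_EFinP.
    exact: openT.
  move=> K _ cK; have mK : measurable K by exact: compact_measurable.
  have : mu.-integrable K (EFin \o h) by exact: (integrableS measurableT).
  by move=> /integrableP[_].
have GB : G b - G a = \int[mu]_(t in `[a, b]) g t.
  rewrite /G Rintegral_itvB ?bnd_simp//; last exact: (integrableS measurableT).
  rewrite Rintegral_itv_obnd_cbnd; last exact: (integrableS measurableT).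
  by apply: eq_Rintegral => x xab; rewrite /h patchE xab.
have : (y b - G b) <= (y a - G a).
  apply: (@ac_ae_derive_le0_nonincr _ _ _ (fun t => y t - G t)) => //.
    by apply: acD => //; apply: acN; exact: integral_ac.
  have aeF := @ae_filter_ringOfSetsType _ _ _ mu.
  apply: (@filterS2 _ _ aeF _ _ _ _ aeG yg) => t [dG Gh] yt tab.
  have [dy ydy dyg] := yt tab.
  exists (dy - h t); last by rewrite subr_le0 /h patchE mem_set.
  apply: is_deriveB.
  by rewrite -Gh derive1E; exact/derivableP.
by rewrite -GB; lra.
Qed.

End AbsoluteContinuityClosure.

(** * C^1 step functions *)

Section SmoothStep.
Context {R : realType}.
Implicit Types (a b c d x h : R).

(** This settles max (0, x)^2 at 0, where no differentiation rule applies. *)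
Lemma is_derive_quadratic_error (f : R -> R) x d (C : R) :
  (forall h, `|f (h + x) - f x - d * h| <= C * h ^+ 2) ->
  is_derive x (1 : R) f d.
Proof.
move=> H; suff cv : h^-1 *: (f (h *: (1:R) + x) - f x) @[h --> 0^'] --> d.
  by split; [apply/cvg_ex; exists d|exact/cvg_lim].
apply/cvgrPdist_le => e e0; near=> h.
have h0 : h != 0 by near: h; exact: nbhs_dnbhs_neq.
have hC : `|h| <= e / (`|C| + 1).
  near: h; apply: dnbhs0_le; rewrite divr_gt0// ltr_wpDl//.
rewrite /GRing.scale/= mulr1 distrC.
have -> : h^-1 * (f (h + x) - f x) - d = (f (h + x) - f x - d * h) / h by field.
rewrite normrM normfV ler_pdivrMr ?normr_gt0//; apply: le_trans (H h) _.
rewrite -[h ^+ 2]ger0_norm ?sqr_ge0// normrX expr2 mulrA ler_wpM2r//.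
move: hC; rewrite ler_pdivlMr ?ltr_wpDl// => hC; apply: le_trans hC.
have := ler_norm C; have := normr_ge0 h; nra.
Unshelve. all: by end_near. Qed.

Lemma is_derive_comp_affine (f : R -> R) (k c x df : R) :
  is_derive (k * x + c) (1 : R) f df ->
  is_derive x (1 : R) (fun y => f (k * y + c)) (k * df).
Proof.
move=> fd; rewrite mulrC.
apply: (@is_derive1_comp R f (fun y => k * y + c)).
have kd : is_derive x (1 : R) (k \*: (id : R -> R)) k.
  by apply: is_derive_eq; rewrite /GRing.scale/= mulr1.
by apply: is_derive_eq; rewrite addr0.
Qed.

Let pos x := Num.max 0 x.

Let continuous_pos : continuous pos.
Proof.
by move=> x; apply: (@continuous_max R _ (fun=> 0) id); [exact: cvg_cst|exact: cvg_id].
Qed.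

Let is_derive_pos2 x : is_derive x (1 : R) (fun y => pos y ^+ 2) (2 * pos x).
Proof.
apply: (@is_derive_quadratic_error _ _ _ 1) => h; rewrite mul1r /pos.
apply/ler_normlP; case: (leP 0 x) => hx; case: (leP 0 (h + x)) => hy; split; nra.
Qed.

(** T rises from 0 at 0 to 1 at 1, and its derivative dT is a tent function. *)
Let T x := 2 * pos x ^+ 2 - 4 * pos (x - 2^-1) ^+ 2 + 2 * pos (x - 1) ^+ 2.
Let dT x := 4 * pos x - 8 * pos (x - 2^-1) + 4 * pos (x - 1).

Let continuous_dT : continuous dT.
Proof.
have cc k c : continuous (fun x => k * pos (x - c)).
  move=> x; apply: cvgMr; apply: (@continuous_comp _ _ _ (fun x => x - c) pos).
    by apply: cvgB; [exact: cvg_id|exact: cvg_cst].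
  exact: continuous_pos.
move=> x; rewrite /dT; apply: cvgD; last exact: cc.
apply: cvgB; last exact: cc.
by apply: cvgMr; exact: continuous_pos.
Qed.

Let is_derive_T x : is_derive x (1 : R) T (dT x).
Proof.
have aux k c : is_derive x (1 : R) (fun y => k * pos (y - c) ^+ 2) (k * (2 * pos (x - c))).
  apply: (@is_deriveZ _ _ _ (fun y => pos (y - c) ^+ 2) k x 1).
  have := @is_derive_comp_affine (fun y => pos y ^+ 2) 1 (- c) x (2 * pos (x - c)).
  rewrite !mul1r => /(_ (is_derive_pos2 _)).
  by under eq_fun do rewrite mul1r.
rewrite /T /dT.
have -> : 4 * pos x - 8 * pos (x - 2^-1) + 4 * pos (x - 1) =
  (2 * (2 * pos (x - 0)) - 4 * (2 * pos (x - 2^-1))) + 2 * (2 * pos (x - 1)).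
  by rewrite subr0; ring.
have h0 : is_derive x (1 : R) (fun y => 2 * pos y ^+ 2) (2 * (2 * pos (x - 0))).
  by have := aux 2 0; under eq_fun do rewrite subr0.
exact: (is_deriveD (is_deriveB h0 (aux 4 2^-1)) (aux 2 1)).
Qed.

(** Test functions are only required to be C^1, so a quadratic spline is smooth
    enough. Its derivative is used as an averaging kernel near an endpoint. *)
Lemma smooth_step a b : a < b -> exists S dS : R -> R,
  [/\ forall x, is_derive x (1 : R) S (dS x), continuous dS,
      forall x, 0 <= dS x, forall x, 0 <= S x <= 1 &
      [/\ forall x, x <= a -> S x = 0, forall x, b <= x -> S x = 1 &
          forall x, ~~ (a <= x <= b) -> dS x = 0]].
Proof.
move=> ab; have ba0 : 0 < b - a by rewrite subr_gt0.
pose k := (b - a)^-1; have k0 : 0 < k by rewrite invr_gt0.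
pose g x := k * x + - (k * a).
have gE x : g x = (x - a) / (b - a) by rewrite /g -mulrN -mulrDr mulrC.
have g0 x : (g x <= 0) = (x <= a).
  by rewrite gE pmulr_lle0 ?invr_gt0// subr_le0.
have g1 x : (1 <= g x) = (b <= x).
  by rewrite gE ler_pdivlMr// mul1r lerD2r.
have g0' x : (0 <= g x) = (a <= x).
  by rewrite gE pmulr_lge0 ?invr_gt0// subr_ge0.
have g1' x : (g x <= 1) = (x <= b).
  by rewrite gE ler_pdivrMr// mul1r lerD2r.
have dT0 x : 0 <= dT x.
  rewrite /dT /pos; case: (leP 0 x); case: (leP 0 (x - 2^-1)); case: (leP 0 (x - 1)); lra.
exists (fun x => T (g x)), (fun x => k * dT (g x)); split.
- by move=> x; exact: is_derive_comp_affine.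
- move=> x; apply: cvgMr; apply: (@continuous_comp _ _ _ g dT); last exact: continuous_dT.
  by apply: cvgD; [apply: cvgMr; exact: cvg_id|exact: cvg_cst].
- by move=> x; rewrite mulr_ge0// ltW.
- move=> x; move: (g x) => {}x; rewrite /T /pos.
  by case: (leP 0 x); case: (leP 0 (x - 2^-1)); case: (leP 0 (x - 1)) => ? ? ?; apply/andP; split; nra.
- split.
  + move=> x; rewrite -g0; move: (g x) => {}x x0; rewrite /T /pos.
    by rewrite !max_l; [ring|lra..].
  + move=> x; rewrite -g1; move: (g x) => {}x x1; rewrite /T /pos.
    by rewrite !max_r; [field|lra..].
  + move=> x; rewrite -g0' -g1'; move: (g x) => {}x; rewrite negb_and -!ltNge.
    move=> x01; rewrite (_ : dT x = 0) ?mulr0//; rewrite /dT /pos; case/orP : x01 => x01.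
      by rewrite !max_l; [ring|lra..].
    by rewrite !max_r; [field|lra..].
Qed.

End SmoothStep.

(** * Integrability of real functions *)

Section RealIntegrable.
Context d (T : measurableType d) (R : realType) (mu : {measure set T -> \bar R}).
Variable D : set T.
Hypothesis mD : measurable D.
Implicit Types f g : T -> R.

Lemma integrable_EFinD f g : mu.-integrable D (EFin \o f) ->
  mu.-integrable D (EFin \o g) ->
  mu.-integrable D (EFin \o (fun x => f x + g x)).
Proof.
move=> fi gi; rewrite (_ : _ \o _ = ((EFin \o f) \+ (EFin \o g))%E); last exact/funext.
exact: integrableD.
Qed.

Lemma integrable_EFinB f g : mu.-integrable D (EFin \o f) ->
  mu.-integrable D (EFin \o g) ->
  mu.-integrable D (EFin \o (fun x => f x - g x)).
Proof.
move=> fi gi; rewrite (_ : _ \o _ = ((EFin \o f) \- (EFin \o g))%E); last exact/funext.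
exact: integrableB.
Qed.

Lemma integrable_EFinZ (k : R) f : mu.-integrable D (EFin \o f) ->
  mu.-integrable D (EFin \o (fun x => k * f x)).
Proof. by move=> fi; have := integrableZl mD k fi. Qed.

Lemma integrable_EFin_sum (I : Type) (r : seq I) (P : pred I) (F : I -> T -> R) :
  (forall i, mu.-integrable D (EFin \o F i)) ->
  mu.-integrable D (EFin \o (fun x => \sum_(i <- r | P i) F i x)).
Proof.
move=> iF; elim: r => [|i r IHr].
  have -> : (fun x => \sum_(i <- [::] | P i) F i x) = fun=> 0.
    by apply/funext => x; rewrite big_nil.
  exact: integrable0.
have -> : (fun x => \sum_(j <- i :: r | P j) F j x) = (fun x =>
    if P i then F i x + \sum_(j <- r | P j) F j x else \sum_(j <- r | P j) F j x).
  by apply/funext => x; rewrite big_cons.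
by case: (P i) => //; exact: integrable_EFinD.
Qed.

Lemma Rintegral_sum (I : Type) (r : seq I) (P : pred I) (F : I -> T -> R) :
  (forall i, mu.-integrable D (EFin \o F i)) ->
  \int[mu]_(x in D) (\sum_(i <- r | P i) F i x) =
  \sum_(i <- r | P i) \int[mu]_(x in D) F i x.
Proof.
move=> iF; elim: r => [|i r IHr].
  under eq_Rintegral do rewrite big_nil.
  by rewrite big_nil Rintegral_cst// mul0r.
under eq_Rintegral do rewrite big_cons.
rewrite big_cons -IHr; case: (P i) => //.
by rewrite RintegralD//; exact: integrable_EFin_sum.
Qed.

End RealIntegrable.

(** * Integration by parts for weak derivatives *)

Section WeakIntegrationByParts.
Context {R : realType}.
Notation mu := (@lebesgue_measure R).
Implicit Types (a b c : R) (f g h phi : R -> R).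

Lemma continuous_integrable a b f : {within `[a, b], continuous f} ->
  mu.-integrable `[a, b] (EFin \o f).
Proof. by move=> cf; apply: continuous_compact_integrable => //; exact: segment_compact. Qed.

Lemma continuousM_integrable a b f g : {within `[a, b], continuous f} ->
  mu.-integrable `[a, b] (EFin \o g) ->
  mu.-integrable `[a, b] (EFin \o (fun x => f x * g x)).
Proof.
move=> cf ig; have [C C0 fC] := continuous_itv_bounded cf.
have mf : measurable_fun `[a, b] f.
  have /integrableP[/measurable_EFinP //] := continuous_integrable cf.
have mg : measurable_fun `[a, b] g by case/integrableP : ig => /measurable_EFinP.
have iCg : mu.-integrable `[a, b] (EFin \o (fun x => C * g x)).
  exact: integrable_EFinZ.
apply: (le_integrable _ _ _ iCg) => //.
  by apply/measurable_EFinP; exact: measurable_funM.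
move=> x xab /=; rewrite lee_fin !normrM ler_wpM2r// (ger0_norm (ltW C0)).
by apply: fC; move: xab; rewrite /= in_itv.
Qed.

(** The average of h against a density that lives where h is close to c: boundary
    values arise in this way from the derivatives of cut-off functions. *)
Lemma Rintegral_average a b (rho h : R -> R) c (e : R) :
  {within `[a, b], continuous rho} -> mu.-integrable `[a, b] (EFin \o h) ->
  \int[mu]_(x in `[a, b]) rho x = 1 ->
  (forall x, 0 <= rho x) ->
  (forall x, a <= x <= b -> rho x != 0 -> `|h x - c| <= e) ->
  `|\int[mu]_(x in `[a, b]) (rho x * h x) - c| <= e.
Proof.
move=> crho ih rho1 rho0 hc.
have irho := continuous_integrable crho.
have irh := continuousM_integrable crho ih.
have irc k : mu.-integrable `[a, b] (EFin \o (fun x => rho x * k)).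
  rewrite (_ : (fun x => rho x * k) = fun x => k * rho x).
    exact: integrable_EFinZ.
  by apply/funext => x; rewrite mulrC.
rewrite -[c in X in _ - X]mul1r -rho1 -RintegralZr// -RintegralB//.
have ird : mu.-integrable `[a, b] (EFin \o (fun x => rho x * h x - rho x * c)).
  exact: integrable_EFinB.
apply: le_trans (le_normr_Rintegral _ ird) _ => //.
have -> : e = \int[mu]_(x in `[a, b]) (rho x * e) by rewrite RintegralZr// rho1 mul1r.
apply: le_Rintegral => //; first exact: (integrable_norm ird).
move=> x; rewrite /= in_itv/= => xab.
rewrite -mulrBr normrM (ger0_norm (rho0 x)).
have [->|r0] := eqVneq (rho x) 0; first by rewrite !mul0r.
by rewrite ler_wpM2l// hc.
Qed.

Lemma continuous_of_is_derive (f df : R -> R) :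
  (forall x, is_derive x (1 : R) f (df x)) -> continuous f.
Proof.
by move=> fd x; apply/differentiable_continuous/derivable1_diffP; have [] := fd x.
Qed.

Lemma Rintegral_is_derive a b (f df : R -> R) : a < b ->
  (forall x, is_derive x (1 : R) f (df x)) -> continuous df ->
  \int[mu]_(x in `[a, b]) df x = f b - f a.
Proof.
move=> ab fd cdf; rewrite /Rintegral (@continuous_FTC2 _ df f)//.
- exact: continuous_subspaceT.
- have cf := continuous_of_is_derive fd; split.
  + by move=> x _; have [] := fd x.
  + by apply: cvg_at_right_filter; exact: cf.
  + by apply: cvg_at_left_filter; exact: cf.
- by move=> x _; rewrite derive1E; have [_ ->] := fd x.
Qed.

Lemma within_continuous_ends a b h (e : R) : a < b ->
  {within `[a, b], continuous h} -> 0 < e ->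
  exists2 d : R, 0 < d & forall x, a <= x <= b ->
    (x <= a + d -> `|h x - h a| <= e) /\ (b - d <= x -> `|h x - h b| <= e).
Proof.
move=> ab /subspace_continuousP ch e0.
have near_end c : a <= c <= b -> exists2 d : R, 0 < d &
    forall x, a <= x <= b -> `|x - c| < d -> `|h x - h c| <= e.
  move=> cab; have := ch c; rewrite /= in_itv/= => /(_ cab).
  move=> /cvgrPdist_le /(_ _ e0); rewrite near_withinE => -[d /= d0 H].
  exists d => // x xab xc; rewrite distrC; apply: H; last by rewrite /= in_itv.
  by rewrite /ball_/= distrC.
have [d1 d10 H1] := near_end a ltac:(by rewrite lexx ltW).
have [d2 d20 H2] := near_end b ltac:(by rewrite lexx ltW).
exists (Num.min d1 d2 / 2); first by rewrite divr_gt0// lt_min d10.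
have m1 : Num.min d1 d2 <= d1 by rewrite ge_min lexx.
have m2 : Num.min d1 d2 <= d2 by rewrite ge_min lexx orbT.
move=> x xab; have /andP[ax xb] := xab.
split=> hx; [apply: H1 => //|apply: H2 => //].
  by rewrite ger0_norm ?subr_ge0//; lra.
by rewrite distrC ger0_norm ?subr_ge0//; lra.
Qed.

Definition scalar_weak_derivative a b f g := forall psi, test_function a b psi ->
  \int[mu]_(x in `[a, b]) (derive1 psi x * f x) =
  - \int[mu]_(x in `[a, b]) (psi x * g x).

(** A weak derivative is tested against functions supported inside the open
    interval, so phi is multiplied by a cut-off chi that rises from 0 to 1 near a
    and falls back to 0 near b. The derivative of chi averages phi f near both
    endpoints, which yields the boundary terms by continuity of f; the integrals
    against 1 - chi are small because 1 - chi lives on a set of small measure. *)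
Lemma weak_ibp a b f g phi dphi : a < b ->
  {within `[a, b], continuous f} -> mu.-integrable `[a, b] (EFin \o g) ->
  scalar_weak_derivative a b f g ->
  (forall x, is_derive x (1 : R) phi (dphi x)) -> continuous dphi ->
  \int[mu]_(x in `[a, b]) (dphi x * f x) =
  phi b * f b - phi a * f a - \int[mu]_(x in `[a, b]) (phi x * g x).
Proof.
move=> ab cf ig fg phid cdphi.
have cphi := continuous_of_is_derive phid.
have withinT (k : R -> R) : continuous k -> {within `[a, b], continuous k}.
  by move=> ck; exact: continuous_subspaceT.
have if_ := continuous_integrable cf.
pose h x := phi x * f x.
have ch : {within `[a, b], continuous h}.
  by move=> x; apply: cvgM; [exact: withinT|exact: cf].
have ih := continuous_integrable ch.
have idf := continuousM_integrable (withinT _ cdphi) if_.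
have ipg := continuousM_integrable (withinT _ cphi) ig.
pose Psi x := dphi x * f x + phi x * g x.
have iPsi : mu.-integrable `[a, b] (EFin \o Psi).
  exact: integrable_EFinD.
suff : forall e : R, 0 < e ->
    `|\int[mu]_(x in `[a, b]) Psi x - (h b - h a)| <= 0 + 3 * e.
  move=> H; have : `|\int[mu]_(x in `[a, b]) Psi x - (h b - h a)| <= 0.
    apply/ler_addgt0Pr => e e0; have := H (e / 3) ltac:(by rewrite divr_gt0).
    by rewrite mulrCA divff// mulr1.
  rewrite normr_le0 subr_eq0 => /eqP; rewrite RintegralD// => <-.
  by rewrite addrK.
move=> e e0; rewrite add0r.
have iPsi' : mu.-integrable setT (EFin \o (Psi \_ `[a, b])).
  by rewrite -restrict_EFin; apply/integrable_restrict => //=; rewrite setIidr.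
have [d [d0 Hd]] := integral_normr_continuous iPsi' e0.
have [d1 d10 Hd1] := within_continuous_ends ab ch e0.
pose m := Num.min (Num.min d d1) (b - a).
have m0 : 0 < m by rewrite !lt_min d0 d10 subr_gt0.
(* Where chi differs from 1 has measure 4 n, and chi varies within 2 n of the ends. *)
pose n := m / 5; have n0 : 0 < n by rewrite divr_gt0.
have nd : 4 * n < d.
  have : m <= d by rewrite !ge_min lexx.
  by rewrite /n; lra.
have nd1 : 2 * n < d1.
  have : m <= d1 by rewrite !ge_min lexx orbT.
  by rewrite /n; lra.
have nba : 4 * n < b - a.
  have : m <= b - a by rewrite !ge_min lexx orbT.
  by rewrite /n; lra.
clearbody n; clear m m0.
have [S [dS [Sd cdS dS0 S01 [Sl Sr dSo]]]] : exists S dS : R -> R, _ :=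
  @smooth_step R (a + n) (a + 2 * n) ltac:(lra).
have [T [dT [Td cdT dT0 T01 [Tl Tr dTo]]]] : exists S dS : R -> R, _ :=
  @smooth_step R (b - 2 * n) (b - n) ltac:(lra).
pose chi x := S x - T x.
have chid x : is_derive x (1 : R) chi (dS x - dT x) by exact: (is_deriveB (Sd x) (Td x)).
have cchi := continuous_of_is_derive chid.
pose psi x := phi x * chi x.
pose dpsi x := phi x * (dS x - dT x) + chi x * dphi x.
have psid x : is_derive x (1 : R) psi (dpsi x).
  exact: (is_deriveM (phid x) (chid x)).
have dpsiE : derive1 psi = dpsi.
  by apply/funext => x; rewrite derive1E; have [_ ->] := psid x.
have cS := continuous_of_is_derive Sd; have cT := continuous_of_is_derive Td.
have test : test_function a b psi.
  split; first by move=> x; have [] := psid x.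
    rewrite dpsiE => x; apply: cvgD; apply: cvgM; [exact: cphi| |exact: cchi|exact: cdphi].
    by apply: cvgB; [exact: cdS|exact: cdT].
  exists (a + n), (b - n); split; [lra..|] => x /negP.
  rewrite negb_and -!ltNge /psi /chi => /orP[] hx.
    by rewrite Sl ?Tl ?subrr ?mulr0//; lra.
  by rewrite Sr ?Tr ?subrr ?mulr0//; lra.
have := fg _ test; rewrite dpsiE.
have iS := continuousM_integrable (withinT _ cdS) ih.
have iT := continuousM_integrable (withinT _ cdT) ih.
have ichi := continuousM_integrable (withinT _ cchi) iPsi.
have icg := continuousM_integrable (withinT _ cchi) ipg.
have icf := continuousM_integrable (withinT _ cchi) idf.
have -> : \int[mu]_(x in `[a, b]) (dpsi x * f x) =
    \int[mu]_(x in `[a, b]) (dS x * h x) - \int[mu]_(x in `[a, b]) (dT x * h x) +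
    \int[mu]_(x in `[a, b]) (chi x * (dphi x * f x)).
  rewrite -RintegralB// -RintegralD//.
    by apply: eq_Rintegral => x _; rewrite /dpsi /h; ring.
  exact: integrable_EFinB.
have -> : \int[mu]_(x in `[a, b]) (psi x * g x) =
    \int[mu]_(x in `[a, b]) (chi x * (phi x * g x)).
  by apply: eq_Rintegral => x _; rewrite /psi; ring.
have -> : \int[mu]_(x in `[a, b]) Psi x =
    \int[mu]_(x in `[a, b]) ((1 - chi x) * Psi x) +
    (\int[mu]_(x in `[a, b]) (chi x * (dphi x * f x)) +
     \int[mu]_(x in `[a, b]) (chi x * (phi x * g x))).
  rewrite -RintegralD//.
  have -> : \int[mu]_(x in `[a, b]) (chi x * (dphi x * f x) + chi x * (phi x * g x)) =
      \int[mu]_(x in `[a, b]) (chi x * Psi x).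
    by apply: eq_Rintegral => x _; rewrite /Psi; ring.
  rewrite -RintegralD//.
    by apply: eq_Rintegral => x _; ring.
  apply: continuousM_integrable => //; apply: withinT => x.
  by apply: cvgB; [exact: cvg_cst|exact: cchi].
have one (c k : R -> R) : (forall x, is_derive x (1 : R) c (k x)) -> continuous k ->
    c a = 0 -> c b = 1 -> \int[mu]_(x in `[a, b]) k x = 1.
  by move=> ck cck ca cb; rewrite (Rintegral_is_derive ab ck cck) ca cb subr0.
have bS : `|\int[mu]_(x in `[a, b]) (dS x * h x) - h a| <= e.
  apply: Rintegral_average => //; first exact: withinT.
    by apply: (one _ _ Sd) => //; [rewrite Sl//; lra|rewrite Sr//; lra].
  move=> x xab dSx; apply: (Hd1 _ xab).1.
  have : a + n <= x <= a + 2 * n by apply/negPn; apply: contra_neqN dSx => /dSo.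
  by move=> /andP[_]; lra.
have bT : `|\int[mu]_(x in `[a, b]) (dT x * h x) - h b| <= e.
  apply: Rintegral_average => //; first exact: withinT.
    by apply: (one _ _ Td) => //; [rewrite Tl//; lra|rewrite Tr//; lra].
  move=> x xab dTx; apply: (Hd1 _ xab).2.
  have : b - 2 * n <= x <= b - n by apply/negPn; apply: contra_neqN dTx => /dTo.
  by move=> /andP[+ _]; lra.
pose A := `[a, a + 2 * n] `|` `[b - 2 * n, b].
have bP : `|\int[mu]_(x in `[a, b]) ((1 - chi x) * Psi x)| <= e.
  have i1 : mu.-integrable `[a, b] (EFin \o (fun x => (1 - chi x) * Psi x)).
    apply: continuousM_integrable => //; apply: withinT => x.
    by apply: cvgB; [exact: cvg_cst|exact: cchi].
  have mA : measurable (A : set R) by exact: measurableU.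
  apply: le_trans (le_normr_Rintegral _ i1) _ => //.
  apply: (@le_trans _ _ (\int[mu]_(x in A) `|(Psi \_ `[a, b]) x|)); last first.
    apply: ltW; apply: Hd => //; apply: (le_lt_trans (measureU2 _ _ _)) => //.
    have l1 : mu `[a, a + 2 * n] = (2 * n)%:E.
      by rewrite lebesgue_measure_itv/= lte_fin ifT -?EFinB; [congr EFin; ring|lra].
    have l2 : mu `[b - 2 * n, b] = (2 * n)%:E.
      by rewrite lebesgue_measure_itv/= lte_fin ifT -?EFinB; [congr EFin; ring|lra].
    by rewrite [X in (X + _)%E]l1 [X in (_ + X)%E]l2 -EFinD lte_fin; lra.
  have AE : \int[mu]_(x in A) `|(Psi \_ `[a, b]) x| =
      \int[mu]_(x in `[a, b]) ((fun x => `|Psi x|) \_ A) x.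
    rewrite -Rintegral_mkcondr [RHS]Rintegral_mkcond [LHS]Rintegral_mkcond.
    apply: eq_Rintegral => x _; rewrite !patchE in_setI.
    by case: (x \in A); rewrite ?andbT ?andbF//; case: ifP => // _; exact: normr0.
  rewrite AE; apply: le_Rintegral => //; first exact: (integrable_norm i1).
    rewrite -restrict_EFin; apply/integrable_restrict => //.
    apply: (integrableS _ _ (@subIsetl _ _ _)) => //; first exact: measurableI.
    exact: (integrable_norm iPsi).
  move=> x /=; rewrite in_itv/= => /andP[ax xb]; rewrite patchE.
  case: ifPn => [xA|].
    rewrite normrM ler_piMl// ler_norml.
    have := S01 x; have := T01 x; rewrite /chi.
    move: xA; rewrite inE /A /= !in_itv/= => -[] /andP[h1 h2].
      by rewrite Tl; [move=> _ /andP[? ?]; apply/andP; split; lra|lra].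
    by rewrite Sr; [move=> /andP[? ?] _; apply/andP; split; lra|lra].
  rewrite notin_setE /A /= !in_itv/= ax xb => /not_orP[/negP h1 /negP h2].
  rewrite /chi Sr ?Tl ?subr0 ?subrr ?mul0r ?normr0//.
    by move: h2; rewrite andbT -ltNge => /ltW.
  by move: h1; rewrite /= -ltNge => /ltW.
move: bS bT bP => /ler_normlP[s1 s2] /ler_normlP[t1 t2] /ler_normlP[p1 p2] E.
move: s1 s2 t1 t2 p1 p2 E.
move: (\int[mu]_(x in `[a, b]) (dS x * h x)) (\int[mu]_(x in `[a, b]) (dT x * h x)).
move: (\int[mu]_(x in `[a, b]) (chi x * (dphi x * f x))).
move: (\int[mu]_(x in `[a, b]) (chi x * (phi x * g x))).
move: (\int[mu]_(x in `[a, b]) ((1 - chi x) * Psi x)) (h a) (h b).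
clear => *; apply/ler_normlP; split; lra.
Qed.

End WeakIntegrationByParts.

(** * Moving integrals *)

Section DelayIntegral.
Context {R : realType}.
Notation mu := (@lebesgue_measure R).
Implicit Types (a b c t : R) (f g u : R -> R).

(** The oriented integral from 0. Near x it differs by a constant from the
    integral from a fixed c smaller than x and 0, which the fundamental theorem of
    calculus covers. *)
Lemma continuous_antiderivative u : continuous u ->
  exists U : R -> R, forall x, is_derive x (1 : R) U (u x).
Proof.
move=> cu.
have iu c d : mu.-integrable `[c, d] (EFin \o u).
  by apply: continuous_integrable; exact: continuous_subspaceT.
have itvB c x d : c <= x -> x <= d -> \int[mu]_(y in `[c, d]) u y =
    \int[mu]_(y in `[c, x]) u y + \int[mu]_(y in `[x, d]) u y.
  move=> cx xd; apply/eqP; rewrite addrC -subr_eq Rintegral_itvB ?bnd_simp//.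
  rewrite Rintegral_itv_obnd_cbnd//.
  by apply: integrableS (iu x d) => //; exact: subset_itv_oc_cc.
pose U x := \int[mu]_(y in `[0, x]) u y - \int[mu]_(y in `[x, 0]) u y.
exists U => x.
pose c := Num.min x 0 - 1.
have cx : c < x.
  have : Num.min x 0 <= x by rewrite ge_min lexx.
  by rewrite /c; lra.
have c0 : c < 0.
  have : Num.min x 0 <= 0 by rewrite ge_min lexx orbT.
  by rewrite /c; lra.
clearbody c.
have UE y : c <= y -> \int[mu]_(z in `[c, y]) u z - \int[mu]_(z in `[c, 0]) u z = U y.
  move=> cy; rewrite /U.
  have zero d e : e <= d -> \int[mu]_(z in `[d, e]) u z = 0.
    rewrite le_eqVlt => /predU1P[->|ed]; first by rewrite set_itv1 Rintegral_set1.
    by rewrite set_itv_ge ?Rintegral_set0// bnd_simp -ltNge.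
  have [y0|y0] := leP 0 y.
    by rewrite (itvB c 0 y)// ?(ltW c0)// (zero y 0)//; ring.
  by rewrite (itvB c y 0)// ?(ltW y0)// (zero 0 y) ?(ltW y0)//; ring.
have x1 : x < x + 1 by rewrite ltrDl.
have [dG Gu] := continuous_FTC1_closed x1 (iu c (x + 1)) cx (cu x).
apply: (@near_eq_is_derive _ _ _
    (fun y => \int[mu]_(z in `[c, y]) u z - \int[mu]_(z in `[c, 0]) u z)).
  near=> y; apply: UE; near: y; exact: lt_le_nbhsr.
rewrite -[u x]subr0; apply: (@is_deriveB _ _ _ (fun y => \int[mu]_(z in `[c, y]) u z) (fun=> _)).
by rewrite -Gu derive1E; exact/derivableP.
Unshelve. all: by end_near. Qed.

(** The function u is merely continuous and cannot be differentiated under the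
    integral sign. Integrating by parts replaces u by an antiderivative, after
    which differentiation under the integral sign is possible. *)
Lemma delay_integral_is_derive a b f g u : a < b ->
  {within `[a, b], continuous f} -> mu.-integrable `[a, b] (EFin \o g) ->
  scalar_weak_derivative a b f g ->
  continuous u -> forall t,
  is_derive t (1 : R) (fun t => \int[mu]_(x in `[a, b]) (f x * u (t + x)))
    (f b * u (t + b) - f a * u (t + a) -
     \int[mu]_(x in `[a, b]) (g x * u (t + x))).
Proof.
move=> ab cf ig fg cu t.
have [U Ud] := continuous_antiderivative cu.
have shiftd s x : is_derive x (1 : R) (fun y => U (s + y)) (u (s + x)).
  have := @is_derive_comp_affine _ U 1 s x (u (s + x)).
  rewrite !mul1r addrC => /(_ (Ud _)).
  by under eq_fun do rewrite mul1r addrC.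
have cshift s (k : R -> R) : continuous k -> continuous (fun y => k (s + y)).
  move=> ck y; apply: (@continuous_comp _ _ _ (fun y => s + y) k).
    by apply: cvgD; [exact: cvg_cst|exact: cvg_id].
  exact: ck.
have -> : (fun t => \int[mu]_(x in `[a, b]) (f x * u (t + x))) =
    fun t => U (t + b) * f b - U (t + a) * f a - \int[mu]_(x in `[a, b]) (U (t + x) * g x).
  apply/funext => s.
  rewrite -(weak_ibp ab cf ig fg (shiftd s) (cshift s _ cu)).
  by apply: eq_Rintegral => x _; rewrite mulrC.
have shiftd' s : is_derive t (1 : R) (fun y => U (y + s)) (u (t + s)).
  have := @is_derive_comp_affine _ U 1 s t (u (t + s)).
  rewrite !mul1r => /(_ (Ud _)).
  by under eq_fun do rewrite mul1r.
have dbound (v w : R) : is_derive t (1 : R) (fun y => U (y + v) * w) (w * u (t + v)).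
  have := is_deriveZ w (shiftd' v).
  rewrite (_ : w \*: _ = (fun y => U (y + v) * w)) //.
  by apply/funext => y; rewrite mulrC.
have cU := continuous_of_is_derive Ud.
have [C C0 uC] : exists2 C : R, 0 < C &
    forall x, t - 1 + a <= x <= t + 1 + b -> `|u x| <= C.
  by apply: continuous_itv_bounded; exact: continuous_subspaceT.
pose F s x := U (s + x) * g x.
have F1 s x : is_derive s (1 : R) (fun y => F y x) (g x * u (s + x)).
  have := @is_derive_comp_affine _ U 1 x s (u (s + x)).
  rewrite !mul1r => /(_ (Ud _)) h.
  have := is_deriveZ (g x) h; rewrite (_ : g x \*: _ = (fun y => F y x)) //.
  by apply/funext => y; rewrite /F/= mul1r mulrC.
have It : `]t - 1, t + 1[%classic t by rewrite /= in_itv/=; apply/andP; split; lra.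
have mab : measurable (`[a, b]%classic : set (measurableTypeR R)) by exact: measurable_itv.
have iF s : `]t - 1, t + 1[%classic s -> mu.-integrable `[a, b] (EFin \o F s).
  move=> _; apply: continuousM_integrable => //.
  by apply: continuous_subspaceT; exact: cshift.
have dF s x : `]t - 1, t + 1[%classic s -> `[a, b]%classic x -> derivable (F ^~ x) s 1.
  by move=> _ _; have [] := F1 s x.
have d1E s x : partial1of2 F s x = g x * u (s + x).
  by rewrite partial1of2E; have [_ ->] := F1 s x.
have G0 y : 0 <= C * `|g y| by rewrite mulr_ge0// ltW.
have iG : mu.-integrable `[a, b] (EFin \o (fun y => C * `|g y|)).
  by apply: integrable_EFinZ => //; exact: (integrable_norm ig).
have Gub s x : `]t - 1, t + 1[%classic s -> `[a, b]%classic x ->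
    `|partial1of2 F s x| <= C * `|g x|.
  rewrite /= !in_itv/= => /andP[? ?] /andP[? ?].
  by rewrite d1E normrM mulrC ler_wpM2r// uC//; apply/andP; split; lra.
have dI : is_derive t (1 : R) (fun s => \int[mu]_(x in `[a, b]) (U (s + x) * g x))
    (\int[mu]_(x in `[a, b]) (g x * u (t + x))).
  apply: DeriveDef; first exact: (derivable_under_integral mab It iF dF G0 iG Gub).
  rewrite -derive1E (differentiation_under_integral mab It iF dF G0 iG Gub).
  by apply: eq_Rintegral => x _; rewrite d1E.
exact: (is_deriveB (is_deriveB (dbound b (f b)) (dbound a (f a))) dI).
Qed.

(** The derivative found in [delay_integral_is_derive] is bounded on compact
    intervals, so the function is Lipschitz there. *)
Lemma delay_integral_ac a b f g u : a < b ->
  {within `[a, b], continuous f} -> mu.-integrable `[a, b] (EFin \o g) ->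
  scalar_weak_derivative a b f g ->
  continuous u -> forall c d,
  abs_continuous c d (fun t => \int[mu]_(x in `[a, b]) (f x * u (t + x))).
Proof.
move=> ab cf ig fg cu c d.
have Gd := delay_integral_is_derive ab cf ig fg cu.
set G := fun t => _ in Gd *.
have [C C0 uC] : exists2 C : R, 0 < C &
    forall x, c + a <= x <= d + b -> `|u x| <= C.
  by apply: continuous_itv_bounded; exact: continuous_subspaceT.
apply: (@lipschitz_ac _ _ _ (`|f b| * C + `|f a| * C +
    C * \int[mu]_(x in `[a, b]) `|g x|)) => s t cs st td.
have cG : continuous G by apply: continuous_of_is_derive Gd.
have [|x xst ->] := MVT_segment st (fun x _ => Gd x).
  exact: continuous_subspaceT.
have {xst} /andP[sx xt] : s <= x <= t by move: xst; rewrite inE.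
rewrite normrM [X in _ * X]ger0_norm ?subr_ge0// ler_wpM2r ?subr_ge0//.
have uCx y : a <= y <= b -> `|u (x + y)| <= C.
  by move=> /andP[? ?]; apply: uC; apply/andP; split; lra.
have ign := integrable_norm ig.
have igu : mu.-integrable `[a, b] (EFin \o (fun y => u (x + y) * g y)).
  apply: continuousM_integrable => //; apply: continuous_subspaceT => y.
  apply: (@continuous_comp _ _ _ (fun y => x + y) u); last exact: cu.
  by apply: cvgD; [exact: cvg_cst|exact: cvg_id].
apply: le_trans (ler_normB _ _) _; apply: lerD.
  apply: le_trans (ler_normB _ _) _; rewrite !normrM; apply: lerD.
    by rewrite ler_wpM2l// uCx// lexx ltW.
  by rewrite ler_wpM2l// uCx// lexx ltW.
under eq_Rintegral do rewrite mulrC.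
apply: le_trans (le_normr_Rintegral _ igu) _ => //.
rewrite -RintegralZl//; apply: le_Rintegral => //.
- exact: (integrable_norm igu).
- by apply: integrable_EFinZ.
- by move=> y /=; rewrite in_itv/= => yab; rewrite normrM ler_wpM2r// uCx.
Qed.

End DelayIntegral.

(** * Square-integrable matrix functions and Bessel's inequality *)

Section MatrixIntegral.
Context {R : realType}.
Notation mu := (@lebesgue_measure R).
Variables a b : R.
Local Notation I := (`[a, b]%classic).

Definition sq_integrable (f : R -> R) :=
  measurable_fun I f /\ mu.-integrable I (fun x => (f x ^+ 2)%:E).

Definition mxintegrable k l (F : R -> 'M[R]_(k, l)) :=
  forall i j, mu.-integrable I (EFin \o (fun x => F x i j)).

Lemma sq_integrableM f g : sq_integrable f -> sq_integrable g ->
  mu.-integrable I (EFin \o (fun x => f x * g x)).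
Proof.
move=> [mf f2] [mg g2].
have h : mu.-integrable I (EFin \o (fun x => f x ^+ 2 + g x ^+ 2)).
  exact: integrable_EFinD.
apply: (le_integrable _ _ _ h) => //.
  by apply/measurable_EFinP; exact: measurable_funM.
move=> x _ /=; rewrite lee_fin [leRHS]ger0_norm ?addr_ge0 ?sqr_ge0//.
have := sqr_ge0 (f x - g x); have := sqr_ge0 (f x + g x).
by have := sqr_ge0 (f x); have := sqr_ge0 (g x); move=> *; apply/ler_normlP; split; nra.
Qed.

Lemma sq_integrable_continuous f : {within I, continuous f} -> sq_integrable f.
Proof.
move=> cf; have := continuous_integrable cf; split.
  by case/integrableP : H => /measurable_EFinP.
have := continuousM_integrable cf H.
by apply: eq_integrable => // x _ /=; rewrite expr2.
Qed.

Lemma sq_integrable1 f : sq_integrable f -> mu.-integrable I (EFin \o f).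
Proof.
move=> sf; have s1 : sq_integrable (fun=> 1).
  by apply: sq_integrable_continuous => x; exact: cvg_cst.
have := sq_integrableM s1 sf.
by apply: eq_integrable => // x _ /=; rewrite mul1r.
Qed.

Lemma sq_integrableZ k f : sq_integrable f -> sq_integrable (fun x => k * f x).
Proof.
move=> [mf f2]; split; first exact: measurable_funM.
have : mu.-integrable I (EFin \o (fun x => k ^+ 2 * f x ^+ 2)) by exact: integrable_EFinZ.
by apply: eq_integrable => // x _ /=; rewrite exprMn.
Qed.

Lemma sq_integrableD f g : sq_integrable f -> sq_integrable g ->
  sq_integrable (fun x => f x + g x).
Proof.
move=> sf sg; have ifg := sq_integrableM sf sg.
move: sf sg => [mf f2] [mg g2]; split; first exact: measurable_funD.
have : mu.-integrable I (EFin \o (fun x => f x ^+ 2 + (2 * (f x * g x) + g x ^+ 2))).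
  apply: integrable_EFinD => //; apply: integrable_EFinD => //; exact: integrable_EFinZ.
by apply: eq_integrable => // x _ /=; congr EFin; ring.
Qed.

Lemma sq_integrable_ae_le (f g : R -> R) : measurable_fun I f ->
  mu.-integrable I (EFin \o g) ->
  {ae mu, forall t, a <= t <= b -> f t ^+ 2 <= g t} -> sq_integrable f.
Proof.
move=> mf ig fg; split => //.
have mI : measurable (I : set (measurableTypeR R)) by exact: measurable_itv.
have mf2 : measurable_fun I (fun x => f x ^+ 2) by exact: measurable_funX.
apply/integrableP; split; first exact/measurable_EFinP.
have /integrableP[mg gfin] := ig.
apply: le_lt_trans gfin; apply: ae_ge0_le_integral => //.
- by apply: measurableT_comp => //; exact/measurable_EFinP.
- by apply: measurableT_comp.
have aeF := @ae_filter_ringOfSetsType _ _ _ mu.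
apply: (@filterS _ _ aeF _ _ _ fg) => t h /=; rewrite in_itv/= => tab.
rewrite lee_fin ger0_norm ?sqr_ge0//; exact: le_trans (h tab) (ler_norm _).
Qed.

Lemma sq_integrable_sum (J : Type) (r : seq J) (P : pred J) (F : J -> R -> R) :
  (forall j, sq_integrable (F j)) ->
  sq_integrable (fun x => \sum_(j <- r | P j) F j x).
Proof.
move=> sF; elim: r => [|j r IHr].
  have -> : (fun x => \sum_(i <- [::] | P i) F i x) = fun=> 0.
    by apply/funext => x; rewrite big_nil.
  by apply: sq_integrable_continuous => x; exact: cvg_cst.
have -> : (fun x => \sum_(i <- j :: r | P i) F i x) = (fun x =>
    if P j then F j x + \sum_(i <- r | P i) F i x else \sum_(i <- r | P i) F i x).
  by apply/funext => x; rewrite big_cons.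
by case: (P j) => //; exact: sq_integrableD.
Qed.

Lemma L2_mulmx k l m (A : 'M[R]_(k, l)) (F : R -> 'M[R]_(l, m)) :
  L2 I F -> L2 I (fun x => A *m F x).
Proof.
move=> LF i j.
have -> : (fun x => (A *m F x) i j) = fun x => \sum_p A i p * F x p j.
  by apply/funext => x; rewrite mxE.
have -> : (fun x => (((A *m F x) i j) ^+ 2)%:E) =
    fun x => ((\sum_p A i p * F x p j) ^+ 2)%:E.
  by apply/funext => x; rewrite mxE.
by apply: sq_integrable_sum => p; apply: sq_integrableZ; exact: LF.
Qed.

Lemma L2_tr k l (F : R -> 'M[R]_(k, l)) : L2 I F -> L2 I (fun x => (F x)^T).
Proof.
move=> LF i j; have := LF j i.
have -> : (fun x => F x j i) = (fun x => (F x)^T i j) by apply/funext => x; rewrite mxE.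
by rewrite (_ : (fun x => (F x j i ^+ 2)%:E) = fun x => ((F x)^T i j ^+ 2)%:E)//;
  apply/funext => x; rewrite mxE.
Qed.

Lemma L2_sub k l (A B : set R) (F : R -> 'M[R]_(k, l)) :
  measurable (A : set (measurableTypeR R)) -> measurable (B : set (measurableTypeR R)) ->
  A `<=` B -> L2 B F -> L2 A F.
Proof.
move=> mA mB AB LF i j; have [mF iF] := LF i j; split; first exact: measurable_funS mF.
exact: (integrableS mB mA AB iF).
Qed.

Lemma L2_col_mx k1 k2 l (F : R -> 'M[R]_(k1, l)) (G : R -> 'M[R]_(k2, l)) :
  L2 I F -> L2 I G -> L2 I (fun x => col_mx (F x) (G x)).
Proof.
move=> LF LG i j; case: (split_ordP i) => i' ->.
  rewrite (_ : (fun x => _) = fun x => F x i' j).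
    rewrite (_ : (fun x => (_ ^+ 2)%:E) = fun x => (F x i' j ^+ 2)%:E); first exact: LF.
    by apply/funext => x; rewrite col_mxEu.
  by apply/funext => x; rewrite col_mxEu.
rewrite (_ : (fun x => _) = fun x => G x i' j).
  rewrite (_ : (fun x => (_ ^+ 2)%:E) = fun x => (G x i' j ^+ 2)%:E); first exact: LG.
  by apply/funext => x; rewrite col_mxEd.
by apply/funext => x; rewrite col_mxEd.
Qed.

Lemma mxintegrable_mul_tr k l (F : R -> 'cV[R]_k) (G : R -> 'cV[R]_l) :
  L2 I F -> L2 I G -> mxintegrable (fun x => F x *m (G x)^T).
Proof.
move=> LF LG i j; have := sq_integrableM (LF i 0) (LG j 0).
by apply: eq_integrable => // x _ /=; rewrite mxE big_ord1 mxE.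
Qed.

Lemma mxintegrable_mulmx k l m (A : 'M[R]_(k, l)) (F : R -> 'M[R]_(l, m)) :
  mxintegrable F -> mxintegrable (fun x => A *m F x).
Proof.
move=> iF i j.
have : mu.-integrable I (EFin \o (fun x => \sum_p A i p * F x p j)).
  by apply: integrable_EFin_sum => // p; exact: integrable_EFinZ.
by apply: eq_integrable => // x _ /=; rewrite mxE.
Qed.

Lemma mxintegrable_tr k l (F : R -> 'M[R]_(k, l)) :
  mxintegrable F -> mxintegrable (fun x => (F x)^T).
Proof. by move=> iF i j; apply: eq_integrable (iF j i) => // x _ /=; rewrite mxE. Qed.

Lemma mxintegrableD k l (F G : R -> 'M[R]_(k, l)) :
  mxintegrable F -> mxintegrable G -> mxintegrable (fun x => F x + G x).
Proof.
move=> iF iG i j.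
have : mu.-integrable I (EFin \o (fun x => F x i j + G x i j)).
  exact: integrable_EFinD.
by apply: eq_integrable => // x _ /=; rewrite mxE.
Qed.

Lemma eq_mxint k l (F G : R -> 'M[R]_(k, l)) :
  (forall x, a <= x <= b -> F x = G x) -> mxint I F = mxint I G.
Proof.
move=> FG; apply/matrixP => i j; rewrite !mxE; apply: eq_Rintegral => x.
by rewrite inE/= in_itv/= => /FG ->.
Qed.

Lemma mxint_mulmx k l m (A : 'M[R]_(k, l)) (F : R -> 'M[R]_(l, m)) :
  mxintegrable F -> mxint I (fun x => A *m F x) = A *m mxint I F.
Proof.
move=> iF; apply/matrixP => i j; rewrite !mxE.
under eq_Rintegral do rewrite mxE.
rewrite Rintegral_sum//; last by move=> p; apply: integrable_EFinZ.
by apply: eq_bigr => p _; rewrite RintegralZl// mxE.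
Qed.

Lemma mxint_trmx k l (F : R -> 'M[R]_(k, l)) :
  mxint I (fun x => (F x)^T) = (mxint I F)^T.
Proof.
by apply/matrixP => i j; rewrite !mxE; apply: eq_Rintegral => x _; rewrite mxE.
Qed.

Lemma mxint_mulmxr k l m (A : 'M[R]_(l, m)) (F : R -> 'M[R]_(k, l)) :
  mxintegrable F -> mxint I (fun x => F x *m A) = mxint I F *m A.
Proof.
move=> iF; apply: trmx_inj; rewrite trmx_mul -!mxint_trmx.
rewrite -mxint_mulmx; last exact: mxintegrable_tr.
by apply: eq_mxint => x _; rewrite trmx_mul.
Qed.

Lemma mxintD k l (F G : R -> 'M[R]_(k, l)) : mxintegrable F -> mxintegrable G ->
  mxint I (fun x => F x + G x) = mxint I F + mxint I G.
Proof.
move=> iF iG; apply/matrixP => i j; rewrite !mxE.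
by under eq_Rintegral do rewrite mxE; rewrite RintegralD.
Qed.

Lemma mxintB k l (F G : R -> 'M[R]_(k, l)) : mxintegrable F -> mxintegrable G ->
  mxint I (fun x => F x - G x) = mxint I F - mxint I G.
Proof.
move=> iF iG; apply/matrixP => i j; rewrite !mxE.
by under eq_Rintegral do rewrite !mxE; rewrite RintegralB.
Qed.

Lemma mxint_col_mx k1 k2 l (F : R -> 'M[R]_(k1, l)) (G : R -> 'M[R]_(k2, l)) :
  mxint I (fun x => col_mx (F x) (G x)) = col_mx (mxint I F) (mxint I G).
Proof.
apply/matrixP => i j; rewrite mxE.
case: (split_ordP i) => i' ->; rewrite (col_mxEu, col_mxEd) mxE;
  by apply: eq_Rintegral => x _; rewrite (col_mxEu, col_mxEd).
Qed.

Lemma mxtrace_integrable k (F : R -> 'M[R]_k) :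
  mxintegrable F -> mu.-integrable I (EFin \o (fun x => \tr (F x))).
Proof. by move=> iF; apply: integrable_EFin_sum => // i; exact: iF. Qed.

Lemma mxint_mxtrace k (F : R -> 'M[R]_k) :
  mxintegrable F -> \int[mu]_(x in I) \tr (F x) = \tr (mxint I F).
Proof.
move=> iF; rewrite /mxtrace Rintegral_sum//.
by apply: eq_bigr => i _; rewrite mxE.
Qed.

(** The Bessel inequality for the quadratic form of Q: integrate the form at
    the residual y - N^T E of the orthogonal projection on the span of E. *)
Lemma bessel_inequality k l (E : R -> 'cV[R]_k) (y : R -> 'cV[R]_l) (Q : 'M[R]_l) :
  L2 I E -> L2 I y -> gram I E E = 1%:M -> Q^T = Q ->
  (forall v : 'cV[R]_l, 0 <= (v^T *m Q *m v) 0 0) ->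
  \tr (gram I E y *m Q *m (gram I E y)^T) <=
  \int[mu]_(x in I) ((y x)^T *m Q *m y x) 0 0.
Proof.
move=> LE Ly gramE Qsym Qpsd; set N := gram I E y.
have qE (v : 'cV[R]_l) : (v^T *m Q *m v) 0 0 = \tr (Q *m (v *m v^T)).
  by rewrite -trace_mx11 -[v^T *m Q *m v]mulmxA mxtrace_mulC mulmxA.
have iyy : mxintegrable (fun x => y x *m (y x)^T) by exact: mxintegrable_mul_tr.
have iEy : mxintegrable (fun x => E x *m (y x)^T) by exact: mxintegrable_mul_tr.
have iEE : mxintegrable (fun x => E x *m (E x)^T) by exact: mxintegrable_mul_tr.
have res x : ((y x - N^T *m E x)^T *m Q *m (y x - N^T *m E x)) 0 0 =
    \tr (Q *m (y x *m (y x)^T)) - 2 * \tr (Q *m N^T *m (E x *m (y x)^T)) +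
    \tr (N *m Q *m N^T *m (E x *m (E x)^T)).
  rewrite qE linearB/= trmx_mul trmxK mulmxBl !mulmxBr !raddfB/= -!mulmxA.
  have -> : \tr (Q *m (y x *m ((E x)^T *m N))) = \tr (Q *m (N^T *m (E x *m (y x)^T))).
    rewrite -mxtrace_tr !trmx_mul !trmxK Qsym !mulmxA mxtrace_mulC.
    by rewrite !mulmxA.
  have -> : \tr (Q *m (N^T *m (E x *m ((E x)^T *m N)))) =
      \tr (N *m (Q *m (N^T *m (E x *m (E x)^T)))).
    by rewrite [RHS]mxtrace_mulC !mulmxA.
  by ring.
rewrite -subr_ge0.
have -> : \int[mu]_(x in I) ((y x)^T *m Q *m y x) 0 0 - \tr (N *m Q *m N^T) =
    \int[mu]_(x in I) ((y x - N^T *m E x)^T *m Q *m (y x - N^T *m E x)) 0 0.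
  under [RHS]eq_Rintegral do rewrite res.
  under eq_Rintegral do rewrite qE.
  have i1 := mxtrace_integrable (mxintegrable_mulmx Q iyy).
  have i2 := mxtrace_integrable (mxintegrable_mulmx (Q *m N^T) iEy).
  have i3 := mxtrace_integrable (mxintegrable_mulmx (N *m Q *m N^T) iEE).
  have i2' : mu.-integrable I
      (EFin \o (fun x => 2 * \tr (Q *m N^T *m (E x *m (y x)^T)))).
    exact: integrable_EFinZ.
  rewrite RintegralD//; last exact: integrable_EFinB.
  rewrite RintegralB// RintegralZl//.
  rewrite !mxint_mxtrace; try exact: mxintegrable_mulmx.
  rewrite !mxint_mulmx//.
  rewrite -/(gram I E y) -/(gram I E E) gramE mulmx1 -/N.
  have -> : \tr (N *m Q *m N^T) = \tr (Q *m N^T *m N) by rewrite -mulmxA mxtrace_mulC.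
  ring.
by apply: Rintegral_ge0 => x _; exact: Qpsd.
Qed.

End MatrixIntegral.

(** * Kronecker products and stacked matrices *)

Section Vectorization.
Context {R : comNzRingType}.

(** The rows of Y are stacked since this is the ordering for which A (x) B acts
    as Y |-> A Y B^T; the integrals of (g (x) I) x are of this form. *)
Definition vecm k a (Y : 'M[R]_(k, a)) : 'cV[R]_(k * a) :=
  \col_i Y (mxtens_unindex i).1 (mxtens_unindex i).2.

Lemma vecmE k a (Y : 'M[R]_(k, a)) i j :
  vecm Y i j = Y (mxtens_unindex i).1 (mxtens_unindex i).2.
Proof. by rewrite mxE. Qed.

Lemma tensmx_vecm k l a c (A : 'M[R]_(k, l)) (B : 'M[R]_(a, c)) (Y : 'M[R]_(l, c)) :
  (A *t B) *m vecm Y = vecm (A *m Y *m B^T).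
Proof.
apply/colP => i; case: (mxtens_indexP i) => i1 i2; rewrite !mxE mxtens_indexK /=.
under [RHS]eq_bigr do rewrite !mxE big_distrl/=.
rewrite exchange_big /= pair_big /=.
rewrite (reindex (@mxtens_index l c)) /=; last first.
  by exists (@mxtens_unindex l c) => ? _; rewrite (mxtens_indexK, mxtens_unindexK).
apply: eq_bigr => -[j1 j2] _ /=; rewrite tensmxE mxE mxtens_indexK/=.
by rewrite mulrAC.
Qed.

Lemma tensmx1_vecm k l a (A : 'M[R]_(k, l)) (Y : 'M[R]_(l, a)) :
  (A *t (1%:M : 'M[R]_a)) *m vecm Y = vecm (A *m Y).
Proof. by rewrite tensmx_vecm trmx1 mulmx1. Qed.

Lemma tens1mx_vecm k a c (B : 'M[R]_(a, c)) (Y : 'M[R]_(k, c)) :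
  ((1%:M : 'M[R]_k) *t B) *m vecm Y = vecm (Y *m B^T).
Proof. by rewrite tensmx_vecm mul1mx. Qed.

Lemma vecm_dot k a (X Y : 'M[R]_(k, a)) :
  ((vecm X)^T *m vecm Y) 0 0 = \tr (X *m Y^T).
Proof.
rewrite mxE; under [RHS]eq_bigr do rewrite mxE.
rewrite pair_big /= (reindex (@mxtens_index k a)) /=; last first.
  by exists (@mxtens_unindex k a) => ? _; rewrite (mxtens_indexK, mxtens_unindexK).
by apply: eq_bigr => -[i j] _ /=; rewrite !mxE mxtens_indexK.
Qed.

Lemma vecm_quad k a (Q : 'M[R]_a) (Y : 'M[R]_(k, a)) : Q^T = Q ->
  ((vecm Y)^T *m ((1%:M : 'M[R]_k) *t Q) *m vecm Y) 0 0 = \tr (Y *m Q *m Y^T).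
Proof.
by move=> Qs; rewrite -mulmxA tens1mx_vecm vecm_dot trmx_mul trmxK mulmxA.
Qed.

Lemma mxcol_Rank k (d : 'I_k -> nat) a (Y : forall i, 'M[R]_(d i, a)) i (j : 'I_(d i)) c :
  (\mxcol_i Y i) (tagnat.Rank i j) c = Y i j c.
Proof. by have /matrixP/(_ j c) := mxcolK Y i; rewrite mxE. Qed.

Lemma castmx_vecm k l a (E : (k * a = l * a)%N) (E' : k = l) (Y : 'M[R]_(k, a)) :
  castmx (E, erefl) (vecm Y) = vecm (castmx (E', erefl) Y).
Proof. by case: l / E' E => E; rewrite (eq_irrelevance E erefl) !castmx_id. Qed.

Lemma vecm_col_mx k l a (E : ((k + l) * a = k * a + l * a)%N)
    (X : 'M[R]_(k, a)) (Y : 'M[R]_(l, a)) :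
  castmx (E, erefl) (vecm (col_mx X Y)) = col_mx (vecm X) (vecm Y).
Proof.
apply/colP => i; rewrite castmxE vecmE.
have a0 (j : 'I_(k * a + l * a)) : (0 < a)%N.
  by case: a E X Y i j => // E X Y i [j]; rewrite !muln0.
have {}a0 := a0 i.
case: (split_ordP i) => j ->; rewrite (col_mxEu, col_mxEd) vecmE.
  set r := (mxtens_unindex (cast_ord _ _)).1; have -> : r = lshift l (mxtens_unindex j).1 by exact: val_inj.
  by rewrite col_mxEu; congr (X _ _); apply: val_inj.
set r := (mxtens_unindex (cast_ord _ _)).1; have -> : r = rshift k (mxtens_unindex j).1.
  by apply: val_inj; rewrite /= divnMDl.
by rewrite col_mxEd; congr (Y _ _); apply: val_inj; rewrite /= modnMDl.
Qed.

Lemma vecm_mxcol k (d : 'I_k -> nat) a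
    (E : ((\sum_i d i) * a = \sum_i (d i * a))%N) (Y : forall i, 'M[R]_(d i, a)) :
  castmx (E, erefl) (vecm (\mxcol_i Y i)) = \mxcol_i vecm (Y i).
Proof.
apply/colP => i; rewrite castmxE vecmE.
have [i1 [i2 ->]] : exists i1 (i2 : 'I_(d i1 * a)), i = tagnat.Rank i1 i2.
  by exists (tagnat.sig1 i), (tagnat.sig2 i); rewrite tagnat.sig2K.
rewrite mxcol_Rank vecmE.
have a0 : (0 < a)%N by case: a {E Y i} i2 => // -[j]; rewrite muln0.
pose rk : nat := @tagnat.Rank _ (fun i => d i * a)%N i1 i2.
have rkE : rk = ((\sum_(j < k | j < i1) d j) * a + i2)%N.
  by rewrite /rk tagnat.RankEsum big_distrl.
set r := (mxtens_unindex (cast_ord _ _)).1.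
have -> : r = tagnat.Rank i1 (mxtens_unindex i2).1.
  apply: ord_inj; rewrite tagnat.RankEsum.
  have -> : nat_of_ord r = (rk %/ a)%N by [].
  by rewrite rkE divnMDl.
rewrite mxcol_Rank; congr (Y _ _ _); apply: ord_inj.
have -> : nat_of_ord (mxtens_unindex i2).2 = (rk %% a)%N by rewrite rkE modnMDl.
by [].
Qed.

Lemma vecm_row a (E : (1 * a = a)%N) (y : 'rV[R]_a) :
  castmx (E, erefl) (vecm y) = y^T.
Proof.
apply/colP => i; rewrite castmxE !mxE; set r := (mxtens_unindex (cast_ord _ _)).1; rewrite (ord1 r).
by congr (y _ _); apply: val_inj; rewrite /= modn_small.
Qed.

Lemma rdiag_mxcol (S : realType) k (d e : 'I_k -> nat) a
    (A : forall i, 'M[S]_(d i, e i)) (Y : forall i, 'M[S]_(e i, a)) :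
  rdiag A *m \mxcol_i Y i = \mxcol_i (A i *m Y i).
Proof.
rewrite /rdiag mxblockEv mxcol_mul; apply: eq_mxcol => i.
rewrite mul_mxrow_mxcol (bigD1 i)//= eqxx conform_mx_id big1 ?addr0//.
by move=> j /negPf; rewrite eq_sym => ->; rewrite mul0mx.
Qed.

Lemma mxdiag_quad k (d : 'I_k -> nat) (Q : forall i, 'M[R]_(d i))
    (v : forall i, 'cV[R]_(d i)) :
  (((\mxcol_i v i)^T *m \mxdiag_i Q i) *m \mxcol_i v i) 0 0 =
  \sum_i ((v i)^T *m Q i *m v i) 0 0.
Proof.
rewrite -mulmxA mul_mxdiag_mxcol tr_mxcol mul_mxrow_mxcol summxE.
by apply: eq_bigr => i _; rewrite mulmxA.
Qed.

Lemma mxcol_dot k (d : 'I_k -> nat) (u v : forall i, 'cV[R]_(d i)) :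
  ((\mxcol_i u i)^T *m \mxcol_i v i) 0 0 = \sum_i ((u i)^T *m v i) 0 0.
Proof. by rewrite tr_mxcol mul_mxrow_mxcol summxE. Qed.

(** The rows of index 0, ..., k, split after the first or before the last. *)
Lemma castmx_rows k a (y : nat -> 'rV[R]_a)
    (E : (\sum_(i < k) 1 + 1 = 1 + \sum_(i < k) 1)%N) :
  castmx (E, erefl) (col_mx (\mxcol_(i < k) y i) (y k)) =
  col_mx (y 0%N) (\mxcol_(i < k) y i.+1).
Proof.
have rowE (j : 'I_(\sum_(i < k) 1)) : exists i : 'I_k,
    (j = i :> nat) /\ forall (z : 'I_k -> 'rV[R]_a) c, (\mxcol_i z i) j c = z i 0 c.
  have [i [u ->]] : exists i1 (i2 : 'I_1), j = tagnat.Rank i1 i2 :> 'I_(\sum_(i < k) 1).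
    by exists (tagnat.sig1 j), (tagnat.sig2 j); rewrite tagnat.sig2K.
  exists i; split; last by move=> z c; rewrite mxcol_Rank (ord1 u).
  rewrite tagnat.RankEsum (ord1 u) addn0 -[RHS]card_ord -sum1_card.
  rewrite (big_ord_widen _ (fun=> 1%N) (ltnW (ltn_ord i)))/=.
  by apply: eq_bigl.
have rows (j : 'I_(1 + \sum_(i < k) 1)) c :
    (col_mx (y 0%N) (\mxcol_(i < k) y i.+1)) j c = y j 0 c.
  case: (split_ordP j) => r ->; first by rewrite col_mxEu (ord1 r).
  by rewrite col_mxEd; have [i [ri ->]] := rowE r; rewrite /= ri.
apply/matrixP => j c; rewrite rows castmxE cast_ord_id /=.
set j' := cast_ord _ j; have jj : (j' : nat) = j by [].
rewrite -jj; case: (split_ordP j') => r ->.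
  by rewrite col_mxEu; have [i [ri ->]] := rowE r; rewrite /= ri.
by rewrite col_mxEd (ord1 r)/= sum1_card card_ord addn0.
Qed.

End Vectorization.

Lemma kronI_mul (R : realType) k a (g : 'cV[R]_k) (y : 'cV[R]_a) :
  kronI a g *m y = vecm (g *m y^T).
Proof.
apply/colP => i; rewrite vecmE !mxE big_ord1 !mxE.
case: (mxtens_indexP i) => i1 i2; rewrite mxtens_indexK /=.
rewrite (bigD1 i2) //= big1 ?addr0.
  rewrite castmxE cast_ord_id !mxE mxtens_indexK /=.
  set u := (X in g i1 X); rewrite (ord1 u).
  set v := (X in _ == X); rewrite (_ : v = i2) ?eqxx ?mulr1//.
  by apply: val_inj; rewrite /= modn_small.
move=> j ji; rewrite castmxE cast_ord_id !mxE mxtens_indexK /=.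
set v := (X in _ == X); rewrite (_ : v = j); last by apply: val_inj; rewrite /= modn_small.
by rewrite eq_sym (negPf ji) mulr0 mul0r.
Qed.

(** * Quadratic forms *)

Section QuadraticForms.
Context {R : realType}.

Definition sqnorm k (x : 'cV[R]_k) : R := \sum_j x j 0 ^+ 2.

Lemma sqnorm_dot k (x : 'cV[R]_k) : sqnorm x = (x^T *m x) 0 0.
Proof. by rewrite mxE; apply: eq_bigr => j _; rewrite mxE expr2. Qed.

Lemma sqnorm_ge0 k (x : 'cV[R]_k) : 0 <= sqnorm x.
Proof. by apply: sumr_ge0 => j _; exact: sqr_ge0. Qed.

Lemma sqnorm_col_mx k l (x : 'cV[R]_k) (y : 'cV[R]_l) :
  sqnorm (col_mx x y) = sqnorm x + sqnorm y.
Proof. by rewrite !sqnorm_dot tr_col_mx mul_row_col mxE. Qed.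

Lemma posdefmx_ge0 k (A : 'M[R]_k) (x : 'cV[R]_k) :
  posdefmx A -> 0 <= (x^T *m A *m x) 0 0.
Proof.
move=> [_ Apos]; have [->|x0] := eqVneq x 0; first by rewrite mulmx0 mxE.
by rewrite ltW// Apos.
Qed.

Lemma posdefmx1 k : posdefmx (1%:M : 'M[R]_k).
Proof.
split=> [|x x0]; first by rewrite trmx1.
rewrite mulmx1 -sqnorm_dot lt_neqAle sqnorm_ge0 andbT eq_sym.
apply: contra_neq x0 => /eqP; rewrite psumr_eq0 => [/allP x0|j _]; last exact: sqr_ge0.
apply/colP => j; rewrite mxE; apply/eqP; rewrite -sqrf_eq0.
by apply: x0; rewrite mem_index_enum.
Qed.

Lemma posdefmx_unit k (A : 'M[R]_k) : posdefmx A -> A \in unitmx.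
Proof.
move=> [_ Apos]; rewrite -row_free_unit -kermx_eq0; apply/eqP/row_matrixP => i.
rewrite row0; apply/eqP/negPn/negP => v0.
have := Apos (row i (kermx A))^T; rewrite trmxK -row_mul mulmx_ker row0 mul0mx mxE ltxx.
by move=> h; have := h (contra_neq (fun e => trmx_inj (etrans e (esym (trmx0 _ _ _)))) v0).
Qed.

Lemma quadE k (A : 'M[R]_k) (v u : 'cV[R]_k) :
  (v^T *m A *m u) 0 0 = \sum_i \sum_j A i j * (v i 0 * u j 0).
Proof.
rewrite mxE exchange_big/=; apply: eq_bigr => j _.
by rewrite mxE big_distrl/=; apply: eq_bigr => i _; rewrite mxE; ring.
Qed.

Lemma quad_form_bound k (A : 'M[R]_k) : exists2 C : R, 0 < C &
  forall x : 'cV[R]_k, `|(x^T *m A *m x) 0 0| <= C * sqnorm x.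
Proof.
exists (1 + \sum_i \sum_j `|A i j|); first by rewrite ltr_pwDl// sumr_ge0// => i _; rewrite sumr_ge0.
move=> x; rewrite mulrDl mul1r ler_wpDl ?sqnorm_ge0//.
have xS j : `|x j 0| ^+ 2 <= sqnorm x.
  by rewrite real_normK ?num_real// /sqnorm (bigD1 j)//= lerDl sumr_ge0// => i _; exact: sqr_ge0.
rewrite mxE; apply: le_trans (ler_norm_sum _ _ _) _; rewrite exchange_big/= mulr_suml.
apply: ler_sum => j _; rewrite mxE normrM.
apply: (@le_trans _ _ ((\sum_i `|x i 0| * `|A i j|) * `|x j 0|)).
  rewrite ler_wpM2r//; apply: le_trans (ler_norm_sum _ _ _) _.
  by apply: ler_sum => i _; rewrite mxE normrM.
rewrite !mulr_suml; apply: ler_sum => i _.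
rewrite mulrAC mulrC ler_wpM2l//.
have := xS i; have := xS j; have := sqr_ge0 (`|x i 0| - `|x j 0|); nra.
Qed.

Lemma mulmx_bound k l (A : 'M[R]_(k, l)) : exists2 C : R, 0 < C &
  forall x : 'cV[R]_l, sqnorm (A *m x) <= C * sqnorm x.
Proof.
have [C C0 AC] := quad_form_bound (A^T *m A); exists C => // x.
apply: le_trans (ler_norm _) _; apply: le_trans (AC x).
by rewrite sqnorm_dot trmx_mul !mulmxA.
Qed.

(** The Cauchy-Schwarz inequality for the scalar product of A bounds each
    coordinate of x, since it is the A-product of x with a column of A^-1. *)
Lemma posdefmx_coercive k (A : 'M[R]_k) : posdefmx A -> exists2 c : R, 0 < c &
  forall x : 'cV[R]_k, c * sqnorm x <= (x^T *m A *m x) 0 0.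
Proof.
move=> Apd; have Au := posdefmx_unit Apd; have [As Apos] := Apd.
pose B (u v : 'cV[R]_k) := (u^T *m A *m v) 0 0.
have Bsym u v : B u v = B v u.
  by rewrite /B -[in RHS]As -mulmxA -[in RHS](trmxK u) -!trmx_mul [RHS]mxE mulmxA.
have CS u v : B u v ^+ 2 <= B u u * B v v.
  have [->|v0] := eqVneq v 0.
    have B0 w : B w 0 = 0 by rewrite /B mulmx0 mxE.
    by rewrite !B0 expr0n mulr0.
  have vv := Apos _ v0.
  have := posdefmx_ge0 (u - (B u v / B v v) *: v) Apd.
  rewrite -/(B _ _); have -> : B (u - (B u v / B v v) *: v) (u - (B u v / B v v) *: v) =
      B u u - B u v ^+ 2 / B v v.
    have BB s : B (u - s *: v) (u - s *: v) = B u u - 2 * s * B u v + s ^+ 2 * B v v.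
      have Bl w : B (u - s *: v) w = B u w - s * B v w.
        rewrite /B (_ : (u - s *: v)^T = u^T - s *: v^T).
          by rewrite !mulmxBl -!scalemxAl mxE [X in _ + X]mxE [X in - X]mxE.
        by apply/matrixP => i j; rewrite !mxE.
      by rewrite Bl (Bsym u (_ - _)) (Bsym v (_ - _)) !Bl (Bsym v u); ring.
    by rewrite BB; field; rewrite gt_eqF.
  by rewrite subr_ge0 ler_pdivrMr.
have e (x : 'cV[R]_k) j : x j 0 = B (col j (invmx A)) x.
  by rewrite /B tr_col trmx_inv As -row_mul mulVmx// row1 -rowE mxE.
pose t := \sum_j B (col j (invmx A)) (col j (invmx A)).
have t0 : 0 <= t by apply: sumr_ge0 => j _; exact: posdefmx_ge0.
exists (t + 1)^-1 => [|x]; first by rewrite invr_gt0 ltr_wpDl.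
rewrite mulrC ler_pdivrMr ?ltr_wpDl// -/(B x x).
apply: (@le_trans _ _ (t * B x x)).
  by rewrite /t mulr_suml; apply: ler_sum => j _; rewrite e; exact: CS.
by rewrite mulrDr mulr1 mulrC lerDl; exact: posdefmx_ge0.
Qed.

Lemma posdefmx_congr k l (A : 'M[R]_(k, l)) (G : 'M[R]_l) : posdefmx G ->
  (forall x : 'cV[R]_k, A^T *m x = 0 -> x = 0) -> posdefmx (A *m G *m A^T).
Proof.
move=> [Gs Gpos] Ainj; split; first by rewrite !trmx_mul trmxK Gs mulmxA.
move=> x x0; have := Gpos (A^T *m x).
rewrite trmx_mul trmxK !mulmxA; apply.
by apply: contra_neq x0; exact: Ainj.
Qed.

Lemma posdefmx_mxdiag k (d : 'I_k -> nat) (Q : forall i, 'M[R]_(d i)) :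
  posdefmx (\mxdiag_i Q i) -> forall i, posdefmx (Q i).
Proof.
move=> [Qs Qpos] i; split.
  by move: Qs; rewrite tr_mxdiag => /eq_mxdiagP/(_ i).
move=> x x0.
pose w j : 'cV[R]_(d j) := if j == i then conform_mx 0 x else 0.
have wi : w i = x by rewrite /w eqxx conform_mx_id.
have E : ((\mxcol_j w j)^T *m \mxdiag_j Q j *m \mxcol_j w j) 0 0 = (x^T *m Q i *m x) 0 0.
  rewrite mxdiag_quad (bigD1 i)//= wi big1 ?addr0// => j /negPf ji.
  by rewrite /w ji mulmx0 mxE.
rewrite -E; apply: Qpos; apply: contra_neq x0 => /(congr1 (fun M => submxcol M i)).
by rewrite mxcolK submxcol0 wi.
Qed.

Lemma cholesky_unit k (X L : 'M[R]_k) : posdefmx X -> cholesky X L -> L \in unitmx.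
Proof.
move=> /posdefmx_unit; rewrite !unitmxE !unitfE => X0 [_ LX].
by apply: contra_neq X0 => L0; rewrite -LX det_mulmx L0 mul0r.
Qed.

(** At the point (x, - J^-1 Y x) the form of the block matrix is that of the
    Schur complement of J; coercivity provides the margin e. *)
Lemma negdefmx_schur k l (X : 'M[R]_k) (Y : 'M[R]_(l, k)) (J : 'M[R]_l) :
  J^T = J -> J \in unitmx -> negdefmx (block_mx X Y^T Y J) ->
  exists2 e : R, 0 < e & forall x : 'cV[R]_k,
    (x^T *m X *m x) 0 0 - ((Y *m x)^T *m invmx J *m (Y *m x)) 0 0 <= - e * sqnorm x.
Proof.
move=> Js Ju [Bs Bneg].
have Bpd : posdefmx (- block_mx X Y^T Y J).
  split; first by rewrite linearN/= Bs.
  by move=> x x0; rewrite mulmxN mulNmx mxE oppr_gt0 Bneg.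
have [c c0 Bc] := posdefmx_coercive Bpd.
exists c => // x; pose u := - (invmx J *m (Y *m x)).
have E : ((col_mx x u)^T *m block_mx X Y^T Y J *m col_mx x u) 0 0 =
    (x^T *m X *m x) 0 0 - ((Y *m x)^T *m invmx J *m (Y *m x)) 0 0.
  rewrite -mulmxA mul_block_col tr_col_mx mul_row_col.
  have -> : Y *m x + J *m u = 0 by rewrite mulmxN mulKVmx// subrr.
  rewrite mulmx0 addr0 mulmxDr mxE mulmxA; congr (_ + _).
  by rewrite !mulmxN mxE trmx_mul !mulmxA.
have := Bc (col_mx x u); rewrite sqnorm_col_mx mulmxN mulNmx mxE E mulrDr.
have := mulr_ge0 (ltW c0) (sqnorm_ge0 u); rewrite mulNr; lra.
Qed.

End QuadraticForms.

(** * The block matrices of the closed loop *)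

Section BlockCasts.
Context {R : realType}.

Lemma castmx_trans k k' k'' c (E1 : k = k') (E2 : k' = k'') (E : k = k'')
    (A : 'M[R]_(k, c)) :
  castmx (E2, erefl) (castmx (E1, erefl) A) = castmx (E, erefl) A.
Proof. by case: k'' / E2 E => E; case: k' / E1 in E *; rewrite (eq_irrelevance E erefl). Qed.

Lemma castmx_mulmx_vec k k' l l' (Ek : k = k') (El : l = l') (A : 'M[R]_(k, l)) (v : 'cV[R]_l) :
  castmx (Ek, El) A *m castmx (El, erefl) v = castmx (Ek, erefl) (A *m v).
Proof. by case: k' / Ek; case: l' / El; rewrite !castmx_id. Qed.

Lemma castmx_quad k l (E : k = l) (A : 'M[R]_k) (v : 'cV[R]_k) :
  (castmx (E, erefl) v)^T *m castmx (E, E) A *m castmx (E, erefl) v = v^T *m A *m v.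
Proof. by case: l / E; rewrite !castmx_id. Qed.

Lemma vecm_col_mx_cast k l a ka la (E : ((k + l) * a = ka + la)%N)
    (Ek : (k * a = ka)%N) (El : (l * a = la)%N) (X : 'M[R]_(k, a)) (Y : 'M[R]_(l, a)) :
  castmx (E, erefl) (vecm (col_mx X Y)) =
  col_mx (castmx (Ek, erefl) (vecm X)) (castmx (El, erefl) (vecm Y)).
Proof. by case: ka / Ek E; case: la / El => E; rewrite !castmx_id vecm_col_mx. Qed.

Lemma castmx_mxcol k (d e : 'I_k -> nat) c (de : forall i, d i = e i)
    (E : (\sum_i d i = \sum_i e i)%N) (Y : forall i, 'M[R]_(d i, c)) :
  castmx (E, erefl) (\mxcol_i Y i) = \mxcol_i castmx (de i, erefl) (Y i).
Proof.
have dE : d = e by exact/funext.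
case: e / dE in de E *; rewrite castmx_id; apply: eq_mxcol => i.
by rewrite (eq_irrelevance (de i) erefl) castmx_id.
Qed.

Lemma vecm_mxcol_rows k a (E : ((\sum_(i < k) 1) * a = \sum_(i < k) a)%N)
    (y : 'I_k -> 'rV[R]_a) :
  castmx (E, erefl) (vecm (\mxcol_i y i)) = \mxcol_i (y i)^T.
Proof.
have E1 : ((\sum_(i < k) 1) * a = \sum_(i < k) (1 * a))%N by rewrite big_distrl.
have E2 : (\sum_(i < k) (1 * a) = \sum_(i < k) a)%N.
  by apply: eq_bigr => i _; rewrite mul1n.
rewrite -(castmx_trans E1 E2) vecm_mxcol.
rewrite (castmx_mxcol (fun=> mul1n a)); apply: eq_mxcol => i.
exact: vecm_row.
Qed.

(** The stacked version of [castmx_rows]. It is needed because one summand of Xi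
    acts on x(t), ..., x(t - r_{nu-1}) and the other on x(t - r_1), ...,
    x(t - r_nu). *)
Lemma castmx_points k a (y : nat -> 'rV[R]_a)
    (E : (\sum_(i < k) a + a = a + \sum_(i < k) a)%N) :
  castmx (E, erefl) (col_mx (\mxcol_(i < k) (y i)^T) (y k)^T) =
  col_mx (y 0%N)^T (\mxcol_(i < k) (y i.+1)^T).
Proof.
have S1 : ((\sum_(i < k) 1) * a = \sum_(i < k) a)%N.
  by rewrite big_distrl/=; apply: eq_bigr => i _; rewrite mul1n.
have E1 : ((\sum_(i < k) 1 + 1) * a = \sum_(i < k) a + a)%N by rewrite mulnDl mul1n S1.
have E2 : ((1 + \sum_(i < k) 1) * a = a + \sum_(i < k) a)%N by rewrite mulnDl mul1n S1.
transitivity (castmx (etrans E1 E, erefl) (vecm (col_mx (\mxcol_(i < k) y i) (y k)))).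
  rewrite -(castmx_trans E1 E); congr castmx.
  by rewrite (vecm_col_mx_cast _ S1 (mul1n a)) vecm_mxcol_rows vecm_row.
have E3 : (\sum_(i < k) 1 + 1 = 1 + \sum_(i < k) 1)%N by rewrite addnC.
have E4 : ((\sum_(i < k) 1 + 1) * a = (1 + \sum_(i < k) 1) * a)%N by rewrite E3.
rewrite -(castmx_trans E4 E2).
rewrite (castmx_vecm E4 E3) castmx_rows.
by rewrite (vecm_col_mx_cast _ (mul1n a) S1) vecm_mxcol_rows vecm_row.
Qed.

Lemma oplus_quad k l (X : 'M[R]_k) (Y : 'M[R]_l) (u : 'cV[R]_k) (v : 'cV[R]_l) :
  ((col_mx u v)^T *m oplus X Y *m col_mx u v) 0 0 =
  (u^T *m X *m u) 0 0 + (v^T *m Y *m v) 0 0.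
Proof.
rewrite /oplus -mulmxA mul_block_col !mul0mx addr0 add0r tr_col_mx mul_row_col.
by rewrite mxE !mulmxA.
Qed.

Lemma quad0 k (u : 'cV[R]_k) : (u^T *m 0 *m u) 0 0 = 0.
Proof. by rewrite mulmx0 mul0mx mxE. Qed.

Lemma quadD k (A B : 'M[R]_k) (u : 'cV[R]_k) :
  (u^T *m (A + B) *m u) 0 0 = (u^T *m A *m u) 0 0 + (u^T *m B *m u) 0 0.
Proof. by rewrite mulmxDr mulmxDl mxE. Qed.

Lemma quadB k (A B : 'M[R]_k) (u : 'cV[R]_k) :
  (u^T *m (A - B) *m u) 0 0 = (u^T *m A *m u) 0 0 - (u^T *m B *m u) 0 0.
Proof. by rewrite mulmxBr mulmxBl mxE [X in _ + X]mxE. Qed.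

Lemma quad_Sy k (A : 'M[R]_k) (u : 'cV[R]_k) :
  (u^T *m Sy A *m u) 0 0 = 2 * (u^T *m A *m u) 0 0.
Proof.
rewrite /Sy quadD mulrDl mul1r; congr (_ + _).
by transitivity ((u^T *m A *m u)^T 0 0); [rewrite !trmx_mul trmxK mulmxA|rewrite mxE].
Qed.

End BlockCasts.

Section ClosedLoopAlgebra.
Context {R : realType} {n m p q nu : nat} (s : delay_system R n m p q nu)
        (D : decomposition R n m p nu) (L : factors D).

(** The vector theta of the closed loop without its last block w. The rows y0
    and yd i are the transposed states x(t) and x(t - r_i); Yh i and Ye i are the
    integrals of the normalised h_i and epsilon_i times x(t + tau)^T. *)
Definition stack a (y0 : 'rV[R]_a) (yd : 'I_nu -> 'rV[R]_a)
    (Yh : forall i, 'M[R]_(dimh D i, a)) (Ye : forall i, 'M[R]_(dimphi D i, a)) :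
    'cV[R]_(bdim D a) :=
  col_mx (col_mx (col_mx y0^T (\mxcol_i (yd i)^T)) (\mxcol_i vecm (Yh i)))
         (\mxcol_i vecm (Ye i)).

(** As a single [vecm], the vector can be multiplied by I (x) K. *)
Lemma stack_vecm a (E : (1 + \sum_(i < nu) 1 + \sum_i dimh D i + \sum_i dimphi D i =
    beta D)%N) (y0 : 'rV[R]_a) yd Yh Ye :
  stack y0 yd Yh Ye = castmx (bdimE D a, erefl) (vecm (castmx (E, erefl)
    (col_mx (col_mx (col_mx y0 (\mxcol_i yd i)) (\mxcol_i Yh i)) (\mxcol_i Ye i)))).
Proof.
have E' : ((1 + \sum_(i < nu) 1 + \sum_i dimh D i + \sum_i dimphi D i) * a =
    beta D * a)%N by rewrite E.
rewrite -(castmx_vecm E') (castmx_trans _ _ (etrans E' (bdimE D a))).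
have S1 : ((\sum_(i < nu) 1) * a = \sum_(i < nu) a)%N.
  by rewrite big_distrl/=; apply: eq_bigr => i _; rewrite mul1n.
have Sh := esym (sum_mull (dimh D) a); have Sp := esym (sum_mull (dimphi D) a).
have E1 : ((1 + \sum_(i < nu) 1) * a = a + \sum_(i < nu) a)%N by rewrite mulnDl mul1n S1.
have E2 : ((1 + \sum_(i < nu) 1 + \sum_i dimh D i) * a =
    a + \sum_(i < nu) a + \sum_i (dimh D i * a))%N by rewrite mulnDl E1 Sh.
rewrite (vecm_col_mx_cast _ E2 Sp) (vecm_col_mx_cast _ E1 Sh).
rewrite (vecm_col_mx_cast _ (mul1n a) S1).
by rewrite vecm_row vecm_mxcol_rows !vecm_mxcol.
Qed.

Lemma Kblock_stack (K : 'M[R]_(p, n)) y0 yd Yh Ye (w : 'cV[R]_q) :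
  Kblock q D K *m col_mx (stack y0 yd Yh Ye) w =
  col_mx (stack (y0 *m K^T) (fun i => yd i *m K^T) (fun i => Yh i *m K^T)
                (fun i => Ye i *m K^T)) 0.
Proof.
have E : (1 + \sum_(i < nu) 1 + \sum_i dimh D i + \sum_i dimphi D i = beta D)%N.
  have G : (\sum_i dimg D i = \sum_i dimphi D i + \sum_i dimh D i)%N by rewrite -big_split.
  rewrite /beta G sum_nat_const card_ord muln1 -!addnA; congr (_ + (_ + _))%N.
  exact: addnC.
rewrite /Kblock /oplus mul_block_col !mul0mx addr0 add0r; congr col_mx.
rewrite !(stack_vecm E) castmx_mulmx_vec tens1mx_vecm; congr castmx; congr vecm.
rewrite -!mxcol_mul -!mul_col_mx; move: (col_mx _ _) => Y.
by case: (beta D) / E; rewrite !castmx_id.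
Qed.

Lemma hatblocks_stack a c k (X0 : 'I_nu.+1 -> 'M[R]_(k, a))
    (X : forall i, 'M[R]_(k, dimg D i * a)) (E : 'M[R]_(k, c)) y0 yd Yh Ye (w : 'cV[R]_c) :
  hatblocks s L X0 X E *m col_mx (stack y0 yd Yh Ye) w =
  X0 ord0 *m y0^T + \sum_i X0 (lift ord0 i) *m (yd i)^T +
  \sum_i X i *m vecm (T1 s L i *m Yh i + T2 L i *m Ye i) + E *m w.
Proof.
rewrite /hatblocks /stack !mul_row_col !mul_mxrow_mxcol; congr (_ + _).
rewrite -addrA; congr (_ + _); rewrite -big_split/=; apply: eq_bigr => i _.
rewrite -!(mulmxA (X i)) !tensmx1_vecm -mulmxDr; congr (_ *m _).
by apply/colP => j; rewrite [LHS]mxE !vecmE [RHS]mxE.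
Qed.

(** L_h Yh is the integral of h_i x^T, whose lower rows form the integral of
    f_i x^T; the latter is then normalised by L_f. *)
Lemma Ihat_mxcol Yh : Ihat L *m (\mxcol_i vecm (Yh i)) =
  vecm (\mxcol_i (invmx (Lf L i) *m (row_mx 0 1%:M *m (Lh L i *m Yh i)))).
Proof.
rewrite /Ihat -(vecm_mxcol (esym (sum_mull (dimh D) n))) castmx_mulmx_vec castmx_id.
rewrite tensmx1_vecm rdiag_mxcol; congr vecm; apply: eq_mxcol => i.
by rewrite !mulmxA.
Qed.

(** The two summands of M see different lists of delayed states, which are both
    read off from the sequence y. *)
Lemma bMI_stack (y : nat -> 'rV[R]_n) (Yh : forall i, 'M[R]_(dimh D i, n)) :
  bMI s L *m col_mx (col_mx (y 0%N)^T (\mxcol_(i < nu) (y i.+1)^T))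
                    (\mxcol_i vecm (Yh i)) =
  vecm (\mxcol_i (invmx (Lf L i) *m (ff D i (- delay s i) *m y i -
    ff D i (- delay s i.+1) *m y i.+1 - Mf D i *m (Lh L i *m Yh i)))).
Proof.
have S1 : ((\sum_(i < nu) 1) * n = \sum_(i < nu) n)%N.
  by rewrite big_distrl/=; apply: eq_bigr => i _; rewrite mul1n.
have Sh := esym (sum_mull (dimh D) n).
have E1 : ((1 + \sum_(i < nu) 1) * n = n + \sum_(i < nu) n)%N by rewrite mulnDl mul1n S1.
have -> : col_mx (col_mx (y 0%N)^T (\mxcol_(i < nu) (y i.+1)^T)) (\mxcol_i vecm (Yh i)) =
    castmx (bdimM D n, erefl) (vecm (col_mx (col_mx (y 0%N) (\mxcol_(i < nu) y i.+1))
      (\mxcol_i Yh i))).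
  rewrite (vecm_col_mx_cast _ E1 Sh) (vecm_col_mx_cast _ (mul1n n) S1).
  by rewrite vecm_row vecm_mxcol_rows vecm_mxcol.
rewrite /bMI castmx_mulmx_vec castmx_id tensmx1_vecm; congr vecm.
rewrite /bM mulmxBl !mul_row_col !mul0mx add0r !rdiag_mxcol.
set E := addn_shift _ _ _.
have E2 : (\sum_(i < nu) 1 + 1 = 1 + \sum_(i < nu) 1)%N by rewrite addnC.
have -> : col_mx (col_mx (y 0%N) (\mxcol_(i < nu) y i.+1)) (\mxcol_i Yh i) =
    castmx (E, erefl) (col_mx (col_mx (\mxcol_(i < nu) y i) (y nu)) (\mxcol_i Yh i)).
  rewrite -(castmx_rows y E2).
  by case: _ / E2 E => E; rewrite castmx_id (eq_irrelevance E erefl) castmx_id.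
rewrite (_ : castmx _ _ *m castmx _ _ = rdiag (fun i => invmx (Lf L i) *m ff D i (- delay s i)) *m \mxcol_(i < nu) y i).
  rewrite rdiag_mxcol -mxcolD -mxcolB; apply: eq_mxcol => i.
  by rewrite !mulmxBr !mulmxA opprD addrA.
case: _ / E; rewrite !castmx_id !mul_row_col !mul0mx !addr0//.
Qed.

Lemma bXi_quad (Q Rm : 'I_nu -> 'M[R]_n) (J3 : 'M[R]_q) (y : nat -> 'rV[R]_n) Yh Ye w :
  (forall i, (Rm i)^T = Rm i) ->
  ((col_mx (stack (y 0%N) (fun i : 'I_nu => y i.+1) Yh Ye) w)^T *m bXi s D Q Rm J3 *m
    col_mx (stack (y 0%N) (fun i : 'I_nu => y i.+1) Yh Ye) w) 0 0 =
  \sum_(i < nu) ((y i *m (Q i + (delay s i.+1 - delay s i) *: Rm i) *m (y i)^T) 0 0 -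
    (y i.+1 *m Q i *m (y i.+1)^T) 0 0) -
  \sum_i (\tr (Yh i *m Rm i *m (Yh i)^T) + \tr (Ye i *m Rm i *m (Ye i)^T)) -
  (w^T *m J3 *m w) 0 0.
Proof.
move=> Rs; rewrite /bXi quadB !oplus_quad !quad0 !addr0 add0r.
set a := (X in X - _); set b := (X in _ - (X + _ + _ + _)).
set c := (X in _ - (_ + X + _ + _)); set e := (X in _ - (_ + _ + X + _)).
have -> : a = \sum_(i < nu) (y i *m (Q i + (delay s i.+1 - delay s i) *: Rm i) *m (y i)^T) 0 0.
  have E : (\sum_(i < nu) n + n = n + \sum_(i < nu) n)%N by rewrite addnC.
  rewrite /a -(castmx_points y E) (eq_irrelevance (addnC _ _) E) castmx_quad oplus_quad.
  rewrite quad0 addr0 quadD mxdiag_quad /bLambda -mulmxA -(mulmxA (\mxdiag_i Rm i)).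
  rewrite !mul_mxdiag_mxcol mxcol_dot -big_split/=; apply: eq_bigr => i _.
  rewrite trmxK mulmxDr mulmxDl [RHS]mxE mul_scalar_mx -!scalemxAr -!scalemxAl.
  by rewrite mulmxA.
have -> : b = \sum_(i < nu) (y i.+1 *m Q i *m (y i.+1)^T) 0 0.
  by rewrite /b mxdiag_quad; apply: eq_bigr => i _; rewrite trmxK.
have -> : c = \sum_i \tr (Yh i *m Rm i *m (Yh i)^T).
  by rewrite /c mxdiag_quad; apply: eq_bigr => i _; rewrite vecm_quad.
have -> : e = \sum_i \tr (Ye i *m Rm i *m (Ye i)^T).
  by rewrite /e mxdiag_quad; apply: eq_bigr => i _; rewrite vecm_quad.
rewrite sumrB [X in _ - X - _]big_split/=; ring.
Qed.

Lemma diagIQ_quad (Q : 'I_nu -> 'M[R]_n) (Z : forall i, 'M[R]_(dimf D i, n)) :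
  (forall i, (Q i)^T = Q i) ->
  ((vecm (\mxcol_i Z i))^T *m diagIQ D Q *m vecm (\mxcol_i Z i)) 0 0 =
  \sum_i \tr (Z i *m Q i *m (Z i)^T).
Proof.
move=> Qs; have E := esym (sum_mull (dimf D) n).
have -> : vecm (\mxcol_i Z i) =
    castmx (sum_mull (dimf D) n, erefl) (\mxcol_i vecm (Z i)).
  by rewrite -(vecm_mxcol E) (castmx_trans _ _ erefl) castmx_id.
rewrite /diagIQ castmx_quad mxdiag_quad; apply: eq_bigr => i _.
exact: vecm_quad.
Qed.

(** P^T Pi and the first product in Phi are the contributions of the two block
    columns of S^T [P1 P2; P2^T P3] to Psi, and the second product in Phi collects
    the terms that contain Sigma. *)
Lemma lmi_blockE (K : 'M[R]_(p, n)) (P1 : 'M[R]_n)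
    (P2 : 'M[R]_(n, dimF D * n)) (P3 : 'M[R]_(dimF D * n))
    (Q Rm : 'I_nu -> 'M[R]_n) (J1 Jt : 'M[R]_m) (J2 : 'M[R]_(m, q)) (J3 : 'M[R]_q) :
  P1^T = P1 -> J1^T = J1 ->
  lmi_block s L K P1 P2 P3 Q Rm J1 Jt J2 J3 =
  Sy ((bP q L P1 P2)^T *m bPi s L K) + bPhi s L K P2 P3 Q Rm J1 Jt J2 J3.
Proof.
move=> P1s J1s.
have SyD k (A B : 'M[R]_k) : Sy (A + B) = Sy A + Sy B.
  by rewrite /Sy linearD/= addrACA.
rewrite /bPhi addrA -SyD /lmi_block /bPsi /oplus.
set Om := bOmega s L K; set Si := bSigma s L K; set X := bXi _ _ _ _ _.
set MI := row_mx (row_mx _ _) _.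
have -> : (bP q L P1 P2)^T *m bPi s L K +
   (col_mx (col_mx (col_mx (col_mx (col_mx P2 0) ((Ihat L)^T *m P3)) 0) 0) 0
    *m row_mx MI 0 + col_mx (col_mx 0 (- J2^T)) Jt *m row_mx Si 0) =
   block_mx ((bS q L)^T *m Pblock P1 P2 P3 *m col_mx Om MI - col_mx 0 J2^T *m Si) 0 (Jt *m Si) 0.
  have PE : (bS q L)^T *m Pblock P1 P2 P3 = row_mx
      (col_mx (col_mx (col_mx (col_mx P1 0) ((Ihat L)^T *m P2^T)) 0) 0)
      (col_mx (col_mx (col_mx (col_mx P2 0) ((Ihat L)^T *m P3)) 0) 0).
    rewrite /bS /Pblock tr_col_mx !tr_row_mx !trmx0 trmx1 mul_row_block.
    rewrite !mul_col_mx !mul0mx !mul1mx !add_col_mx !addr0 !add0r //.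
  have -> : (bP q L P1 P2)^T = col_mx
      (col_mx (col_mx (col_mx (col_mx P1 0) ((Ihat L)^T *m P2^T)) 0) 0) 0.
    by rewrite /bP !tr_row_mx !trmx0 trmx_mul P1s.
  rewrite PE mul_row_col /bPi -/Om; move: Si Om MI => Si Om MI.
  move: (col_mx (col_mx (col_mx (col_mx P1 0) _) 0) 0) => V.
  move: (col_mx (col_mx (col_mx (col_mx P2 0) _) 0) 0) => U.
  rewrite !mul_col_row !mulmx0 !mul0mx !add_block_mx !addr0 !add0r addrA.
  by rewrite -mulNmx opp_col_mx oppr0.
move: (_ *m col_mx Om MI - _) => M.
rewrite /Sy tr_block_mx !add_block_mx !trmx0 trmx_mul !addr0 !add0r.
by [].
Qed.

End ClosedLoopAlgebra.

(** * Gram matrices and orthonormal families *)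

Section GramMatrices.
Context {R : realType}.
Notation mu := (@lebesgue_measure R).
Variables a b : R.
Local Notation I := (`[a, b]%classic).

Lemma mxintegrable_mul k l c (F : R -> 'M[R]_(k, l)) (G : R -> 'M[R]_(l, c)) :
  L2 I F -> L2 I G -> mxintegrable a b (fun x => F x *m G x).
Proof.
move=> LF LG i j.
have : mu.-integrable I (EFin \o (fun x => \sum_p F x i p * G x p j)).
  apply: integrable_EFin_sum => // r; exact: (sq_integrableM (LF i r) (LG r j)).
by apply: eq_integrable => // x _ /=; rewrite mxE.
Qed.

Lemma ae_eq_mxint k l (F G : R -> 'M[R]_(k, l)) :
  mxintegrable a b F -> mxintegrable a b G ->
  {ae mu, forall x, I x -> F x = G x} -> mxint I F = mxint I G.
Proof.
move=> iF iG FG; apply/matrixP => i j; rewrite !mxE /Rintegral; congr fine.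
apply: ae_eq_integral => //.
- by case/integrableP: (iF i j).
- by case/integrableP: (iG i j).
- have aeF := @ae_filter_ringOfSetsType _ _ _ mu.
  by apply: (@filterS _ _ aeF _ _ _ FG) => x xFG Ix; rewrite /= xFG.
Qed.

Lemma gram_mulmx k k' l l' (A : 'M[R]_(k', k)) (B : 'M[R]_(l', l)) u v :
  L2 I u -> L2 I v ->
  gram I (fun x => A *m u x) (fun x => B *m v x) = A *m gram I u v *m B^T.
Proof.
move=> Lu Lv; have iuv := mxintegrable_mul_tr Lu Lv.
rewrite /gram -mxint_mulmx// -mxint_mulmxr; last exact: mxintegrable_mulmx.
by apply: eq_mxint => x _; rewrite trmx_mul !mulmxA.
Qed.

Lemma gram_mulmxl k k' l (A : 'M[R]_(k', k)) u (v : R -> 'cV[R]_l) :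
  L2 I u -> L2 I v -> gram I (fun x => A *m u x) v = A *m gram I u v.
Proof.
move=> Lu Lv; rewrite /gram -mxint_mulmx; last exact: mxintegrable_mul_tr.
by apply: eq_mxint => x _; rewrite mulmxA.
Qed.

Lemma tr_gram k l (u : R -> 'cV[R]_k) (v : R -> 'cV[R]_l) : (gram I u v)^T = gram I v u.
Proof. by rewrite /gram -mxint_trmx; apply: eq_mxint => x _; rewrite trmx_mul trmxK. Qed.

Lemma gram_col_mx k1 k2 l (u1 : R -> 'cV[R]_k1) (u2 : R -> 'cV[R]_k2) (v : R -> 'cV[R]_l) :
  gram I (fun x => col_mx (u1 x) (u2 x)) v = col_mx (gram I u1 v) (gram I u2 v).
Proof. by rewrite /gram -mxint_col_mx; apply: eq_mxint => x _; rewrite mul_col_mx. Qed.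

Lemma gram_block k1 k2 (u1 : R -> 'cV[R]_k1) (u2 : R -> 'cV[R]_k2) :
  gram I (fun x => col_mx (u1 x) (u2 x)) (fun x => col_mx (u1 x) (u2 x)) =
  block_mx (gram I u1 u1) (gram I u1 u2) (gram I u2 u1) (gram I u2 u2).
Proof.
rewrite gram_col_mx -!(tr_gram (fun x => col_mx _ _)) !gram_col_mx !tr_col_mx.
by rewrite !tr_gram block_mxEv.
Qed.

End GramMatrices.

Section ClosedLoop.
Context {R : realType} {n m p q nu : nat} (s : delay_system R n m p q nu)
        (D : decomposition R n m p nu) (L : factors D).
Notation mu := (@lebesgue_measure R).
Hypothesis sD : decomposes s D.
Hypothesis Lwf : factors_wf s L.
Local Notation I i := (itv_delay s i).

Lemma L2_ff i : L2 (I i) (ff D i).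
Proof. by have [_ [[]]] := sD i. Qed.

Lemma L2_fh i : L2 (I i) (fh D i).
Proof. by have [_ [_ Lv _] _ _ _] := sD i; apply: L2_col_mx => //; exact: L2_ff. Qed.

Lemma L2_fg i : L2 (I i) (fg D i).
Proof. by have [_ [_ _ Lp] _ _ _] := sD i; apply: L2_col_mx => //; exact: L2_fh. Qed.

Let posdef_sub k1 k2 (u1 : R -> 'cV[R]_k1) (u2 : R -> 'cV[R]_k2) i :
  L2 (I i) u1 -> L2 (I i) u2 ->
  posdefmx (gram (I i) (fun x => col_mx (u1 x) (u2 x)) (fun x => col_mx (u1 x) (u2 x))) ->
  posdefmx (gram (I i) u2 u2).
Proof.
move=> L1 L2 Gpos; have := @posdefmx_congr _ _ _ (row_mx 0 1%:M) _ Gpos.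
rewrite -gram_mulmx; try exact: L2_col_mx.
have -> : (fun x => row_mx 0 1%:M *m col_mx (u1 x) (u2 x)) = u2.
  by apply/funext => x; rewrite mul_row_col mul0mx mul1mx add0r.
apply => x; rewrite tr_row_mx mul_col_mx trmx0 trmx1 mul1mx => /(congr1 dsubmx).
by rewrite col_mxKd linear0.
Qed.

Lemma posdef_gramH i : posdefmx (gramH s D i).
Proof.
have [_ [_ _ Lp] _ _ Gpos] := sD i.
exact: (posdef_sub Lp (@L2_fh i) Gpos).
Qed.

Lemma posdef_gram_ff i : posdefmx (gram (I i) (ff D i) (ff D i)).
Proof.
have [_ [_ Lv _] _ _ _] := sD i.
exact: (posdef_sub Lv (@L2_ff i) (posdef_gramH i)).
Qed.

Let Reps i : 'M[R]_(dimphi D i, dimg D i) :=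
  row_mx 1%:M (- (Gam s D i *m invmx (gramH s D i))).

Let fepsE i : feps s D i = fun x => Reps i *m fg D i x.
Proof. by apply/funext => x; rewrite mul_row_col mul1mx mulNmx. Qed.

Lemma L2_feps i : L2 (I i) (feps s D i).
Proof. by rewrite fepsE; apply: L2_mulmx; exact: L2_fg. Qed.

Lemma posdef_gram_feps i : posdefmx (gram (I i) (feps s D i) (feps s D i)).
Proof.
have [_ _ _ _ Gpos] := sD i; rewrite fepsE gram_mulmx; try exact: L2_fg.
apply: posdefmx_congr => // x; rewrite tr_row_mx mul_col_mx trmx1 mul1mx.
by move=> /(congr1 usubmx); rewrite col_mxKu linear0.
Qed.

(** epsilon_i is phi_i minus its L^2 projection on the span of h_i. *)
Lemma gram_fh_feps i : gram (I i) (fh D i) (feps s D i) = 0.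
Proof.
have -> : fh D i = fun x => row_mx 0 1%:M *m fg D i x.
  by apply/funext => x; rewrite mul_row_col mul0mx mul1mx add0r.
rewrite fepsE gram_mulmx; try exact: L2_fg.
rewrite {1}/fg gram_block mul_row_block !mul0mx !mul1mx !add0r tr_row_mx mul_row_col.
rewrite trmx1 mulmx1 linearN/= trmx_mul trmx_inv.
have [Hs _] := posdef_gramH i; rewrite /gramH in Hs.
rewrite Hs mulmxN mulKVmx; last exact: posdefmx_unit (posdef_gramH i).
by rewrite /Gam tr_gram subrr.
Qed.

Lemma Lf_unit i : Lf L i \in unitmx.
Proof. by have [c _ _] := Lwf i; exact: cholesky_unit (posdef_gram_ff i) c. Qed.

Lemma Lh_unit i : Lh L i \in unitmx.
Proof. by have [_ c _] := Lwf i; exact: cholesky_unit (posdef_gramH i) c. Qed.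

Lemma Le_unit i : Le L i \in unitmx.
Proof. by have [_ _ c] := Lwf i; exact: cholesky_unit (posdef_gram_feps i) c. Qed.

(** The families ef, eh and ee are orthonormal in L^2, because the Cholesky
    factors are those of the Gram matrices. *)
Definition ef i x := invmx (Lf L i) *m ff D i x.
Definition eh i x := invmx (Lh L i) *m fh D i x.
Definition ee i x := invmx (Le L i) *m feps s D i x.

Lemma L2_ef i : L2 (I i) (ef i). Proof. by apply: L2_mulmx; exact: L2_ff. Qed.
Lemma L2_eh i : L2 (I i) (eh i). Proof. by apply: L2_mulmx; exact: L2_fh. Qed.
Lemma L2_ee i : L2 (I i) (ee i). Proof. by apply: L2_mulmx; exact: L2_feps. Qed.

Let orthonormal_cholesky k (u : R -> 'cV[R]_k) (M : 'M[R]_k) i :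
  L2 (I i) u -> M \in unitmx -> M *m M^T = gram (I i) u u ->
  gram (I i) (fun x => invmx M *m u x) (fun x => invmx M *m u x) = 1%:M.
Proof.
move=> Lu Mu MM; rewrite gram_mulmx// -MM mulKmx// trmx_inv mulmxV//.
by rewrite unitmx_tr.
Qed.

Lemma gram_ef i : gram (I i) (ef i) (ef i) = 1%:M.
Proof.
have [[_ c] _ _] := Lwf i; apply: orthonormal_cholesky => //; first exact: L2_ff.
exact: Lf_unit.
Qed.

Lemma gram_eh_ee i : gram (I i) (fun x => col_mx (eh i x) (ee i x))
  (fun x => col_mx (eh i x) (ee i x)) = 1%:M.
Proof.
have [_ [_ ch] [_ ce]] := Lwf i; rewrite gram_block.
rewrite (orthonormal_cholesky (@L2_fh i) (@Lh_unit i) ch).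
rewrite (orthonormal_cholesky (@L2_feps i) (@Le_unit i) ce).
have X : gram (I i) (eh i) (ee i) = 0.
  rewrite gram_mulmx; [|exact: L2_fh|exact: L2_feps].
  by rewrite gram_fh_feps mulmx0 mul0mx.
by rewrite X -tr_gram X trmx0 -scalar_mx_block.
Qed.

(** [T1 T2] expresses g_i in the orthonormal basis formed by eh and ee. *)
Lemma T1_T2_gram i (y : R -> 'cV[R]_n) : L2 (I i) y ->
  T1 s L i *m gram (I i) (eh i) y + T2 L i *m gram (I i) (ee i) y =
  gram (I i) (fg D i) y.
Proof.
move=> Ly; have [_ [_ ch] _] := Lwf i.
have Hu := posdefmx_unit (posdef_gramH i).
rewrite /T1 /T2 gram_mulmxl//; last exact: L2_fh.
rewrite gram_mulmxl//; last exact: L2_feps.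
rewrite -mulmxA mulKVmx ?Le_unit// !mul_col_mx mul1mx mul0mx mulKVmx ?Lh_unit//.
rewrite add_col_mx addr0 [RHS](gram_col_mx _ _ (fphi D i) (fh D i)); congr col_mx.
rewrite -!mulmxA [X in Gam _ _ _ *m X](_ : _ = invmx (gramH s D i) *m gram (I i) (fh D i) y).
  have [_ [_ _ Lp] _ _ _] := sD i.
  have -> : gram (I i) (feps s D i) y = gram (I i) (fphi D i) y -
      Gam s D i *m invmx (gramH s D i) *m gram (I i) (fh D i) y.
    rewrite -gram_mulmxl//; last exact: L2_fh.
    rewrite /gram -mxintB; first by apply: eq_mxint => x _; rewrite mulmxBl.
      exact: mxintegrable_mul_tr.
    by apply: mxintegrable_mul_tr => //; apply: L2_mulmx; exact: L2_fh.
  by rewrite mulmxA addrC subrK.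
rewrite mulmxA; congr (_ *m _).
rewrite -[LHS](mulKmx Hu) -[RHS]mulmx1; congr (_ *m _); rewrite -ch -mulmxA trmx_inv.
by rewrite (mulmxA (Lh L i)^T) mulmxV ?unitmx_tr ?Lh_unit// mul1mx mulmxV// Lh_unit.
Qed.

(** The vector theta(t) without w(t), for the history y = x(t + .). *)
Definition delay_state (y : R -> 'cV[R]_n) : 'cV[R]_(bdim D n) :=
  stack (y (- delay s 0))^T (fun i : 'I_nu => (y (- delay s i.+1))^T)
    (fun i => gram (I i) (eh i) y) (fun i => gram (I i) (ee i) y).

Lemma mxint_kronI k a i (X : 'M[R]_(k, dimg D i * a)) (y : R -> 'cV[R]_a) :
  L2 (I i) y ->
  X *m vecm (gram (I i) (fg D i) y) =
  mxint (I i) (fun x => X *m (kronI a (fg D i x) *m y x)).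
Proof.
move=> Ly; have iy := mxintegrable_mul_tr (@L2_fg i) Ly.
rewrite mxint_mulmx; last first.
  move=> j c; have := iy (mxtens_unindex j).1 (mxtens_unindex j).2.
  by apply: eq_integrable => // x _ /=; rewrite kronI_mul vecmE.
congr (_ *m _); apply/colP => j; rewrite vecmE !mxE.
by apply: eq_Rintegral => x _; rewrite kronI_mul vecmE.
Qed.

(** Both equations of the closed loop are instances: X stands for the matrices
    that act on the state, Y for those that act on the feedback K x. *)
Lemma hatblocks_delay_state k (X0 : 'I_nu.+1 -> 'M[R]_(k, n)) (Y0 : 'I_nu.+1 -> 'M[R]_(k, p))
    (Xh : forall i, 'M[R]_(k, dimg D i * n)) (Yh : forall i, 'M[R]_(k, dimg D i * p))
    (Xt : 'I_nu -> R -> 'M[R]_(k, n)) (Yt : 'I_nu -> R -> 'M[R]_(k, p))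
    (E : 'M[R]_(k, q)) (K : 'M[R]_(p, n)) y w :
  (forall i, L2 (I i) y) -> (forall i, L2 (I i) (Xt i)) -> (forall i, L2 (I i) (Yt i)) ->
  (forall i, {ae mu, forall x, I i x -> Xt i x = Xh i *m kronI n (fg D i x) /\
    Yt i x = Yh i *m kronI p (fg D i x)}) ->
  (hatblocks s L X0 Xh E + hatblocks s L Y0 Yh (0 : 'M[R]_(k, q)) *m Kblock q D K) *m
    col_mx (delay_state y) w =
  \sum_(i < nu.+1) (X0 i + Y0 i *m K) *m y (- delay s i) +
  \sum_(i < nu) mxint (I i) (fun x => (Xt i x + Yt i x *m K) *m y x) + E *m w.
Proof.
move=> Ly LX LY XY; rewrite mulmxDl -mulmxA /delay_state Kblock_stack !hatblocks_stack.
have LKy i : L2 (I i) (fun x => K *m y x) by apply: L2_mulmx; exact: Ly.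
rewrite mulmx0 addr0 big_ord_recl/= !trmxK.
have term i : mxint (I i) (fun x => (Xt i x + Yt i x *m K) *m y x) =
    Xh i *m vecm (T1 s L i *m gram (I i) (eh i) y + T2 L i *m gram (I i) (ee i) y) +
    Yh i *m vecm (T1 s L i *m (gram (I i) (eh i) y *m K^T) +
                  T2 L i *m (gram (I i) (ee i) y *m K^T)).
  rewrite !mulmxA -mulmxDl T1_T2_gram//.
  have -> : gram (I i) (fg D i) y *m K^T = gram (I i) (fg D i) (fun x => K *m y x).
    rewrite -[RHS]tr_gram gram_mulmxl; [|exact: Ly|exact: L2_fg].
    by rewrite trmx_mul tr_gram.
  rewrite !mxint_kronI//.
  have int_kron a (X : 'M[R]_(k, dimg D i * a)) (Z : R -> 'M[R]_(k, a)) (z : R -> 'cV[R]_a) :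
      L2 (I i) z -> mxintegrable (- delay s i.+1) (- delay s i)
        (fun x => X *m (kronI a (fg D i x) *m z x)).
    move=> Lz; apply: mxintegrable_mulmx => j c.
    have := mxintegrable_mul_tr (@L2_fg i) Lz (mxtens_unindex j).1 (mxtens_unindex j).2.
    by apply: eq_integrable => // x _ /=; rewrite kronI_mul vecmE.
  rewrite -mxintD; [|exact: int_kron (Xt i) _ _|exact: int_kron (Yt i) _ _].
  apply: ae_eq_mxint.
  - have h1 := mxintegrableD (mxintegrable_mul (LX i) (Ly i)) (mxintegrable_mul (LY i) (LKy i)).
    move=> j c; apply: eq_integrable (h1 j c) => // x _ /=.
    by rewrite mulmxDl mulmxA.
  - by apply: mxintegrableD; [exact: int_kron (Xt i) _ _|exact: int_kron (Yt i) _ _].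
  - have aeF := @ae_filter_ringOfSetsType _ _ _ mu.
    apply: (@filterS _ _ aeF _ _ _ (XY i)) => x XYx Ix; have [-> ->] := XYx Ix.
    by rewrite mulmxDl !mulmxA.
have sumE (V : zmodType) (a b c d a' b' c' : V) :
    a + b + c + d + (a' + b' + c') = (a + a') + (b + b') + (c + c') + d.
  by rewrite addrAC (addrACA (a + b)) (addrACA a).
rewrite sumE -!big_split/=; congr (_ + _ + _ + _).
- by rewrite mulmxDl trmx_mul !trmxK mulmxA.
- by apply: eq_bigr => i _; rewrite mulmxDl trmx_mul !trmxK mulmxA.
- by apply: eq_bigr => i _; rewrite term.
Qed.

End ClosedLoop.

(** * The Lyapunov-Krasovskii functional and the matrix inequality *)

Section Lyapunov.
Context {R : realType} {n m p q nu : nat} (s : delay_system R n m p q nu)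
        (D : decomposition R n m p nu) (L : factors D).
Notation mu := (@lebesgue_measure R).
Hypothesis sD : decomposes s D.
Hypothesis Lwf : factors_wf s L.
Variables (J1 Jt : 'M[R]_m) (J2 : 'M[R]_(m, q)) (J3 : 'M[R]_q).
Variables (K : 'M[R]_(p, n)) (P1 : 'M[R]_n) (P2 : 'M[R]_(n, dimF D * n))
  (P3 : 'M[R]_(dimF D * n)) (Q Rm : 'I_nu -> 'M[R]_n).
Local Notation I i := (itv_delay s i).
Local Notation Pb := (Pblock P1 P2 P3).

(** The vector on which [P1 P2; P2^T P3] acts: x(t) and the integrals of the
    normalised f_i against the history. *)
Definition lyap_state (y : R -> 'cV[R]_n) : 'cV[R]_(n + dimF D * n) :=
  col_mx (y (- delay s 0)) (vecm (\mxcol_i gram (I i) (ef L i) y)).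

(** The value along the closed loop of the derivative of [lyap_state]: the
    integrals produce boundary terms and, since f_i' = M_i h_i, integrals of h_i. *)
Definition lyap_state_deriv (y : R -> 'cV[R]_n) (w : 'cV[R]_q) : 'cV[R]_(n + dimF D * n) :=
  col_mx (bOmega s L K *m col_mx (delay_state s L y) w)
    (vecm (\mxcol_i (invmx (Lf L i) *m (ff D i (- delay s i) *m (y (- delay s i))^T -
      ff D i (- delay s i.+1) *m (y (- delay s i.+1))^T -
      Mf D i *m gram (I i) (fh D i) y)))).

Definition quad (A : 'M[R]_n) (v : 'cV[R]_n) : R := (v^T *m A *m v) 0 0.

(** The Lyapunov-Krasovskii functional. The weight Q_i + (tau + r_i) R_i is
    chosen such that the derivative of the integrals consists of boundary terms and
    of - [weightR]. *)
Definition lyap (y : R -> 'cV[R]_n) : R :=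
  ((lyap_state y)^T *m Pb *m lyap_state y) 0 0 +
  \sum_i \int[mu]_(x in I i) quad (Q i + (x + delay s i.+1) *: Rm i) (y x).

Definition weightR (y : R -> 'cV[R]_n) : R :=
  \sum_i \int[mu]_(x in I i) quad (Rm i) (y x).

(** The value along the closed loop of the derivative of [lyap]. *)
Definition lyap_deriv (y : R -> 'cV[R]_n) (w : 'cV[R]_q) : R :=
  2 * ((lyap_state y)^T *m Pb *m lyap_state_deriv y w) 0 0 +
  \sum_(i < nu) (quad (Q i + (delay s i.+1 - delay s i) *: Rm i) (y (- delay s i)) -
    quad (Q i) (y (- delay s i.+1))) - weightR y.

Lemma quad_integrable i (A : 'M[R]_n) (y : R -> 'cV[R]_n) : L2 (I i) y ->
  mu.-integrable (I i) (EFin \o (fun x => quad A (y x))).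
Proof.
move=> Ly; have := mxintegrable_mul (L2_tr Ly) (L2_mulmx A Ly).
by move=> /(_ 0 0); apply: eq_integrable => // x _ /=; rewrite /quad mulmxA.
Qed.

Lemma quad_weight (A B : 'M[R]_n) r v : quad (A + r *: B) v = quad A v + r * quad B v.
Proof. by rewrite /quad quadD -scalemxAr -scalemxAl [X in _ + X]mxE. Qed.

Lemma bS_delay_state y w : (forall i, L2 (I i) y) ->
  bS q L *m col_mx (delay_state s L y) w = lyap_state y.
Proof.
move=> Ly; rewrite /bS /delay_state /stack mul_col_mx !mul_row_col !mul0mx !addr0 !add0r.
rewrite mul1mx trmxK Ihat_mxcol; congr col_mx; congr vecm; apply: eq_mxcol => i.
rewrite -gram_mulmxl; [|exact: L2_eh|exact: Ly].
rewrite -gram_mulmxl; [|by apply: L2_mulmx; exact: L2_eh|exact: Ly].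
rewrite -gram_mulmxl; [|by apply: L2_mulmx; apply: L2_mulmx; exact: L2_eh|exact: Ly].
congr (gram _ _ _); apply/funext => x; rewrite /eh mulKVmx ?(Lh_unit sD Lwf)//.
by rewrite mul_row_col mul0mx mul1mx add0r.
Qed.

Lemma bMI_delay_state y w : (forall i, L2 (I i) y) ->
  col_mx (bOmega s L K) (row_mx (row_mx (bMI s L) 0) (0 : 'M[R]_(_, q))) *m
    col_mx (delay_state s L y) w = lyap_state_deriv y w.
Proof.
move=> Ly; rewrite mul_col_mx; congr col_mx.
rewrite /delay_state /stack !mul_row_col !mul0mx !addr0.
rewrite (bMI_stack s L (fun j => (y (- delay s j))^T) (fun i => gram (I i) (eh L i) y)).
congr vecm; apply: eq_mxcol => i; congr (_ *m (_ - _ *m _)).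
rewrite gram_mulmxl; [|exact: L2_fh|exact: Ly].
by rewrite mulKVmx// (Lh_unit sD Lwf).
Qed.

(** Up to sign, the terms of Xi that contain R_i but not a boundary value: what
    [weightR] becomes when the history is replaced by its projection on the span
    of eh and ee. *)
Definition projR (y : R -> 'cV[R]_n) : R :=
  \sum_i (\tr (gram (I i) (eh L i) y *m Rm i *m (gram (I i) (eh L i) y)^T) +
          \tr (gram (I i) (ee s L i) y *m Rm i *m (gram (I i) (ee s L i) y)^T)).

Hypothesis Rpd : forall i, posdefmx (Rm i).

(** Bessel's inequality on each delay interval. *)
Lemma projR_le y : (forall i, L2 (I i) y) -> projR y <= weightR y.
Proof.
move=> Ly; apply: ler_sum => i _; have [Rs _] := Rpd i.
have := bessel_inequality (L2_col_mx (L2_eh L sD (i := i)) (L2_ee L sD (i := i))) (Ly i)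
  (gram_eh_ee sD Lwf i) Rs (fun v => posdefmx_ge0 v (Rpd i)).
by rewrite gram_col_mx tr_col_mx mul_col_mx mul_col_row mxtrace_block.
Qed.

Lemma supplyE (z : 'cV[R]_m) (w : 'cV[R]_q) : supply J1 Jt J2 J3 z w =
  ((Jt *m z)^T *m invmx J1 *m (Jt *m z)) 0 0 + 2 * (w^T *m J2^T *m z) 0 0 +
  (w^T *m J3 *m w) 0 0.
Proof.
rewrite /supply -mulmxA mul_block_col tr_col_mx mul_row_col !mulmxDr trmx_mul !mulmxA.
have -> : z^T *m J2 *m w = (w^T *m J2^T *m z)^T by rewrite !trmx_mul !trmxK mulmxA.
rewrite mxE [X in X + _]mxE [X in _ + X + _]mxE [X in _ + X]mxE; ring.
Qed.

(** At theta, the form of Psi is the derivative of the functional minus the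
    terms of the supply rate with J2 and J3, except that [projR] stands in place of
    [weightR]; the term with J1 comes from the Schur complement. *)
Lemma lyap_deriv_le (J1s : J1^T = J1) (J1u : J1 \in unitmx) :
  negdefmx (lmi_block s L K P1 P2 P3 Q Rm J1 Jt J2 J3) ->
  exists2 e : R, 0 < e & forall y w, (forall i, L2 (I i) y) ->
    lyap_deriv y w <= supply J1 Jt J2 J3 (bSigma s L K *m col_mx (delay_state s L y) w) w
      - e * sqnorm (col_mx (delay_state s L y) w) - (weightR y - projR y).
Proof.
move=> lmi; rewrite /lmi_block -trmx_mul in lmi.
have [e e0 He] := negdefmx_schur J1s J1u lmi.
exists e => // y w Ly; have := He (col_mx (delay_state s L y) w).
set th := col_mx _ _; set z := bSigma s L K *m th.
have Rs i : (Rm i)^T = Rm i by have [] := Rpd i.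
have -> : (th^T *m bPsi s L K P1 P2 P3 Q Rm J2 J3 *m th) 0 0 =
    lyap_deriv y w + weightR y - projR y - (w^T *m J3 *m w) 0 0 - 2 * (w^T *m J2^T *m z) 0 0.
  rewrite /bPsi quadD quad_Sy quadB.
  have -> : (th^T *m (((bS q L)^T *m Pb) *m col_mx (bOmega s L K)
      (row_mx (row_mx (bMI s L) 0) (0 : 'M[R]_(_, q)))) *m th) 0 0 =
      ((lyap_state y)^T *m Pb *m lyap_state_deriv y w) 0 0.
    by rewrite -(bMI_delay_state w Ly) -(bS_delay_state w Ly) trmx_mul !mulmxA.
  have -> : (th^T *m (col_mx (0 : 'M[R]_(bdim D n, m)) J2^T *m bSigma s L K) *m th) 0 0 =
      (w^T *m J2^T *m z) 0 0.
    rewrite /th tr_col_mx -!mulmxA (mulmxA _ (col_mx _ _)) mul_row_col mulmx0 add0r.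
    by rewrite -!mulmxA.
  rewrite (bXi_quad s Q J3 (fun j => (y (- delay s j))^T) (fun i => gram (I i) (eh L i) y)
    (fun i => gram (I i) (ee s L i) y) w Rs).
  rewrite /lyap_deriv /projR /quad.
  under eq_bigr do rewrite !trmxK.
  ring.
have zE : Jt *m bSigma s L K *m th = Jt *m z by rewrite -mulmxA.
rewrite supplyE zE; lra.
Qed.

End Lyapunov.

(** * Bounds for the functional *)

Section LyapunovBounds.
Context {R : realType} {n m p q nu : nat} (s : delay_system R n m p q nu)
        (D : decomposition R n m p nu) (L : factors D).
Notation mu := (@lebesgue_measure R).
Hypothesis swf : delay_system_wf s.
Hypothesis sD : decomposes s D.
Hypothesis Lwf : factors_wf s L.
Variables (K : 'M[R]_(p, n)) (P1 : 'M[R]_n) (P2 : 'M[R]_(n, dimF D * n))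
  (P3 : 'M[R]_(dimF D * n)) (Q Rm : 'I_nu -> 'M[R]_n).
Hypothesis Qpd : forall i, posdefmx (Q i).
Hypothesis Rpd : forall i, posdefmx (Rm i).
Local Notation I i := (itv_delay s i).
Local Notation Pb := (Pblock P1 P2 P3).
Local Notation V y := (lyap s L P1 P2 P3 Q Rm y).

Lemma quad_weight_integrable i (y : R -> 'cV[R]_n) : L2 (I i) y ->
  mu.-integrable (I i) (EFin \o (fun x => quad (Q i + (x + delay s i.+1) *: Rm i) (y x))).
Proof.
move=> Ly.
have h : mu.-integrable (I i)
    (EFin \o (fun x => quad (Q i) (y x) + (x + delay s i.+1) * quad (Rm i) (y x))).
  apply: integrable_EFinD => //; [exact: measurable_itv|exact: quad_integrable|].
  apply: continuousM_integrable; last exact: quad_integrable.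
  apply: continuous_subspaceT => x.
  by apply: cvgD; [exact: cvg_id|exact: cvg_cst].
by apply: eq_integrable h => [|x _ /=]; [exact: measurable_itv|rewrite quad_weight].
Qed.

Lemma tr_gram_ef_le i (A : 'M[R]_n) (y : R -> 'cV[R]_n) : posdefmx A -> L2 (I i) y ->
  \tr (gram (I i) (ef L i) y *m A *m (gram (I i) (ef L i) y)^T) <=
  \int[mu]_(x in I i) quad A (y x).
Proof.
move=> Apd Ly; have [As _] := Apd.
apply: (bessel_inequality _ Ly (gram_ef sD Lwf i) As) => [|v].
  exact: L2_ef.
exact: posdefmx_ge0.
Qed.

(** By Bessel's inequality for ef, the integrals with weights Q_i dominate the
    form of diag (I (x) Q_i) at the second block of [lyap_state]. This is why the
    matrix with P1, P2, P3 only has to be positive definite after adding that form. *)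
Lemma lyap_lower_bound :
  posdefmx (Pb + oplus (0 : 'M[R]_n) (diagIQ D Q)) ->
  exists2 c : R, 0 < c & forall y, (forall i, L2 (I i) y) ->
    c * sqnorm (y (- delay s 0)) <= V y.
Proof.
move=> Ppd; have [c c0 Hc] := posdefmx_coercive Ppd.
exists c => // y Ly; have := Hc (lyap_state s L y).
rewrite {1}/lyap_state sqnorm_col_mx mulrDr => h.
apply: (@le_trans _ _ (c * sqnorm (y (- delay s 0)) +
    c * sqnorm (vecm (\mxcol_i gram (I i) (ef L i) y)))).
  by rewrite lerDl mulr_ge0 ?sqnorm_ge0// ltW.
apply: le_trans h _; rewrite quadD lerD2l /lyap_state oplus_quad quad0 add0r.
have Qs i : (Q i)^T = Q i by have [] := Qpd i.
rewrite diagIQ_quad//; apply: ler_sum => i _.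
apply: le_trans (tr_gram_ef_le (Qpd i) (Ly i)) _.
apply: le_Rintegral; [exact: measurable_itv|exact: quad_integrable|exact: quad_weight_integrable|].
move=> x; rewrite /itv_delay/= in_itv/= => /andP[ax _].
rewrite quad_weight lerDl mulr_ge0 ?posdefmx_ge0//.
by rewrite -[delay _ _]opprK subr_ge0.
Qed.

(** Bessel's inequality for ef bounds the second block of [lyap_state] by the
    integral of |y|^2, and positive definiteness of R_i bounds the latter by
    [weightR]. *)
Lemma lyap_upper_bound : exists2 k : R, 0 < k &
  forall y, (forall i, L2 (I i) y) ->
    V y <= k * (sqnorm (y (- delay s 0)) + weightR s Rm y).
Proof.
have [C C0 HC] := quad_form_bound Pb.
have term i : exists k : R, 0 < k /\ forall y, L2 (I i) y ->
    C * \tr (gram (I i) (ef L i) y *m (gram (I i) (ef L i) y)^T) +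
    \int[mu]_(x in I i) quad (Q i + (x + delay s i.+1) *: Rm i) (y x) <=
    k * \int[mu]_(x in I i) quad (Rm i) (y x).
  have [c c0 Hc] := posdefmx_coercive (Rpd i).
  have [CQ CQ0 HQ] := quad_form_bound (Q i).
  have [_ dlt _] := swf; have {dlt} := dlt i (ltn_ord i) => dlt.
  pose r := delay s i.+1 - delay s i; have r0 : 0 < r by rewrite subr_gt0.
  exists ((C + CQ) / c + r); split.
    by rewrite addr_gt0// divr_gt0// addr_gt0.
  move=> y Ly; have iR := quad_integrable (Rm i) Ly.
  have sqq (v : 'cV[R]_n) : quad 1%:M v = sqnorm v by rewrite /quad mulmx1 sqnorm_dot.
  have B1 := tr_gram_ef_le (posdefmx1 n) Ly; rewrite mulmx1 in B1.
  have N1 : \int[mu]_(x in I i) quad 1%:M (y x) <= c^-1 * \int[mu]_(x in I i) quad (Rm i) (y x).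
    rewrite -RintegralZl//; last exact: measurable_itv.
    apply: le_Rintegral; [exact: measurable_itv|exact: quad_integrable|
      apply: integrable_EFinZ; [exact: measurable_itv|exact: iR]|].
    by move=> x _; rewrite sqq mulrC ler_pdivlMr// mulrC; exact: Hc.
  have iQ : mu.-integrable (I i)
      (EFin \o (fun x => CQ * quad 1%:M (y x) + r * quad (Rm i) (y x))).
    apply: integrable_EFinD; [exact: measurable_itv| |].
      by apply: integrable_EFinZ; [exact: measurable_itv|exact: quad_integrable].
    by apply: integrable_EFinZ; [exact: measurable_itv|exact: quad_integrable].
  have N2 : \int[mu]_(x in I i) quad (Q i + (x + delay s i.+1) *: Rm i) (y x) <=
      CQ * \int[mu]_(x in I i) quad 1%:M (y x) + r * \int[mu]_(x in I i) quad (Rm i) (y x).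
    rewrite -!RintegralZl//; try exact: measurable_itv; try exact: quad_integrable.
    rewrite -RintegralD; [|exact: measurable_itv|
      apply: integrable_EFinZ; [exact: measurable_itv|exact: quad_integrable]|
      apply: integrable_EFinZ; [exact: measurable_itv|exact: quad_integrable]].
    apply: le_Rintegral; [exact: measurable_itv|exact: quad_weight_integrable|exact: iQ|].
    move=> x; rewrite /itv_delay/= in_itv/= => /andP[_ xb]; rewrite quad_weight lerD//.
      by rewrite sqq; apply: le_trans (ler_norm _) _; exact: HQ.
    rewrite ler_wpM2r ?posdefmx_ge0// /r addrC lerD2l.
    exact: xb.
  apply: le_trans (lerD (ler_wpM2l (ltW C0) B1) N2) _.
  rewrite addrA -mulrDl [leRHS]mulrDl lerD2r -mulrA ler_wpM2l//.
  by rewrite addr_ge0 ?ltW.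
have [k Hk] := choice term.
pose kk := C + \sum_i k i.
have Sk i : k i <= kk.
  rewrite /kk (bigD1 i)//= addrCA lerDl addr_ge0 ?(ltW C0)// sumr_ge0// => j _.
  by rewrite ltW//; have [] := Hk j.
exists kk.
  by rewrite ltr_pwDl// sumr_ge0// => i _; rewrite ltW//; have [] := Hk i.
move=> y Ly; have := HC (lyap_state s L y) => /(le_trans (ler_norm _)) h.
apply: (le_trans (lerD h (lexx _))).
rewrite /lyap_state sqnorm_col_mx mulrDr -addrA mulrDr lerD//.
  by rewrite ler_wpM2r ?sqnorm_ge0// lerDl sumr_ge0// => i _; rewrite ltW//; have [] := Hk i.
rewrite sqnorm_dot vecm_dot.
have -> : \tr ((\mxcol_i gram (I i) (ef L i) y) *m (\mxcol_i gram (I i) (ef L i) y)^T) =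
    \sum_i \tr (gram (I i) (ef L i) y *m (gram (I i) (ef L i) y)^T).
  rewrite mxtrace_mulC tr_mxcol mul_mxrow_mxcol raddf_sum/=.
  by apply: eq_bigr => i _; rewrite mxtrace_mulC.
rewrite mulr_sumr -big_split/= /weightR mulr_sumr; apply: ler_sum => i _.
have [_ /(_ y (Ly i)) h1] := Hk i; apply: le_trans h1 _.
apply: ler_wpM2r (Sk i); apply: Rintegral_ge0 => x _.
exact: posdefmx_ge0.
Qed.

Lemma projR_bound : exists2 C : R, 0 < C &
  forall y w, projR s L Rm y <= C * sqnorm (col_mx (delay_state s L y) (w : 'cV[R]_q)).
Proof.
pose W : 'M[R]_(bdim D n + q) := oplus (oplus (oplus (0 : 'M[R]_(n + \sum_(i < nu) n))
  (\mxdiag_(i < nu) ((1%:M : 'M[R]_(dimh D i)) *t Rm i)))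
  (\mxdiag_(i < nu) ((1%:M : 'M[R]_(dimphi D i)) *t Rm i))) (0 : 'M[R]_q).
have [C C0 HC] := quad_form_bound W; exists C => // y w.
apply: le_trans (HC _); apply: le_trans (ler_norm _).
rewrite /W /delay_state /stack !oplus_quad !quad0 addr0 add0r.
have Rs i : (Rm i)^T = Rm i by have [] := Rpd i.
rewrite !mxdiag_quad -big_split/=; apply: ler_sum => i _.
by rewrite !vecm_quad.
Qed.

(** The margin - e |theta|^2 controls |x(t)|^2 but not the integrals of |x|^2
    that occur in the functional. They are recovered from the defect [weightR] -
    [projR] >= 0: keep a fraction th of it, small enough for th [projR] to be
    absorbed by half of the margin. *)
Lemma lyap_decay (J1 Jt : 'M[R]_m) (J2 : 'M[R]_(m, q)) (J3 : 'M[R]_q) :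
  J1^T = J1 -> J1 \in unitmx -> negsemidefmx (Jt^T *m invmx J1 *m Jt) ->
  negdefmx (lmi_block s L K P1 P2 P3 Q Rm J1 Jt J2 J3) ->
  exists2 l : R, 0 < l & forall y, (forall i, L2 (I i) y) ->
    lyap_deriv s L K P1 P2 P3 Q Rm y 0 <= - l * V y.
Proof.
move=> J1s J1u [_ Jneg] lmi.
have [e e0 He] := lyap_deriv_le sD Lwf Rpd J1s J1u lmi.
have [C C0 HC] := projR_bound.
have [k k0 Hk] := lyap_upper_bound.
pose th := Num.min 1 (e / (2 * C)).
have th0 : 0 < th by rewrite lt_min ltr01 divr_gt0// mulr_gt0.
have thC : th * C <= e / 2.
  have : th <= e / (2 * C) by rewrite ge_min lexx orbT.
  rewrite -(ler_pM2r C0) => /le_trans; apply.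
  by rewrite le_eqVlt; apply/orP; left; apply/eqP; field; rewrite gt_eqF.
pose l := Num.min (e / 2) th.
have l0 : 0 < l by rewrite lt_min th0 divr_gt0.
exists (l / k) => [|y Ly]; first by rewrite divr_gt0.
have := He y 0 Ly; have := HC y 0; have := projR_le sD Lwf Rpd Ly.
set x := sqnorm (col_mx _ _); set W := weightR _ _ _; set Pr := projR _ _ _ _ => PW PC.
have W0 : 0 <= W.
  by apply: sumr_ge0 => i _; apply: Rintegral_ge0 => t _; exact: posdefmx_ge0.
have y0x : sqnorm (y (- delay s 0)) <= x.
  rewrite /x /delay_state /stack trmxK !sqnorm_col_mx -!addrA lerDl.
  by rewrite !addr_ge0 ?sqnorm_ge0.
have s0 : supply J1 Jt J2 J3 (bSigma s L K *m col_mx (delay_state s L y) 0) 0 <= 0.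
  rewrite supplyE linear0 !mul0mx [X in _ + X]mxE [X in 2 * X]mxE mulr0 !addr0 trmx_mul.
  have := Jneg (bSigma s L K *m col_mx (delay_state s L y) 0).
  by rewrite !mulmxA.
have x0 : 0 <= x by exact: sqnorm_ge0.
have Vk := Hk y Ly.
have th1 : th <= 1 by rewrite ge_min lexx.
have le1 : l <= e / 2 by rewrite ge_min lexx.
have le2 : l <= th by rewrite ge_min lexx orbT.
have kV : - (l * (sqnorm (y (- delay s 0)) + W)) <= - (l / k) * V y.
  rewrite mulNr lerN2 -mulrA; apply: ler_wpM2l; first exact: ltW.
  by rewrite [k^-1 * _]mulrC ler_pdivrMr// mulrC.
have a1 : th * (W - Pr) <= W - Pr by rewrite ler_piMl// subr_ge0.
have a2 : th * Pr <= th * (C * x) by rewrite ler_wpM2l// ltW.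
have a3 : th * (C * x) <= e / 2 * x by rewrite mulrA ler_wpM2r.
have a4 : l * sqnorm (y (- delay s 0)) <= e / 2 * x.
  by apply: ler_pM => //; [exact: ltW|exact: sqnorm_ge0].
have a5 : l * W <= th * W by rewrite ler_wpM2r.
have hh : e * x = e / 2 * x + e / 2 * x by rewrite -mulrDl -splitr.
move: a1 kV; rewrite mulrBr mulrDr; clear -s0 a2 a3 a4 a5 hh; lra.
Qed.

End LyapunovBounds.

(** * Derivatives of quadratic forms and of moving Gram matrices *)

Section Calculus.
Context {R : realType}.
Notation mu := (@lebesgue_measure R).

Lemma clamp_continuous a b (g : R -> R) : a <= b ->
  {within `[a, b], continuous g} ->
  continuous (fun u => g (Num.max a (Num.min u b))).
Proof.
move=> ab /subspace_continuousP cg u; pose c (u : R) := Num.max a (Num.min u b).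
have cab v : a <= c v <= b by rewrite /c le_max lexx/= ge_max ab ge_min lexx orbT.
have cc : continuous c.
  move=> v; apply: (@continuous_max R _ (fun=> a) (fun u => Num.min u b)).
    exact: cvg_cst.
  by apply: (@continuous_min R _ id (fun=> b)); [exact: cvg_id|exact: cvg_cst].
have := cg (c u); rewrite /= in_itv/= => /(_ (cab u)) gc.
suff key : forall e : R, 0 < e -> \forall v \near u, `|g (c u) - g (c v)| < e.
  exact/cvgrPdist_lt.
move=> e e0; move/cvgrPdist_lt : gc => /(_ _ e0); rewrite near_withinE => near_c.
have /(_ _ near_c) near_u : c @ u --> c u by exact: cc.
near=> v; have : `[a, b]%classic (c v) -> `|g (c u) - g (c v)| < e.
  by near: v; exact: near_u.
by apply; rewrite /= in_itv/=; exact: cab.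
Unshelve. all: by end_near. Qed.

Lemma is_derive_fsum n (F : 'I_n -> R -> R) (dF : 'I_n -> R) t :
  (forall i, is_derive t (1 : R) (F i) (dF i)) ->
  is_derive t (1 : R) (fun t => \sum_i F i t) (\sum_i dF i).
Proof.
move=> Fd; rewrite (_ : (fun t => _) = \sum_i F i); last first.
  by apply/funext => u; rewrite fct_sumE.
exact: is_derive_sum.
Qed.

Lemma quad_form_is_derive n (A : 'M[R]_n) (v : R -> 'cV[R]_n) (dv : 'cV[R]_n) t :
  A^T = A -> (forall k, is_derive t (1 : R) (fun t => v t k 0) (dv k 0)) ->
  is_derive t (1 : R) (fun t => ((v t)^T *m A *m v t) 0 0) (2 * ((v t)^T *m A *m dv) 0 0).
Proof.
move=> As vd.
have -> : (fun t => ((v t)^T *m A *m v t) 0 0) =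
    fun t => \sum_k \sum_l A k l * (v t k 0 * v t l 0).
  by apply/funext => u; rewrite quadE.
have -> : 2 * ((v t)^T *m A *m dv) 0 0 =
    \sum_k \sum_l A k l * (v t k 0 * dv l 0 + v t l 0 * dv k 0).
  rewrite quadE mulrDl mul1r [X in X + _ = _]exchange_big/= -big_split/=.
  apply: eq_bigr => k _; rewrite -big_split/=; apply: eq_bigr => l _.
  by rewrite -[in A l k]As mxE; ring.
apply: is_derive_fsum => k; apply: is_derive_fsum => l.
have := is_deriveZ (A k l) (is_deriveM (vd k) (vd l)); exact.
Qed.

Lemma quad_form_ac n (A : 'M[R]_n) (v : R -> 'cV[R]_n) a b :
  (forall k, abs_continuous a b (fun t => v t k 0)) ->
  abs_continuous a b (fun t => ((v t)^T *m A *m v t) 0 0).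
Proof.
move=> va; rewrite (_ : (fun t => _) = fun t => \sum_k \sum_l A k l * (v t k 0 * v t l 0)).
  apply: ac_sum => k; apply: ac_sum => l; apply: acM; first exact: ac_cst.
  exact: acM.
by apply/funext => u; rewrite quadE.
Qed.

Lemma test_function_continuous a b (psi : R -> R) : test_function a b psi -> continuous psi.
Proof.
move=> [dpsi _ _]; apply: (@continuous_of_is_derive R psi (fun x => derive1 psi x)) => x.
by rewrite derive1E; exact/derivableP.
Qed.

Lemma weak_derivative_coord k a b (u v : R -> 'cV[R]_k) j : weak_derivative a b u v ->
  scalar_weak_derivative a b (fun x => u x j 0) (fun x => v x j 0).
Proof.
move=> uv psi tpsi; have /matrixP/(_ j 0) := uv psi tpsi; rewrite !mxE.
by under eq_Rintegral do rewrite mxE; under [in RHS]eq_Rintegral do rewrite mxE.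
Qed.

Lemma weak_derivative_mulmx k l a b (A : 'M[R]_(l, k)) (u v : R -> 'cV[R]_k) :
  L2 `[a, b] u -> L2 `[a, b] v -> weak_derivative a b u v ->
  weak_derivative a b (fun x => A *m u x) (fun x => A *m v x).
Proof.
move=> Lu Lv uv psi tpsi; have [_ cdpsi _] := tpsi.
have cpsi := test_function_continuous tpsi.
have int (c : R -> R) (f : R -> 'cV[R]_k) : continuous c -> L2 `[a, b] f ->
    mxintegrable a b (fun x => c x *: f x).
  move=> cc Lf i j.
  have := @continuousM_integrable R a b c _ (continuous_subspaceT cc) (sq_integrable1 (Lf i j)).
  by apply: eq_integrable => // x _ /=; rewrite mxE.
rewrite (_ : mxint _ (fun x => derive1 psi x *: _) =
    A *m mxint `[a, b] (fun x => derive1 psi x *: u x)); last first.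
  by rewrite -mxint_mulmx; [apply: eq_mxint => x _; rewrite scalemxAr|exact: int].
rewrite uv// (_ : mxint _ (fun x => psi x *: _) = A *m mxint `[a, b] (fun x => psi x *: v x)).
  by rewrite mulmxN.
by rewrite -mxint_mulmx; [apply: eq_mxint => x _; rewrite scalemxAr|exact: int].
Qed.

Section GramDerivative.
Variables (a b : R) (ab : a < b) (k n : nat) (u v : R -> 'cV[R]_k) (x : R -> 'cV[R]_n).
Hypothesis cu : forall j, {within `[a, b], continuous (fun t => u t j 0)}.
Hypothesis Lv : L2 `[a, b] v.
Hypothesis uv : weak_derivative a b u v.
Hypothesis cx : forall l, continuous (fun t => x t l 0).

Let gramE (f : R -> 'cV[R]_k) t j l : gram `[a, b] f (segment x t) j l =
  \int[mu]_(y in `[a, b]) (f y j 0 * x (t + y) l 0).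
Proof.
by rewrite mxE; apply: eq_Rintegral => y _; rewrite mxE big_ord1 mxE.
Qed.

Lemma gram_is_derive t j l :
  is_derive t (1 : R) (fun t => gram `[a, b] u (segment x t) j l)
   ((u b *m (x (t + b))^T - u a *m (x (t + a))^T - gram `[a, b] v (segment x t)) j l).
Proof.
have := delay_integral_is_derive ab (@cu j) (sq_integrable1 (Lv j 0))
  (weak_derivative_coord j uv) (@cx l) t.
rewrite -gramE (_ : (fun t => \int[mu]_(y in _) _) = fun t => gram `[a, b] u (segment x t) j l).
  move=> /is_derive_eq; apply.
  rewrite [RHS]mxE [X in _ = _ + X]mxE; congr (_ - _).
  by rewrite !mxE !big_ord1 !mxE.
by apply/funext => t'; rewrite gramE.
Qed.

Lemma gram_ac j l c d : abs_continuous c d (fun t => gram `[a, b] u (segment x t) j l).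
Proof.
rewrite (_ : (fun t => _) = fun t => \int[mu]_(y in `[a, b]) (u y j 0 * x (t + y) l 0)).
  exact: (delay_integral_ac ab (@cu j) (sq_integrable1 (Lv j 0))
    (weak_derivative_coord j uv) (@cx l)).
by apply/funext => t; rewrite gramE.
Qed.

End GramDerivative.

Section WeightedIntegral.
Variables (a b : R) (ab : a < b) (n : nat) (Q Rm : 'M[R]_n) (x : R -> 'cV[R]_n).
Hypothesis cx : forall l, continuous (fun t => x t l 0).

Let f k l y := Q k l + (y - a) * Rm k l.
Let u k l y := x y k 0 * x y l 0.

Let cf k l : continuous (f k l).
Proof.
move=> y; apply: cvgD; first exact: cvg_cst.
by apply: cvgMl; apply: cvgB; [exact: cvg_id|exact: cvg_cst].
Qed.

Let cu k l : continuous (u k l).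
Proof. by move=> y; apply: cvgM; exact: cx. Qed.

Let ig k l : mu.-integrable `[a, b] (EFin \o (fun=> Rm k l)).
Proof. by apply: continuous_integrable => y; exact: cvg_cst. Qed.

Let fg k l : scalar_weak_derivative a b (f k l) (fun=> Rm k l).
Proof.
move=> psi tpsi; have [dpsi cdpsi [c [d [ac db psi0]]]] := tpsi.
have cpsi := test_function_continuous tpsi.
have psid y : is_derive y (1 : R) psi (derive1 psi y) by rewrite derive1E; exact/derivableP.
have fd y : is_derive y (1 : R) (f k l) (Rm k l).
  have := @is_derive_comp_affine R id (Rm k l) (Q k l - a * Rm k l) y 1 (is_derive_id _ _).
  rewrite mulr1 (_ : (fun _ => id _) = f k l) //.
  by apply/funext => z; rewrite /f/=; ring.
have pfd y := is_deriveM (psid y) (fd y).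
have cst_c : continuous (fun y => psi y * Rm k l + f k l y * derive1 psi y).
  move=> y; apply: cvgD; first by apply: cvgMl; exact: cpsi.
  by apply: cvgM; [exact: cf|exact: cdpsi].
have := @Rintegral_is_derive R a b (psi * f k l) _ ab pfd cst_c.
rewrite /= [(psi * f k l) b]/GRing.mul/= [(psi * f k l) a]/GRing.mul/=.
rewrite !psi0 ?mul0r ?subrr; try by move=> /andP[]; lra.
move=> h; apply/eqP; rewrite -addr_eq0 -RintegralD//.
- rewrite -[X in _ == X]h; apply/eqP; apply: eq_Rintegral => y _.
  by rewrite /GRing.scale/=; ring.
- apply: continuous_integrable; apply: continuous_subspaceT => y.
  by apply: cvgM; [exact: cdpsi|exact: cf].
- apply: continuous_integrable; apply: continuous_subspaceT => y.
  by apply: cvgMl; exact: cpsi.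
Qed.

Let shift_continuous t k l : continuous (fun y => u k l (t + y)).
Proof.
move=> y; apply: (@continuous_comp _ _ _ (fun y => t + y) (u k l)); last exact: cu.
by apply: cvgD; [exact: cvg_cst|exact: cvg_id].
Qed.

Let quad_int (A : R -> 'M[R]_n) t : (forall k l, continuous (fun y => A y k l)) ->
  \int[mu]_(y in `[a, b]) quad (A y) (x (t + y)) =
  \sum_k \sum_l \int[mu]_(y in `[a, b]) (A y k l * u k l (t + y)).
Proof.
move=> cA; have i k l : mu.-integrable `[a, b] (EFin \o (fun y => A y k l * u k l (t + y))).
  apply: continuous_integrable; apply: continuous_subspaceT => y.
  by apply: cvgM; [exact: cA|exact: shift_continuous].
under eq_Rintegral do rewrite /quad quadE.
rewrite Rintegral_sum//; last by move=> k; exact: integrable_EFin_sum.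
by apply: eq_bigr => k _; rewrite Rintegral_sum.
Qed.

Let weightE t : \int[mu]_(y in `[a, b]) quad (Q + (y - a) *: Rm) (x (t + y)) =
  \sum_k \sum_l \int[mu]_(y in `[a, b]) (f k l y * u k l (t + y)).
Proof.
rewrite quad_int => [|k l].
  apply: eq_bigr => k _; apply: eq_bigr => l _; apply: eq_Rintegral => y _.
  by rewrite !mxE.
rewrite (_ : (fun y => _) = f k l); first exact: cf.
by apply/funext => y; rewrite !mxE.
Qed.

(** Entrywise, these are moving integrals of the continuous function x_k x_l
    against an affine weight, whose weak derivative is a constant. *)
Lemma weighted_integral_is_derive t :
  is_derive t (1 : R) (fun t => \int[mu]_(y in `[a, b]) quad (Q + (y - a) *: Rm) (x (t + y)))
   (quad (Q + (b - a) *: Rm) (x (t + b)) - quad Q (x (t + a)) -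
    \int[mu]_(y in `[a, b]) quad Rm (x (t + y))).
Proof.
rewrite (_ : (fun t => \int[mu]_(y in _) _) =
  fun t => \sum_k \sum_l \int[mu]_(y in `[a, b]) (f k l y * u k l (t + y))); last first.
  by apply/funext => t'; exact: weightE.
have -> : quad (Q + (b - a) *: Rm) (x (t + b)) - quad Q (x (t + a)) -
    \int[mu]_(y in `[a, b]) quad Rm (x (t + y)) =
    \sum_k \sum_l (f k l b * u k l (t + b) - f k l a * u k l (t + a) -
      \int[mu]_(y in `[a, b]) (Rm k l * u k l (t + y))).
  rewrite quad_int => [|k l]; last by move=> y; exact: cvg_cst.
  rewrite /quad !quadE -!sumrB; apply: eq_bigr => k _; rewrite -!sumrB; apply: eq_bigr => l _.
  by rewrite /f /u !mxE subrr mul0r addr0.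
apply: is_derive_fsum => k; apply: is_derive_fsum => l.
apply: (delay_integral_is_derive ab _ (ig k l) (@fg k l) (@cu k l)).
by apply: continuous_subspaceT; exact: cf.
Qed.

Lemma weighted_integral_ac c d :
  abs_continuous c d (fun t => \int[mu]_(y in `[a, b]) quad (Q + (y - a) *: Rm) (x (t + y))).
Proof.
rewrite (_ : (fun t => \int[mu]_(y in _) _) =
  fun t => \sum_k \sum_l \int[mu]_(y in `[a, b]) (f k l y * u k l (t + y))); last first.
  by apply/funext => t'; exact: weightE.
apply: ac_sum => k; apply: ac_sum => l.
apply: (delay_integral_ac ab _ (ig k l) (@fg k l) (@cu k l)).
by apply: continuous_subspaceT; exact: cf.
Qed.

End WeightedIntegral.

End Calculus.

(** * The functional along a solution *)

Section Dynamics.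
Context {R : realType} {n m p q nu : nat} (s : delay_system R n m p q nu)
        (D : decomposition R n m p nu) (L : factors D).
Notation mu := (@lebesgue_measure R).
Hypothesis nu0 : (0 < nu)%N.
Hypothesis swf : delay_system_wf s.
Hypothesis sD : decomposes s D.
Hypothesis Lwf : factors_wf s L.
Variables (K : 'M[R]_(p, n)) (P1 : 'M[R]_n) (P2 : 'M[R]_(n, dimF D * n))
  (P3 : 'M[R]_(dimF D * n)) (Q Rm : 'I_nu -> 'M[R]_n).
Hypothesis P1s : P1^T = P1.
Hypothesis P3s : P3^T = P3.
Local Notation I i := (itv_delay s i).
Local Notation V y := (lyap s L P1 P2 P3 Q Rm y).

Lemma delay_le i j : (i <= j <= nu)%N -> delay s i <= delay s j.
Proof.
have [_ dlt _] := swf; move=> /andP[ij jnu].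
elim: j ij jnu => [|j IHj]; first by rewrite leqn0 => /eqP ->.
rewrite leq_eqVlt => /predU1P[->//|ij] jnu.
by apply: le_trans (IHj ij (ltnW jnu)) (ltW (dlt _ jnu)).
Qed.

Lemma delay0 : delay s 0 = 0. Proof. by have [] := swf. Qed.

Lemma delay_gt0 : 0 < delay s nu.
Proof.
have [_ dlt _] := swf; rewrite -delay0; apply: (lt_le_trans (dlt 0%N nu0)).
by rewrite delay_le// nu0 leqnn.
Qed.

Lemma itv_delay_lt (i : 'I_nu) : - delay s i.+1 < - delay s i.
Proof. by have [_ dlt _] := swf; rewrite ltrN2 dlt. Qed.

Lemma itv_delay_sub i : I i `<=` itv_hist s.
Proof.
move=> y; rewrite /itv_delay /itv_hist /= !in_itv/= => /andP[ay yb].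
rewrite (le_trans _ ay) ?(le_trans yb)//.
  by rewrite oppr_le0 -delay0 delay_le// leq0n ltnW.
by rewrite lerN2 delay_le// ltn_ord leqnn.
Qed.

Lemma delay_hist i : (i <= nu)%N -> itv_hist s (- delay s i).
Proof.
move=> inu; rewrite /itv_hist/= in_itv/= lerN2 delay_le ?inu ?leqnn//=.
by rewrite oppr_le0 -delay0 delay_le.
Qed.

Lemma hist_coord (y : R -> 'cV[R]_n) k : hist_fun s y -> {within itv_hist s, continuous (fun t => y t k 0)}.
Proof.
move=> cy t; apply: (@continuous_comp _ _ _ (y : subspace (itv_hist s) -> _)
  (fun v : 'cV[R]_n => v k 0)); first exact: cy.
exact: coord_continuous.
Qed.

Lemma coord_L2 (y : R -> 'cV[R]_n) i : (forall k, {within I i, continuous (fun t => y t k 0)}) -> L2 (I i) y.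
Proof. by move=> cy k l; rewrite (ord1 l); apply: sq_integrable_continuous; exact: cy. Qed.

Lemma hist_L2 (y : R -> 'cV[R]_n) i : hist_fun s y -> L2 (I i) y.
Proof.
move=> cy; apply: coord_L2 => k.
by move=> t; apply: (continuous_subspaceW (@itv_delay_sub i)); exact: hist_coord.
Qed.

Lemma eq_gram_hist k (u : R -> 'cV[R]_k) (y y' : R -> 'cV[R]_n) i :
  (forall t, itv_hist s t -> y t = y' t) -> gram (I i) u y = gram (I i) u y'.
Proof.
move=> yy'; apply: eq_mxint => t tab; rewrite yy'//.
by apply: (@itv_delay_sub i); rewrite /itv_delay /= in_itv.
Qed.

(** This allows a solution to be replaced by its [extension]. *)
Lemma eq_lyap (y y' : R -> 'cV[R]_n) :
  (forall t, itv_hist s t -> y t = y' t) -> V y = V y'.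
Proof.
move=> yy'; rewrite /lyap.
have -> : lyap_state s L y = lyap_state s L y'.
  have e0 : y (- delay s 0) = y' (- delay s 0) by apply: yy'; exact: delay_hist.
  rewrite /lyap_state e0; congr (col_mx _ _); congr vecm.
  by apply: eq_mxcol => i; exact: eq_gram_hist.
congr (_ + _); apply: eq_bigr => i _; apply: eq_Rintegral => t; rewrite inE => tI.
by rewrite yy'//; exact: itv_delay_sub tI.
Qed.

Section Trajectory.
Variables (t0 T0 : R) (psi : R -> 'cV[R]_n) (w : R -> 'cV[R]_q) (x : R -> 'cV[R]_n).
Hypothesis psi_hist : hist_fun s psi.
Hypothesis x_sol : is_solution s K t0 psi w x.
Hypothesis tT : t0 <= T0.
Local Notation T := (T0 + 1).
Local Notation r := (delay s nu).

(** The rules for moving integrals ask for continuity on the whole line, but a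
    solution is only determined from time t0 - r on. It is frozen before t0 - r and
    after T0 + 1; stopping after T0 leaves it unchanged in a neighbourhood of T0,
    as differentiation at T0 requires. *)
Definition extension u := x (Num.max (t0 - r) (Num.min u T)).
Local Notation xe := extension.

Lemma extensionE u : t0 - r <= u -> u <= T -> xe u = x u.
Proof. by move=> h1 h2; rewrite /extension (min_idPl h2) (max_idPr h1). Qed.

Lemma extension_continuous k : continuous (fun u => xe u k 0).
Proof.
have r0 : 0 < r by exact: delay_gt0.
have tT' := tT.
have tr : t0 - r <= t0 by lra.
have tT1 : t0 <= T by rewrite (le_trans tT)// lerDl.
have rT : t0 - r <= T by exact: le_trans tr tT1.
apply: (@clamp_continuous _ _ _ (fun u => x u k 0) rT).
have -> : `[t0 - r, T]%classic = `[t0 - r, t0] `|` `[t0, T].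
  apply/seteqP; split => u /=; rewrite !in_itv/=.
    by move=> /andP[-> ->]; case: (leP u t0) => h; [left|right; rewrite ltW].
  case=> /andP[h1 h2]; first by rewrite h1 (le_trans h2).
  by rewrite h2 (le_trans _ h1).
apply: withinU_continuous; [exact: interval_closed|exact: interval_closed| |].
  pose g u := psi (Num.max (- r) (Num.min u 0)) k 0.
  have cg : continuous g.
    apply: (@clamp_continuous _ _ _ (fun u => psi u k 0)); first by rewrite oppr_le0 ltW.
    exact: hist_coord.
  have cgs : continuous (fun u => g (u - t0)).
    move=> u; apply: (@continuous_comp _ _ _ (fun u => u - t0) g); last exact: cg.
    by apply: cvgB; [exact: cvg_id|exact: cvg_cst].
  apply: (@subspace_eq_continuous _ _ _ (fun u => g (u - t0))); last exact: continuous_subspaceT.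
  move=> u; rewrite inE/= in_itv/= => /andP[h1 h2].
  have [xpsi _ _] := x_sol.
  have := xpsi (u - t0); rewrite addrCA subrr addr0 /from_subspace => ->.
    by rewrite /g min_l ?subr_le0// max_r//; lra.
  by rewrite inE /itv_hist/= in_itv/=; apply/andP; split; lra.
have [_ xac _] := x_sol.
by apply: ac_continuous; [lra|exact: xac].
Qed.

Lemma extension_hist t tau : t0 <= t <= T -> itv_hist s tau ->
  segment x t tau = segment xe t tau.
Proof.
move=> /andP[h1 h2]; rewrite /itv_hist/= in_itv/= => /andP[h3 h4].
by rewrite /segment extensionE//; lra.
Qed.

Lemma lyap_extension t : t0 <= t <= T -> V (segment x t) = V (segment xe t).
Proof. by move=> tt; apply: eq_lyap => tau; exact: extension_hist. Qed.

Lemma extension_L2 t i : L2 (I i) (segment xe t).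
Proof.
apply: coord_L2 => k; apply: continuous_subspaceT => u.
apply: (@continuous_comp _ _ _ (fun u => t + u) (fun u => xe u k 0)).
  by apply: cvgD; [exact: cvg_cst|exact: cvg_id].
exact: extension_continuous.
Qed.

Lemma closed_loop_state t v : bOmega s L K *m col_mx (delay_state s L (segment xe t)) (w v) =
  \sum_(i < nu.+1) (A0 s i + B0 s i *m K) *m xe (t - delay s i)
  + \sum_(i < nu) mxint (itv_delay s i)
      (fun tau => (At s i tau + Bt s i tau *m K) *m xe (t + tau))
  + D1 s *m w v.
Proof.
have [_ _ LAB] := swf.
apply: (hatblocks_delay_state sD Lwf (A0 s) (B0 s) (Xt := At s) (Yt := Bt s)).
- by move=> i; exact: extension_L2.
- by move=> i; have [] := LAB i.
- by move=> i; have [] := LAB i.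
- move=> i; have [_ _ ABCD _ _] := sD i.
  have aeF := @ae_filter_ringOfSetsType _ _ _ mu.
  by apply: (@filterS _ _ aeF _ _ _ ABCD) => y h /h[].
Qed.

Lemma closed_loop_output t v : bSigma s L K *m col_mx (delay_state s L (segment xe t)) (w v) =
  \sum_(i < nu.+1) (C0 s i + F0 s i *m K) *m xe (t - delay s i)
  + \sum_(i < nu) mxint (itv_delay s i)
      (fun tau => (Ct s i tau + Ft s i tau *m K) *m xe (t + tau))
  + D2 s *m w v.
Proof.
have [_ _ LAB] := swf.
apply: (hatblocks_delay_state sD Lwf (C0 s) (F0 s) (Xt := Ct s) (Yt := Ft s)).
- by move=> i; exact: extension_L2.
- by move=> i; have [] := LAB i.
- by move=> i; have [] := LAB i.
- move=> i; have [_ _ ABCD _ _] := sD i.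
  have aeF := @ae_filter_ringOfSetsType _ _ _ mu.
  by apply: (@filterS _ _ aeF _ _ _ ABCD) => y h /h[].
Qed.

Let rhs_eq k (X : 'I_nu.+1 -> 'M[R]_(k, n)) (Y : 'I_nu -> R -> 'M[R]_(k, n)) t :
  t0 <= t <= T ->
  \sum_(i < nu.+1) X i *m x (t - delay s i) +
    \sum_(i < nu) mxint (itv_delay s i) (fun tau => Y i tau *m x (t + tau)) =
  \sum_(i < nu.+1) X i *m xe (t - delay s i) +
    \sum_(i < nu) mxint (itv_delay s i) (fun tau => Y i tau *m xe (t + tau)).
Proof.
move=> tt; congr (_ + _); apply: eq_bigr => i _.
  congr (_ *m _); apply: (extension_hist tt); apply: delay_hist.
  by rewrite -ltnS.
apply: eq_mxint => tau tab; congr (_ *m _); apply: (extension_hist tt).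
by apply: (@itv_delay_sub i); rewrite /itv_delay/= in_itv.
Qed.

Lemma state_rhsE t : t0 <= t <= T ->
  state_rhs s K w x t = bOmega s L K *m col_mx (delay_state s L (segment xe t)) (w t).
Proof.
move=> tt; rewrite closed_loop_state /state_rhs.
by rewrite (rhs_eq (fun i => A0 s i + B0 s i *m K) (fun i tau => At s i tau + Bt s i tau *m K)).
Qed.

Lemma output_rhsE t : t0 <= t <= T ->
  output_rhs s K w x t = bSigma s L K *m col_mx (delay_state s L (segment xe t)) (w t).
Proof.
move=> tt; rewrite closed_loop_output /output_rhs.
by rewrite (rhs_eq (fun i => C0 s i + F0 s i *m K) (fun i tau => Ct s i tau + Ft s i tau *m K)).
Qed.

Let dv i tau := invmx (Lf L i) *m (Mf D i *m fh D i tau).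

Let ef_continuous i j : {within I i, continuous (fun t => ef L i t j 0)}.
Proof.
have [_ [[_ cf _] _ _] _ _ _] := sD i.
have cc k : {within I i, continuous (fun t => ff D i t k 0)}.
  move=> t; apply: (@continuous_comp _ _ _ (ff D i : subspace (I i) -> _)
    (fun v : 'cV[R]_(dimf D i) => v k 0)); first exact: cf.
  exact: coord_continuous.
rewrite (_ : (fun t => _) = fun t => \sum_k invmx (Lf L i) j k * ff D i t k 0).
  rewrite (_ : (fun t => _) = \sum_k (fun t => invmx (Lf L i) j k * ff D i t k 0)).
    elim/big_ind : _ => [t|f g cf' cg' t|k _ t].
    - exact: cvg_cst.
    - by apply: cvgD; [exact: cf'|exact: cg'].
    - by apply: cvgMr; exact: cc.
  by apply/funext => t; rewrite fct_sumE.
by apply/funext => t; rewrite mxE.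
Qed.

Let dv_L2 i : L2 (I i) (dv i).
Proof. by apply: L2_mulmx; apply: L2_mulmx; exact: L2_fh. Qed.

Let ef_weak (i : 'I_nu) : weak_derivative (- delay s i.+1) (- delay s i) (ef L i) (dv i).
Proof.
have [_ _ _ wd _] := sD i; apply: weak_derivative_mulmx => //; first exact: L2_ff.
by apply: L2_mulmx; exact: L2_fh.
Qed.

Lemma lyap_ac : abs_continuous t0 T0 (fun t => V (segment xe t)).
Proof.
apply: acD.
  apply: quad_form_ac => k; case: (split_ordP k) => j ->.
    rewrite (_ : (fun t => _) = fun t => xe t j 0); last first.
      by apply/funext => t; rewrite col_mxEu /segment delay0 oppr0 addr0.
    have [_ xac _] := x_sol; have acx := xac T0 j.
    move=> e e0; have [d d0 H] := acx e e0; exists d => // N u v uv vu duv.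
    have r0 : 0 < r by exact: delay_gt0.
    have tT' := tT.
    rewrite (eq_bigr (fun k : 'I_N => `|x (v k) j 0 - x (u k) j 0|)); first exact: H.
    move=> l _; have [h1 h2 h3] := uv _ (ltn_ord l).
    by rewrite !extensionE//; lra.
  rewrite (_ : (fun t => _) = fun t => gram (I (tagnat.sig1 (mxtens_unindex j).1))
      (ef L (tagnat.sig1 (mxtens_unindex j).1)) (segment xe t)
      (tagnat.sig2 (mxtens_unindex j).1) (mxtens_unindex j).2); last first.
    by apply/funext => t; rewrite col_mxEd vecmE mxE.
  set i := tagnat.sig1 _.
  exact: (gram_ac (itv_delay_lt i) (@ef_continuous i) (@dv_L2 i) (@ef_weak i)
    extension_continuous).
apply: ac_sum => i.
have := weighted_integral_ac (itv_delay_lt i) (Q i) (Rm i) extension_continuous t0 T0.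
rewrite opprK; exact.
Qed.

(** The integrals are differentiable at all times; the exceptional times are
    those at which the solution itself violates the differential equation. *)
Lemma lyap_is_derive : {ae mu, forall t, t0 <= t <= T0 ->
  is_derive t (1 : R) (fun t => V (segment xe t))
    (lyap_deriv s L K P1 P2 P3 Q Rm (segment xe t) (w t))}.
Proof.
have [_ _ xd] := x_sol; have aeF := @ae_filter_ringOfSetsType _ _ _ mu.
apply: (@filterS _ _ aeF _ _ _ xd) => t xdt /andP[t0t tT0].
have {}xdt := xdt t0t.
have r0 : 0 < r by exact: delay_gt0.
have tT' := tT.
have xk k : is_derive t (1 : R) (fun t => xe t k 0)
    ((bOmega s L K *m col_mx (delay_state s L (segment xe t)) (w t)) k 0).
  rewrite -state_rhsE; last by rewrite t0t/=; lra.
  have [xder xE] := xdt.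
  apply: (@near_eq_is_derive _ _ _ (fun t => x t k 0)).
    near=> u; rewrite extensionE//.
      by apply: ltW; near: u; apply: lt_nbhsr; lra.
    by apply: ltW; near: u; apply: lt_nbhsl; lra.
  apply: DeriveDef; first by move/derivable_mxP : xder => /(_ k 0).
  by rewrite -xE derive_mx// mxE.
have Pbs : (Pblock P1 P2 P3)^T = Pblock P1 P2 P3.
  by rewrite /Pblock tr_block_mx P1s P3s trmxK.
rewrite /lyap_deriv -addrA.
apply: is_deriveD.
  apply: quad_form_is_derive => // k; case: (split_ordP k) => j ->.
    rewrite col_mxEu; have := xk j.
    rewrite (_ : (fun t => xe t j 0) = fun t => lyap_state s L (segment xe t) (lshift _ j) 0) //.
    by apply/funext => t'; rewrite col_mxEu /segment delay0 oppr0 addr0.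
  rewrite col_mxEd vecmE mxE.
  set i := tagnat.sig1 _; set j1 := tagnat.sig2 _; set j2 := (mxtens_unindex j).2.
  have := gram_is_derive (itv_delay_lt i) (@ef_continuous i) (@dv_L2 i) (@ef_weak i)
    extension_continuous t j1 j2.
  rewrite (_ : (fun t => gram _ _ _ _ _) =
    fun t => lyap_state s L (segment xe t) (rshift n j) 0); last first.
    by apply/funext => t'; rewrite col_mxEd vecmE [RHS]mxE.
  move=> /is_derive_eq; apply.
  rewrite /ef /dv gram_mulmxl; [|by apply: L2_mulmx; exact: L2_fh|exact: extension_L2].
  rewrite gram_mulmxl; [|exact: L2_fh|exact: extension_L2].
  by rewrite -!mulmxA -!mulmxBr.
rewrite /weightR -sumrB; apply: is_derive_fsum => i.
have := weighted_integral_is_derive (itv_delay_lt i) (Q i) (Rm i) extension_continuous t.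
by rewrite opprK [- delay s i + _]addrC.
Unshelve. all: by end_near. Qed.

End Trajectory.

End Dynamics.

(** * Continuity of the functional in the sup norm *)

Section StorageFunctional.
Context {R : realType} {n m p q nu : nat} (s : delay_system R n m p q nu)
        (D : decomposition R n m p nu) (L : factors D).
Notation mu := (@lebesgue_measure R).
Hypothesis swf : delay_system_wf s.
Hypothesis sD : decomposes s D.
Hypothesis Lwf : factors_wf s L.
Variables (P1 : 'M[R]_n) (P2 : 'M[R]_(n, dimF D * n))
  (P3 : 'M[R]_(dimF D * n)) (Q Rm : 'I_nu -> 'M[R]_n).
Local Notation I i := (itv_delay s i).
Local Notation V y := (lyap s L P1 P2 P3 Q Rm y).
Local Notation N y := (sup_norm s y).
Implicit Types y psi chi : R -> 'cV[R]_n.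

Lemma norm2_coord k (v : 'cV[R]_k) j : `|v j 0| <= norm2 v.
Proof.
rewrite -sqrtr_sqr /norm2 ler_sqrt; last exact: sqnorm_ge0.
by rewrite (bigD1 j)//= lerDl sumr_ge0// => i _; exact: sqr_ge0.
Qed.

Lemma norm2_sqr k (v : 'cV[R]_k) : norm2 v ^+ 2 = sqnorm v.
Proof. by rewrite sqr_sqrtr//; exact: sqnorm_ge0. Qed.

Lemma norm2_le_sup_norm y t : hist_fun s y -> itv_hist s t -> norm2 (y t) <= N y.
Proof.
move=> cy tJ; apply: ub_le_sup; last by exists t.
have bnd k : exists C : R, forall t, itv_hist s t -> `|y t k 0| <= C.
  have [C _ HC] := continuous_itv_bounded (hist_coord (k := k) cy).
  by exists C => u; rewrite /itv_hist/= in_itv/=; exact: HC.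
have [C HC] := choice bnd.
exists (Num.sqrt (\sum_k C k ^+ 2)) => _ [u uJ <-].
rewrite /norm2 ler_sqrt; last by apply: sumr_ge0 => k _; exact: sqr_ge0.
apply: ler_sum => k _; rewrite -[leLHS]real_normK ?num_real// ler_pXn2r ?nnegrE//.
  exact: HC.
by apply: le_trans (HC k _ uJ).
Qed.

Lemma sup_norm_ge0 y : hist_fun s y -> 0 <= N y.
Proof.
move=> cy; apply: le_trans (sqrtr_ge0 _) (norm2_le_sup_norm cy (delay_hist swf (leq0n nu))).
Qed.

Lemma hist_funB chi psi : hist_fun s chi -> hist_fun s psi ->
  hist_fun s (fun t => chi t - psi t).
Proof. by move=> cc cp t; apply: cvgB; [exact: cc|exact: cp]. Qed.

Lemma coord_le_sup_norm y t k : hist_fun s y -> itv_hist s t -> `|y t k 0| <= N y.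
Proof. by move=> cy tJ; apply: le_trans (norm2_coord _ _) (norm2_le_sup_norm cy tJ). Qed.

Definition sup_continuous (F : (R -> 'cV[R]_n) -> R) :=
  forall psi, hist_fun s psi -> forall e : R, 0 < e -> exists2 d : R, 0 < d &
    forall chi, hist_fun s chi -> N (fun t => chi t - psi t) < d ->
      `|F chi - F psi| < e.

Lemma eq_sup_continuous F G : (forall y, hist_fun s y -> F y = G y) ->
  sup_continuous F -> sup_continuous G.
Proof.
move=> FG cF psi hp e e0; have [d d0 H] := cF psi hp e e0.
by exists d => // chi hc; rewrite -!FG//; exact: H.
Qed.

Lemma sup_continuous_cst c : sup_continuous (fun=> c).
Proof. by move=> psi _ e e0; exists 1 => // chi _ _; rewrite subrr normr0. Qed.

Lemma sup_continuousD F G : sup_continuous F -> sup_continuous G ->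
  sup_continuous (fun y => F y + G y).
Proof.
move=> cF cG psi hp e e0; have e2 : 0 < e / 2 by rewrite divr_gt0.
have [d1 d10 H1] := cF psi hp _ e2; have [d2 d20 H2] := cG psi hp _ e2.
exists (Num.min d1 d2) => [|chi hc]; first by rewrite lt_min d10.
rewrite lt_min => /andP[h1 h2]; rewrite (splitr e) opprD addrACA.
by apply: le_lt_trans (ler_normD _ _) (ltrD (H1 _ hc h1) (H2 _ hc h2)).
Qed.

Lemma sup_continuousM F G : sup_continuous F -> sup_continuous G ->
  sup_continuous (fun y => F y * G y).
Proof.
move=> cF cG psi hp e e0.
pose B := 1 + `|F psi| + `|G psi|.
have B0 : 0 < B by rewrite /B -addrA ltr_pwDl// addr_ge0.
pose e' := Num.min 1 (e / (2 * B)).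
have e'0 : 0 < e' by rewrite lt_min ltr01 divr_gt0// mulr_gt0.
have [d1 d10 H1] := cF psi hp _ e'0; have [d2 d20 H2] := cG psi hp _ e'0.
exists (Num.min d1 d2) => [|chi hc]; first by rewrite lt_min d10.
rewrite lt_min => /andP[h1 h2]; have := H1 _ hc h1; have := H2 _ hc h2.
have e'1 : e' <= 1 by rewrite ge_min lexx.
have e'B : e' * B <= e / 2.
  have : e' <= e / (2 * B) by rewrite ge_min lexx orbT.
  rewrite -(ler_pM2r B0) => /le_trans; apply.
  by rewrite le_eqVlt; apply/orP; left; apply/eqP; field; rewrite gt_eqF.
move: (F chi) (G chi) => f g; rewrite /B in B0 e'B; clearbody e'.
move: (F psi) (G psi) B0 e'B => f0 g0 B0 e'B hg hf.
have -> : f * g - f0 * g0 = (f - f0) * (g - g0) + (f - f0) * g0 + f0 * (g - g0) by ring.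
apply: le_lt_trans (ler_normD _ _) _; apply: le_lt_trans (lerD (ler_normD _ _) (lexx _)) _.
rewrite !normrM.
have k1 : `|f - f0| * `|g - g0| <= e' * 1.
  by apply: ler_pM => //; [exact: ltW|apply: le_trans e'1; exact: ltW].
have k2 : `|f - f0| * `|g0| <= e' * `|g0| by rewrite ler_wpM2r// ltW.
have k3 : `|f0| * `|g - g0| <= e' * `|f0| by rewrite mulrC ler_wpM2r// ltW.
have k4 : e / 2 < e by lra.
move: e'B; rewrite !mulrDr; lra.
Qed.

Lemma sup_continuous_sum k (F : 'I_k -> (R -> 'cV[R]_n) -> R) :
  (forall i, sup_continuous (F i)) -> sup_continuous (fun y => \sum_i F i y).
Proof.
move=> cF; apply: (@eq_sup_continuous (\sum_i F i)) => [y _|]; first by rewrite fct_sumE.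
elim/big_ind : _ => [|F' G' cF' cG'|//]; first exact: sup_continuous_cst.
exact: sup_continuousD.
Qed.

Lemma sup_continuous_point t k : itv_hist s t -> sup_continuous (fun y => y t k 0).
Proof.
move=> tJ psi hp e e0; exists e => // chi hc; apply: le_lt_trans.
have := coord_le_sup_norm k (hist_funB hc hp) tJ.
by rewrite !mxE.
Qed.

(** The constant B may depend on psi, so that phi may be a product of two
    coordinates, which is Lipschitz on bounded sets only. *)
Lemma sup_continuous_integral i (f : R -> R) (phi : 'cV[R]_n -> R) :
  mu.-integrable (I i) (EFin \o f) ->
  (forall y, hist_fun s y -> {within I i, continuous (fun t => phi (y t))}) ->
  (forall psi, hist_fun s psi -> exists2 B : R, 0 <= B & forall chi, hist_fun s chi ->
    N (fun t => chi t - psi t) <= 1 -> forall t, itv_hist s t ->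
    `|phi (chi t) - phi (psi t)| <= B * N (fun t => chi t - psi t)) ->
  sup_continuous (fun y => \int[mu]_(t in I i) (f t * phi (y t))).
Proof.
move=> if_ cphi lphi psi hp e e0.
have [B B0 HB] := lphi psi hp.
pose A := \int[mu]_(t in I i) `|f t|.
have A0 : 0 <= A by exact: Rintegral_ge0.
have BA0 : 0 < B * A + 1 by rewrite ltr_wpDl// mulr_ge0.
exists (Num.min 1 (e / (B * A + 1))) => [|chi hc]; first by rewrite lt_min ltr01 divr_gt0.
rewrite lt_min => /andP[N1 Ne]; set d := N _ in N1 Ne.
have d0 : 0 <= d by apply: sup_norm_ge0; exact: hist_funB.
have int y : hist_fun s y -> mu.-integrable (I i) (EFin \o (fun t => f t * phi (y t))).
  move=> hy; have := continuousM_integrable (cphi _ hy) if_.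
  by apply: eq_integrable => [|t _ /=]; [exact: measurable_itv|rewrite mulrC].
have mI : measurable (I i : set (measurableTypeR R)) by exact: measurable_itv.
rewrite -RintegralB//; try exact: int.
have idiff : mu.-integrable (I i) (EFin \o (fun t => f t * phi (chi t) - f t * phi (psi t))).
  by apply: integrable_EFinB => //; exact: int.
apply: le_lt_trans (le_normr_Rintegral mI idiff) _.
apply: (@le_lt_trans _ _ (B * d * A)).
  rewrite -RintegralZl//; last exact: (integrable_norm if_).
  apply: le_Rintegral => //; first exact: (integrable_norm idiff).
    by apply: integrable_EFinZ => //; exact: (integrable_norm if_).
  move=> t tI; rewrite -mulrBr normrM mulrC ler_wpM2r//.
  by apply: HB => //; [exact: ltW|exact: (itv_delay_sub swf tI)].
move: Ne; rewrite ltr_pdivlMr// mulrDr mulr1 => h; apply: le_lt_trans h.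
by rewrite mulrAC mulrC lerDl.
Qed.

Lemma sup_continuous_integral1 i f k : mu.-integrable (I i) (EFin \o f) ->
  sup_continuous (fun y => \int[mu]_(t in I i) (f t * y t k 0)).
Proof.
move=> if_; apply: (sup_continuous_integral (phi := fun v => v k 0)) => // [y hy t|psi hp].
  by apply: (continuous_subspaceW (@itv_delay_sub _ _ _ _ _ _ _ swf i)); exact: hist_coord.
exists 1 => // chi hc _ t tJ; rewrite mul1r.
by have := coord_le_sup_norm k (hist_funB hc hp) tJ; rewrite !mxE.
Qed.

Lemma sup_continuous_integral2 i f k l : mu.-integrable (I i) (EFin \o f) ->
  sup_continuous (fun y => \int[mu]_(t in I i) (f t * (y t k 0 * y t l 0))).
Proof.
move=> if_; apply: (sup_continuous_integral (phi := fun v => v k 0 * v l 0)) => // [y hy t|psi hp].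
  apply: (continuous_subspaceW (@itv_delay_sub _ _ _ _ _ _ _ swf i)) => u.
  by apply: cvgM; exact: hist_coord.
exists (1 + 2 * N psi) => [|chi hc N1 t tJ].
  by rewrite addr_ge0// mulr_ge0// sup_norm_ge0.
have c1 := coord_le_sup_norm k (hist_funB hc hp) tJ; rewrite !mxE in c1.
have c2 := coord_le_sup_norm l (hist_funB hc hp) tJ; rewrite !mxE in c2.
have c3 := coord_le_sup_norm k hp tJ; have c4 := coord_le_sup_norm l hp tJ.
move: c1 c2 c3 c4 N1; move: (N psi) (N _) => M d.
move: (chi t k 0) (chi t l 0) (psi t k 0) (psi t l 0) => f1 g1 f0 g0 c1 c2 c3 c4 N1.
have -> : f1 * g1 - f0 * g0 = (f1 - f0) * (g1 - g0) + (f1 - f0) * g0 + f0 * (g1 - g0) by ring.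
apply: le_trans (ler_normD _ _) _; apply: le_trans (lerD (ler_normD _ _) (lexx _)) _.
rewrite !normrM.
have k1 : `|f1 - f0| * `|g1 - g0| <= d * 1.
  by apply: ler_pM => //; exact: le_trans N1.
have k2 : `|f1 - f0| * `|g0| <= d * M by exact: ler_pM.
have k3 : `|f0| * `|g1 - g0| <= M * d by exact: ler_pM.
lra.
Qed.

(** The functional is a polynomial in point values of the history and in
    integrals of one coordinate or of a product of two coordinates. *)
Lemma lyap_sup_continuous : sup_continuous (fun y => V y).
Proof.
have etac k : sup_continuous (fun y => lyap_state s L y k 0).
  case: (split_ordP k) => j ->.
    apply: eq_sup_continuous (sup_continuous_point j (delay_hist swf (leq0n nu))) => y _.
    by rewrite col_mxEu.
  pose i := tagnat.sig1 (mxtens_unindex j).1.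
  pose j1 : 'I_(dimf D i) := tagnat.sig2 (mxtens_unindex j).1.
  have ie : mu.-integrable (I i) (EFin \o (fun t => ef L i t j1 0)).
    by apply: sq_integrable1; exact: (L2_ef L sD (i := i) j1 0).
  apply: eq_sup_continuous (sup_continuous_integral1 (mxtens_unindex j).2 ie) => y _.
  rewrite col_mxEd vecmE [RHS]mxE [RHS]mxE; apply: eq_Rintegral => t _.
  by rewrite [RHS]mxE big_ord1 [X in _ = _ * X]mxE.
apply: sup_continuousD.
  apply: (@eq_sup_continuous (fun y => \sum_k \sum_l Pblock P1 P2 P3 k l *
      (lyap_state s L y k 0 * lyap_state s L y l 0))) => [y _|]; first by rewrite quadE.
  apply: sup_continuous_sum => k; apply: sup_continuous_sum => l.
  by apply: sup_continuousM; [exact: sup_continuous_cst|exact: sup_continuousM].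
apply: sup_continuous_sum => i.
pose f k l t := Q i k l + (t + delay s i.+1) * Rm i k l.
have if_ k l : mu.-integrable (I i) (EFin \o f k l).
  apply: continuous_integrable; apply: continuous_subspaceT => t.
  apply: cvgD; first exact: cvg_cst.
  by apply: cvgMl; apply: cvgD; [exact: cvg_id|exact: cvg_cst].
apply: (@eq_sup_continuous (fun y => \sum_k \sum_l
    \int[mu]_(t in I i) (f k l t * (y t k 0 * y t l 0)))) => [y hy|]; last first.
  by apply: sup_continuous_sum => k; apply: sup_continuous_sum => l;
    exact: sup_continuous_integral2.
have ikl k l : mu.-integrable (I i) (EFin \o (fun t => f k l t * (y t k 0 * y t l 0))).
  have cy : {within I i, continuous (fun t => y t k 0 * y t l 0)}.
    apply: (continuous_subspaceW (@itv_delay_sub _ _ _ _ _ _ _ swf i)) => u.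
    by apply: cvgM; exact: hist_coord.
  have h := continuousM_integrable cy (if_ k l).
  by apply: eq_integrable h => [|t _ /=]; [exact: measurable_itv|rewrite mulrC].
have mI : measurable (I i : set (measurableTypeR R)) by exact: measurable_itv.
transitivity (\int[mu]_(t in I i) \sum_k \sum_l (f k l t * (y t k 0 * y t l 0))).
  rewrite Rintegral_sum//; last by move=> k; exact: integrable_EFin_sum.
  by apply: eq_bigr => k _; rewrite Rintegral_sum.
apply: eq_Rintegral => t _; rewrite /quad quadE.
by apply: eq_bigr => k _; apply: eq_bigr => l _; rewrite /f !mxE.
Qed.

Lemma lyap_storage_functional :
  (forall i, posdefmx (Q i)) -> (forall i, posdefmx (Rm i)) ->
  posdefmx (Pblock P1 P2 P3 + oplus (0 : 'M[R]_n) (diagIQ D Q)) ->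
  storage_functional s (fun y => V y).
Proof.
move=> Qpd Rpd Ppd; split.
- move=> psi hp; have [c c0 Hc] := lyap_lower_bound sD Lwf Qpd Rpd Ppd.
  apply: le_trans (Hc _ (fun i => hist_L2 swf i hp)).
  by rewrite mulr_ge0 ?sqnorm_ge0// ltW.
- have eta0 : lyap_state s L (fun=> 0) = 0.
    apply/colP => k; case: (split_ordP k) => j ->; first by rewrite col_mxEu !mxE.
    rewrite col_mxEd vecmE !mxE; under eq_Rintegral do rewrite mxE big_ord1 !mxE mulr0.
    by rewrite Rintegral_cst ?mul0r//; exact: measurable_itv.
  rewrite /lyap eta0 mulmx0 mxE add0r big1// => i _.
  under eq_Rintegral do rewrite /quad mulmx0 mxE.
  by rewrite Rintegral_cst ?mul0r//; exact: measurable_itv.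
- exact: lyap_sup_continuous.
Qed.

End StorageFunctional.

(** * Bounds by the supremum of the history *)

Section HistoryBounds.
Context {R : realType} {n m p q nu : nat} (s : delay_system R n m p q nu)
        (D : decomposition R n m p nu) (L : factors D).
Notation mu := (@lebesgue_measure R).
Hypothesis swf : delay_system_wf s.
Hypothesis sD : decomposes s D.
Hypothesis Lwf : factors_wf s L.
Local Notation I i := (itv_delay s i).

Lemma weightR_bound (Rm : 'I_nu -> 'M[R]_n) : exists2 C : R, 0 < C &
  forall y M, (forall i, L2 (I i) y) -> (forall t, itv_hist s t -> sqnorm (y t) <= M) ->
    weightR s Rm y <= C * M.
Proof.
have term i : exists C : R, 0 < C /\ forall y M, L2 (I i) y ->
    (forall t, itv_hist s t -> sqnorm (y t) <= M) ->
    \int[mu]_(x in I i) quad (Rm i) (y x) <= C * M.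
  have [C C0 HC] := quad_form_bound (Rm i).
  have lt_ := itv_delay_lt swf i.
  exists (C * (- delay s i - - delay s i.+1)); split.
    by rewrite mulr_gt0// subr_gt0.
  move=> y M Ly yM.
  have mI : measurable (I i : set (measurableTypeR R)) by exact: measurable_itv.
  have -> : C * (- delay s i - - delay s i.+1) * M = \int[mu]_(x in I i) (cst (C * M)) x.
    rewrite Rintegral_cst// [X in fine X]lebesgue_measure_itv/= lte_fin lt_/=.
    by rewrite mulrAC.
  apply: le_Rintegral; [exact: mI|exact: quad_integrable| |].
    by apply: continuous_integrable; apply: continuous_subspaceT => x; exact: cvg_cst.
  move=> t tI; apply: le_trans (ler_norm _) _; apply: le_trans (HC _) _.
  by rewrite ler_wpM2l ?(ltW C0)// yM//; exact: (itv_delay_sub swf tI).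
have [C HC] := choice term.
exists (1 + \sum_i C i).
  by rewrite ltr_pwDl// sumr_ge0// => i _; rewrite ltW//; have [] := HC i.
move=> y M Ly yM.
have M0 : 0 <= M.
  by apply: le_trans (yM _ (delay_hist swf (leq0n nu))); exact: sqnorm_ge0.
rewrite mulrDl mul1r; apply: (@le_trans _ _ (\sum_i C i * M)); last by rewrite mulr_suml lerDr.
by apply: ler_sum => i _; have [_ H] := HC i; exact: H.
Qed.

(** The last two blocks contribute [projR] for R_i = 1, which Bessel's inequality
    bounds by an integral of |y|^2. *)
Lemma delay_state_bound : exists2 C : R, 0 < C &
  forall y M, (forall i, L2 (I i) y) -> (forall t, itv_hist s t -> sqnorm (y t) <= M) ->
    sqnorm (delay_state s L y) <= C * M.
Proof.
have [C C0 HC] := weightR_bound (fun=> 1%:M).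
exists (1 + nu%:R + C) => [|y M Ly yM]; first by rewrite ltr_wpDl// addr_ge0.
have -> : sqnorm (delay_state s L y) = sqnorm (y (- delay s 0)) +
    \sum_(i < nu) sqnorm (y (- delay s i.+1)) + projR s L (fun=> 1%:M) y.
  have sq_mxcol (d : 'I_nu -> nat) (u : forall i, 'cV[R]_(d i)) :
      sqnorm (\mxcol_i u i) = \sum_i sqnorm (u i).
    by rewrite sqnorm_dot mxcol_dot; apply: eq_bigr => i _; rewrite sqnorm_dot.
  rewrite /delay_state /stack !sqnorm_col_mx !sq_mxcol trmxK -addrA -big_split/=.
  congr (_ + _ + _).
    by apply: eq_bigr => i _; rewrite trmxK.
  by apply: eq_bigr => i _; rewrite !sqnorm_dot !vecm_dot !mulmx1.
rewrite !mulrDl mul1r; apply: lerD; first apply: lerD.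
- exact: yM (delay_hist swf (leq0n nu)).
- apply: (@le_trans _ _ (\sum_(i < nu) M)); last by rewrite sumr_const card_ord mulr_natl.
  by apply: ler_sum => i _; apply: yM; exact: delay_hist.
- apply: le_trans (projR_le sD Lwf (fun=> posdefmx1 n) Ly) _; exact: HC.
Qed.

End HistoryBounds.

(** * Dissipativity *)

Section Dissipativity.
Context {R : realType} {n m p q nu : nat} (s : delay_system R n m p q nu)
        (D : decomposition R n m p nu) (L : factors D).
Notation mu := (@lebesgue_measure R).
Hypothesis nu0 : (0 < nu)%N.
Hypothesis swf : delay_system_wf s.
Hypothesis sD : decomposes s D.
Hypothesis Lwf : factors_wf s L.
Variables (t0 : R) (J1 Jt : 'M[R]_m) (J2 : 'M[R]_(m, q)) (J3 : 'M[R]_q).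
Variables (K : 'M[R]_(p, n)) (P1 : 'M[R]_n) (P2 : 'M[R]_(n, dimF D * n))
  (P3 : 'M[R]_(dimF D * n)) (Q Rm : 'I_nu -> 'M[R]_n).
Hypothesis J1s : J1^T = J1.
Hypothesis J1u : J1 \in unitmx.
Hypothesis P1s : P1^T = P1.
Hypothesis P3s : P3^T = P3.
Hypothesis Qpd : forall i, posdefmx (Q i).
Hypothesis Rpd : forall i, posdefmx (Rm i).
Hypothesis Ppd : posdefmx (Pblock P1 P2 P3 + oplus (0 : 'M[R]_n) (diagIQ D Q)).
Hypothesis lmi : negdefmx (lmi_block s L K P1 P2 P3 Q Rm J1 Jt J2 J3).
Local Notation I i := (itv_delay s i).
Local Notation V y := (lyap s L P1 P2 P3 Q Rm y).

Section AlongOutput.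
Variables (psi : R -> 'cV[R]_n) (w : R -> 'cV[R]_q) (x : R -> 'cV[R]_n)
  (z : R -> 'cV[R]_m) (t1 t2 : R).
Hypothesis psi_hist : hist_fun s psi.
Hypothesis w_L2 : L2 `[t0, +oo[ w.
Hypothesis x_sol : is_solution s K t0 psi w x.
Hypothesis z_out : is_output s K t0 w x z.
Hypothesis t01 : t0 <= t1.
Hypothesis t12 : t1 <= t2.

Let t02 : t0 <= t2. Proof. exact: le_trans t12. Qed.
Local Notation xe := (extension s t0 t2 x).
Let xe_L2 t i : L2 (I i) (segment xe t).
Proof. exact: (extension_L2 nu0 swf psi_hist x_sol t02). Qed.

Let sub12 : `[t1, t2]%classic `<=` `[t0, +oo[%classic.
Proof. by move=> t; rewrite /= !in_itv/= andbT => /andP[h _]; exact: le_trans h. Qed.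

Let w12 : L2 `[t1, t2] w.
Proof. by apply: (L2_sub _ _ sub12 w_L2); exact: measurable_itv. Qed.

(** Measurability is a hypothesis. Almost everywhere z = Sigma (theta, w), where
    theta is bounded on [t1, t2] since the solution is continuous. *)
Lemma output_L2 : L2 `[t1, t2] z.
Proof.
move=> j k; rewrite (ord1 k).
have [C C0 HC] := delay_state_bound swf sD Lwf.
have [B B0 HB] := mulmx_bound (bSigma s L K).
have bnd k' : exists M : R, forall t, t1 - delay s nu <= t <= t2 -> `|xe t k' 0| <= M.
  have cx := extension_continuous nu0 swf psi_hist x_sol t02 (k := k').
  have cx' : {within `[t1 - delay s nu, t2], continuous (fun u => xe u k' 0)}.
    by apply: continuous_subspaceT => u; exact: cx.
  by have [M _ HM] := continuous_itv_bounded cx'; exists M.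
have [M HM] := choice bnd.
pose N := \sum_k M k ^+ 2.
have xN t : t1 <= t <= t2 -> sqnorm (delay_state s L (segment xe t)) <= C * N.
  move=> /andP[h1 h2]; apply: HC => [i|tau]; first exact: xe_L2.
  rewrite /itv_hist/= in_itv/= => /andP[h3 h4].
  apply: ler_sum => k' _; rewrite -[leLHS]real_normK ?num_real// ler_pXn2r ?nnegrE//.
    by apply: HM; apply/andP; split; lra.
  by apply: le_trans (HM k' t1 _) => //; rewrite t12 andbT gerBl ltW// (delay_gt0 nu0 swf).
have [mz ze] := z_out.
pose g t := B * (C * N) + B * sqnorm (w t).
apply: (sq_integrable_ae_le (g := g)).
- by apply: measurable_funS (mz j) => //; exact: measurable_itv.
- have mI : measurable (`[t1, t2]%classic : set (measurableTypeR R)) by exact: measurable_itv.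
  apply: integrable_EFinD => //.
    by apply: continuous_integrable; apply: continuous_subspaceT => t; exact: cvg_cst.
  apply: integrable_EFinZ => //; apply: integrable_EFin_sum => // k'.
  by have [] := w12 k' 0.
have aeF := @ae_filter_ringOfSetsType _ _ _ mu.
apply: (@filterS _ _ aeF _ _ _ ze) => t zt tt; have /andP[h1 h2] := tt.
have t0t : t0 <= t by exact: le_trans h1.
rewrite zt// (output_rhsE nu0 swf sD Lwf psi_hist x_sol t02); last first.
  by rewrite t0t/= (le_trans h2)// lerDl.
apply: (@le_trans _ _ (sqnorm (bSigma s L K *m col_mx (delay_state s L (segment xe t)) (w t)))).
  by rewrite /sqnorm (bigD1 j)//= lerDl sumr_ge0// => i _; exact: sqr_ge0.
apply: le_trans (HB _) _; rewrite sqnorm_col_mx mulrDr lerD2r ler_wpM2l ?(ltW B0)//.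
exact: xN.
Qed.

Lemma supply_integrable : mu.-integrable `[t1, t2]
  (EFin \o (fun t => supply J1 Jt J2 J3 (z t) (w t))).
Proof.
have Lzw := L2_col_mx output_L2 w12.
have mI : measurable (`[t1, t2]%classic : set (measurableTypeR R)) by exact: measurable_itv.
pose B := block_mx (Jt^T *m invmx J1 *m Jt) J2 J2^T J3.
have h : mu.-integrable `[t1, t2] (EFin \o (fun t => \sum_k \sum_l B k l *
    (col_mx (z t) (w t) k 0 * col_mx (z t) (w t) l 0))).
  apply: integrable_EFin_sum => // k; apply: integrable_EFin_sum => // l.
  apply: integrable_EFinZ => //.
  exact: (sq_integrableM (Lzw k 0) (Lzw l 0)).
by apply: eq_integrable h => [|t _ /=]; [exact: mI|rewrite /supply quadE].
Qed.

Lemma lyap_increment_le :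
  V (segment x t2) - V (segment x t1) <=
  \int[mu]_(t in `[t1, t2]) supply J1 Jt J2 J3 (z t) (w t).
Proof.
have Vx t : t1 <= t <= t2 -> V (segment x t) = V (segment xe t).
  move=> /andP[h1 h2]; apply: lyap_extension => //.
  by rewrite (le_trans t01)//= (le_trans h2)// lerDl.
rewrite !Vx ?lexx ?t12//.
apply: (ac_increment_le t12 (y := fun t => V (segment xe t))).
- apply: (ac_sub t01 (lexx t2)).
  exact: (lyap_ac L nu0 swf sD _ _ _ _ _ psi_hist x_sol t02).
- exact: supply_integrable.
have [e e0 He] := lyap_deriv_le sD Lwf Rpd J1s J1u lmi.
have [_ ze] := z_out.
have aeF := @ae_filter_ringOfSetsType _ _ _ mu.
have dV := lyap_is_derive nu0 swf sD Lwf P2 Q Rm P1s P3s psi_hist x_sol t02.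
apply: (@filterS2 _ _ aeF _ _ _ _ dV ze) => t dVt zt /andP[h1 h2].
have t0t : t0 <= t by exact: le_trans h1.
exists (lyap_deriv s L K P1 P2 P3 Q Rm (segment xe t) (w t)).
  by apply: dVt; rewrite t0t.
rewrite zt// (output_rhsE nu0 swf sD Lwf psi_hist x_sol t02); last first.
  by rewrite t0t/= (le_trans h2)// lerDl.
apply: le_trans (He _ _ (xe_L2 t)) _.
have PW := projR_le sD Lwf Rpd (xe_L2 t).
rewrite -addrA gerDl subr_le0; apply: (@le_trans _ _ 0); last by rewrite subr_ge0.
by rewrite oppr_le0 mulr_ge0 ?sqnorm_ge0// ltW.
Qed.

End AlongOutput.

Lemma lyap_dissipative : dissipative s K t0 (supply J1 Jt J2 J3).
Proof.
exists (fun y => V y); first exact: lyap_storage_functional.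
move=> psi w x z hpsi wL xs zs t1 t2 h1 h2.
exact: (lyap_increment_le hpsi wL xs zs h1 h2).
Qed.

End Dissipativity.

(** * Exponential stability *)

Section ExponentialStability.
Context {R : realType} {n m p q nu : nat} (s : delay_system R n m p q nu)
        (D : decomposition R n m p nu) (L : factors D).
Notation mu := (@lebesgue_measure R).
Hypothesis nu0 : (0 < nu)%N.
Hypothesis swf : delay_system_wf s.
Hypothesis sD : decomposes s D.
Hypothesis Lwf : factors_wf s L.
Variables (t0 : R) (J1 Jt : 'M[R]_m) (J2 : 'M[R]_(m, q)) (J3 : 'M[R]_q).
Variables (K : 'M[R]_(p, n)) (P1 : 'M[R]_n) (P2 : 'M[R]_(n, dimF D * n))
  (P3 : 'M[R]_(dimF D * n)) (Q Rm : 'I_nu -> 'M[R]_n).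
Hypothesis J1s : J1^T = J1.
Hypothesis J1u : J1 \in unitmx.
Hypothesis Jneg : negsemidefmx (Jt^T *m invmx J1 *m Jt).
Hypothesis P1s : P1^T = P1.
Hypothesis P3s : P3^T = P3.
Hypothesis Qpd : forall i, posdefmx (Q i).
Hypothesis Rpd : forall i, posdefmx (Rm i).
Hypothesis Ppd : posdefmx (Pblock P1 P2 P3 + oplus (0 : 'M[R]_n) (diagIQ D Q)).
Hypothesis lmi : negdefmx (lmi_block s L K P1 P2 P3 Q Rm J1 Jt J2 J3).
Local Notation I i := (itv_delay s i).
Local Notation V y := (lyap s L P1 P2 P3 Q Rm y).

(** With w = 0, [lyap_decay] makes the functional decay exponentially. It bounds
    |x(t)|^2 from above, and its initial value is bounded by the square of the sup
    norm of psi. *)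
Lemma lyap_exp_stable : globally_exp_stable s K t0.
Proof.
have [l l0 Hl] := lyap_decay swf sD Lwf Rpd J1s J1u Jneg lmi.
have [c c0 Hc] := lyap_lower_bound sD Lwf Qpd Rpd Ppd.
have [k k0 Hk] := lyap_upper_bound swf sD Lwf P1 P2 P3 Q Rpd.
have [C C0 HC] := weightR_bound swf Rm.
pose G := k * (1 + C) / c.
have G0 : 0 < G by rewrite divr_gt0// mulr_gt0// addr_gt0.
exists (Num.sqrt G), (l / 2); split; [by rewrite sqrtr_gt0|by rewrite divr_gt0|].
move=> psi x hpsi xs T tT.
have N0 := sup_norm_ge0 swf hpsi.
have yT t i : L2 (I i) (segment (extension s t0 T x) t).
  exact: (extension_L2 nu0 swf hpsi xs tT).
have decay := ac_gronwall (ltW l0) tT (lyap_ac L nu0 swf sD P1 P2 P3 Q Rm hpsi xs tT).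
have {}decay : V (segment (extension s t0 T x) T) <=
    expR (- (l * (T - t0))) * V (segment (extension s t0 T x) t0).
  apply: decay; have aeF := @ae_filter_ringOfSetsType _ _ _ mu.
  have dV := lyap_is_derive nu0 swf sD Lwf P2 Q Rm P1s P3s hpsi xs tT.
  apply: (@filterS _ _ aeF _ _ _ dV) => t dVt tt.
  exists (lyap_deriv s L K P1 P2 P3 Q Rm (segment (extension s t0 T x) t) 0).
    exact: dVt.
  by apply: Hl => i; exact: yT.
have init : V (segment (extension s t0 T x) t0) = V psi.
  rewrite -lyap_extension//; last by rewrite lexx (le_trans tT)// lerDl.
  apply: (eq_lyap L swf) => tau tauJ; have [xpsi _ _] := xs.
  by rewrite /segment xpsi// mem_set.
have psiN t : itv_hist s t -> sqnorm (psi t) <= sup_norm s psi ^+ 2.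
  move=> tJ; rewrite -norm2_sqr ler_pXn2r ?nnegrE ?sqrtr_ge0//.
  exact: norm2_le_sup_norm.
have Vpsi : V psi <= k * (1 + C) * sup_norm s psi ^+ 2.
  have Lpsi i := hist_L2 swf i hpsi.
  apply: le_trans (Hk _ Lpsi) _; rewrite -mulrA ler_wpM2l ?(ltW k0)//.
  rewrite mulrDl mul1r lerD//; last exact: HC.
  exact: psiN (delay_hist swf (leq0n nu)).
have xT : c * sqnorm (x T) <= V (segment (extension s t0 T x) T).
  apply: le_trans (Hc _ (yT T)); rewrite /segment (delay0 swf) oppr0 addr0.
  rewrite extensionE ?lerDl//; have := delay_gt0 nu0 swf; lra.
rewrite -(@ler_pXn2r _ 2) ?nnegrE ?sqrtr_ge0//; last first.
  by rewrite !mulr_ge0 ?sqrtr_ge0 ?expR_ge0.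
rewrite norm2_sqr !exprMn sqr_sqrtr ?(ltW G0)// -expRM_natl.
have -> : 2 * (- (l / 2) * (T - t0)) = - (l * (T - t0)) by field.
rewrite -(ler_pM2l c0); apply: le_trans xT _; apply: le_trans decay _.
rewrite init (_ : c * _ = expR (- (l * (T - t0))) * (k * (1 + C) * sup_norm s psi ^+ 2)).
  by rewrite ler_wpM2l ?expR_ge0.
by rewrite /G; field; rewrite gt_eqF.
Qed.

End ExponentialStability.

(** * Dissipativity and stability from the matrix inequality *)

Theorem theorem1 (R : realType) (n m p q nu : nat)
    (s : delay_system R n m p q nu) (t0 : R)
    (J1 Jt : 'M[R]_m) (J2 : 'M[R]_(m, q)) (J3 : 'M[R]_q)
    (D : decomposition R n m p nu) (L : factors D)
    (K : 'M[R]_(p, n)) (P1 : 'M[R]_n) (P2 : 'M[R]_(n, dimF D * n))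
    (P3 : 'M[R]_(dimF D * n)) (Q Rm : 'I_nu -> 'M[R]_n) :
  (0 < n)%N -> (0 < m)%N -> (0 < p)%N -> (0 < q)%N -> (0 < nu)%N ->
  delay_system_wf s ->
  J1^T = J1 -> J1 \in unitmx -> negdefmx (invmx J1) ->
  negsemidefmx (Jt^T *m invmx J1 *m Jt) -> J3^T = J3 ->
  decomposes s D -> factors_wf s L ->
  P1^T = P1 -> P3^T = P3 ->
  (forall i, (Q i)^T = Q i) -> (forall i, (Rm i)^T = Rm i) ->
  posdefmx (Pblock P1 P2 P3 + oplus (0 : 'M[R]_n) (diagIQ D Q)) ->
  posdefmx (\mxdiag_(i < nu) Q i) -> posdefmx (\mxdiag_(i < nu) Rm i) ->
  negdefmx (lmi_block s L K P1 P2 P3 Q Rm J1 Jt J2 J3) ->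
  [/\ lmi_block s L K P1 P2 P3 Q Rm J1 Jt J2 J3 =
        Sy ((bP q L P1 P2)^T *m bPi s L K)
        + bPhi s L K P2 P3 Q Rm J1 Jt J2 J3,
      dissipative s K t0 (supply J1 Jt J2 J3) &
      globally_exp_stable s K t0].
Proof.
move=> _ _ _ _ nu0 swf J1s J1u _ Jneg _ sD Lwf P1s P3s _ _ Ppd Qpd Rpd lmi.
have {}Qpd := posdefmx_mxdiag Qpd; have {}Rpd := posdefmx_mxdiag Rpd.
split; first exact: lmi_blockE.
- exact: (lyap_dissipative nu0 swf sD Lwf t0 J1s J1u P1s P3s Qpd Rpd Ppd lmi).
- exact: (lyap_exp_stable nu0 swf sD Lwf t0 J1s J1u Jneg P1s P3s Qpd Rpd Ppd lmi).
Qed.
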